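(* For every integer $N\ge 2$, the Möbius ladder $M_{2N+1}$ is intrinsically chiral.
   Context: A Möbius ladder $M_n$ with $n$ rungs is the graph obtained from a circle with $2n$ vertices by adding an edge between every pair of antipodal vertices. Embeddings of graphs in $S^3$ are tame. A graph embedded in $S^3$ is achiral if there is an orientation reversing homeomorphism of $S^3$ that takes the embedded graph to itself setwise (edge labels and edge orientations are disregarded); otherwise it is chiral. An abstract graph is intrinsically chiral if every embedding of the graph in $S^3$ is chiral. *)

(* Defs.v *)
From HB Require Import structures.
From mathcomp Require Import all_boot all_order all_algebra.
From mathcomp Require Import all_classical reals topology normedtype.
From mathcomp.multinomials Require Import freeg.

Set Implicit Arguments.
Unset Strict Implicit.
Unset Printing Implicit Defensive.

Import Order.TTheory GRing.Theory Num.Theory.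
Import numFieldNormedType.Exports.

Local Open Scope classical_set_scope.
Local Open Scope ring_scope.

(* Finite simple graphs; the vertices are numbered. *)
Record simple_graph := SimpleGraph {
  order : nat;
  adj : rel 'I_order;
  adj_sym : symmetric adj;
  adj_irr : irreflexive adj }.

(* The circle 0 - 1 - ... - (2n-1) - 0 with a rung between i and i + n.
   For n = 1 the parallel edges of the multigraph M_1 are merged, and n = 0
   gives the empty graph; for n >= 2 this is exactly M_n. *)
Definition moebius_adj (n : nat) : rel 'I_(2 * n) := fun i j =>
  [|| (j == i.+1 %% (2 * n) :> nat)%N, (i == j.+1 %% (2 * n) :> nat)%N
    | (j == (i + n) %% (2 * n) :> nat)%N].

Lemma moebius_adj_sym n : symmetric (@moebius_adj n).
Proof.
suff rung (i j : 'I_(2 * n)) :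
    (j == (i + n) %% (2 * n) :> nat)%N -> (i == (j + n) %% (2 * n) :> nat)%N.
  move=> i j; rewrite /moebius_adj orbCA; do 2!congr (_ || _).
  by apply/idP/idP; exact: rung.
move=> /eqP ->; rewrite modnDml -addnA addnn -mul2n modnDr.
by rewrite modn_small.
Qed.

Lemma moebius_adj_irr n : irreflexive (@moebius_adj n).
Proof.
case: n => [[]//|n] i; have lt_i := ltn_ord i.
have nofix k : (0 < k < 2 * n.+1)%N ->
    (i == (i + k) %% (2 * n.+1) :> nat)%N = false.
  move=> /andP[k_gt0 k_lt]; apply/negbTE/negP => /eqP ik.
  have: (i + 0 == i + k %[mod 2 * n.+1])%N.
    by rewrite addn0 -ik modn_small // eqxx.
  rewrite eqn_modDl mod0n modn_small // => /eqP k0.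
  by rewrite -k0 in k_gt0.
have nofixS : (i == i.+1 %% (2 * n.+1) :> nat)%N = false.
  by rewrite -[X in (X %% _)%N]addn1 nofix // mul2n.
have nofix_n : (i == (i + n.+1) %% (2 * n.+1) :> nat)%N = false.
  by rewrite nofix // ltn_Pmull.
by rewrite /moebius_adj nofixS nofix_n.
Qed.

Definition moebius_ladder (n : nat) : simple_graph :=
  SimpleGraph (@moebius_adj_sym n) (@moebius_adj_irr n).

(* The underlying space of G: the union of the segments joining the basis
   vectors delta_i and delta_j, for i, j adjacent (or equal). *)
Definition realization (R : realType) (G : simple_graph) :
    set 'rV[R]_(order G) :=
  [set x | exists i j (t : R), [/\ i = j \/ adj i j, 0 <= t <= 1
    & x = t *: delta_mx 0 i + (1 - t) *: delta_mx 0 j]].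
Arguments realization : clear implicits.

(* The unit sphere of R^4. The library norm on 'rV[R]_4 is the sup norm. *)
Definition sphere3 (R : realType) : set 'rV[R]_4 :=
  [set x | \sum_i (x 0 i) ^+ 2 = 1].
Arguments sphere3 : clear implicits.

Definition is_homeo (X Y : topologicalType) (h : continuousType X Y) : Prop :=
  exists g : continuousType Y X, cancel h g /\ cancel g h.

(* Topological embeddings: f is injective and X carries the topology induced
   by f. *)
Definition is_embedding (X Y : topologicalType) (f : X -> Y) : Prop :=
  injective f /\
  forall A : set X, open A <-> exists2 B : set Y, open B & f @^-1` B = A.

Section SingularHomology.
Variable R : realType.

Definition stdsimplex (k : nat) : set 'rV[R]_k.+1 :=
  [set x | (forall j, 0 <= x 0 j) /\ \sum_j x 0 j = 1].
Arguments stdsimplex : clear implicits.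

(* Insertion of a zero at the i-th barycentric coordinate. *)
Definition insert0 (k : nat) (i : 'I_k.+2) (x : 'rV[R]_k.+1) : 'rV[R]_k.+2 :=
  \row_j oapp (x 0) 0 (unlift i j).

Lemma insert0_stdsimplex k (i : 'I_k.+2) (x : stdsimplex k) :
  insert0 i (set_val x) \in stdsimplex k.+1.
Proof.
have [x_ge0 x_sum] := set_valP x; apply/mem_set; split.
  by move=> j; rewrite mxE; case: unlift => /=.
rewrite (bigD1_ord i) //= mxE unlift_none add0r -x_sum.
by apply: eq_bigr => j _; rewrite mxE liftK.
Qed.

Definition face (k : nat) (i : 'I_k.+2) (x : stdsimplex k) : stdsimplex k.+1 :=
  exist _ (insert0 i (set_val x)) (insert0_stdsimplex i x).

Lemma face_continuous k (i : 'I_k.+2) : continuous (@face k i).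
Proof.
apply: (@continuous_comp_initial (stdsimplex k.+1) _ _ set_val).
move=> x U /= [P UP sPU].
have row_nbhs j :
    nbhs (set_val x) [set y : 'rV[R]_k.+1 | P 0 j (insert0 i y 0 j)].
  have := UP 0 j; rewrite !mxE; case Ej: (unlift i j) => [j'|] /= Pj.
    have : nbhs (set_val x) ((fun y : 'rV[R]_k.+1 => y 0 j') @^-1` P 0 j).
      exact: coord_continuous.
    by apply: filterS => y /=; rewrite mxE Ej.
  by apply: filterE => y /=; rewrite mxE Ej; exact: nbhs_singleton.
have all_nbhs := filter_forall (nbhs_filter (set_val x)) row_nbhs.
have val_cts : continuous (set_val : stdsimplex k -> 'rV[R]_k.+1).
  exact: initial_continuous.
apply: (@filterS _ (nbhs x) _ _ _ _ (val_cts x _ all_nbhs)) => y Py.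
apply: sPU => i' j.
by rewrite (ord1 i') /=; exact: Py.
Qed.

HB.instance Definition _ k (i : 'I_k.+2) :=
  isContinuous.Build _ _ (@face k i) (@face_continuous k i).

Definition sing (k : nat) (X : topologicalType) :=
  continuousType (stdsimplex k) X.

Definition chain (k : nat) (X : topologicalType) := {freeg (sing k X) / int}.

Definition boundary (k : nat) (X : topologicalType) (c : chain k.+1 X) :
    chain k X :=
  fglift (fun s : sing k.+1 X =>
    \sum_(i < k.+2) (-1) ^+ i *: << (s \o face i : sing k X) >>) c.

Definition pushforward (k : nat) (X Y : topologicalType)
    (h : continuousType X Y) (c : chain k X) : chain k Y :=
  fglift (fun s : sing k X => << (h \o s : sing k Y) >>) c.

Definition homologous (k : nat) (X : topologicalType) (c d : chain k X) :
    Prop :=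
  exists w : chain k.+1 X, boundary w = c - d.

End SingularHomology.

Section SpatialGraphs.
Variable R : realType.
Local Notation S3 := (sphere3 R).

(* h acts as -1 on the third singular homology group of the 3-sphere, which is
   infinite cyclic. *)
Definition orientation_reversing (h : continuousType S3 S3) : Prop :=
  forall z : chain R 3 S3, boundary z = 0 ->
    homologous (pushforward h z) (- z).

(* The shortest great-circle arc from a to b if b <> - a; for b = - a this set
   degenerates to the two points a and b. *)
Definition geodesic_segment (a b : S3) : set S3 :=
  [set x | exists s t : R, [/\ 0 <= s, 0 <= t
    & set_val x = s *: set_val a + t *: set_val b]].

(* The great-circle segments are the radial projections of straight segments of
   R^4, so polygonal sets are the (at most) one-dimensional polyhedra of the
   standard PL structure of the 3-sphere. *)
Definition polygonal (A : set S3) : Prop :=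
  exists s : seq (S3 * S3),
    A = \bigcup_(p in [set` s]) geodesic_segment p.1 p.2.

Definition tame (A : set S3) : Prop :=
  exists h : continuousType S3 S3, is_homeo h /\ polygonal (h @` A).

Definition achiral (A : set S3) : Prop :=
  exists h : continuousType S3 S3,
    [/\ is_homeo h, orientation_reversing h & h @` A = A].

Definition chiral (A : set S3) : Prop := ~ achiral A.

Definition intrinsically_chiral (G : simple_graph) : Prop :=
  forall f : realization R G -> S3,
    is_embedding f -> tame (range f) -> chiral (range f).

End SpatialGraphs.

(* Main.v *)
(** For two disjoint edges e, f of a graph embedded in S^3 in R^4, the join of
    f with the antipode of e is a singular 3-simplex that radial projection
    sends to S^3. In the sub-ladder of M_n formed by the outer circle and three
    consecutive rungs, a copy of K_{3,3}, the disjoint pairs of edges form a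
    closed surface, so these joins add up to a 3-cycle; let L_i be its degree,
    for the rungs i, i+1, i+2 (Simon's linking invariant). Each L_i is odd: by
    a Borsuk-Ulam argument the antipode changes the cochain computing the degree
    by a coboundary, which reduces the parity to a count over K_{3,3}. The sum of the
    L_i over i < n does not change under the dihedral symmetries of M_n, and it is
    odd for n odd.

    Let h reverse the orientation and preserve the embedded graph f. Then h
    negates the degree of each 3-cycle. The self-map phi = f^-1 h f of the graph
    fixes the set of vertices (points with three arcs attached) and maps edges
    to edges, so it is homotopic to an automorphism sigma of M_n along maps that
    keep disjoint edges disjoint; for n >= 4 the rungs are the only edges lying
    in two squares, whence sigma is dihedral. Hence the sum
    of the L_i equals its own negative, although it is odd.

    Degrees are computed combinatorially: cochains are integer functions on lists
    of vertices, and the degree of a small simplex is its intersection number with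
    a half-line, in general position thanks to the moment curve. Iterated
    barycentric subdivision and acyclic carriers replace the homotopies. *)

From HB Require Import structures.
From mathcomp Require Import all_boot all_order all_algebra.
From mathcomp Require Import all_classical reals topology normedtype realfun.
From mathcomp.multinomials Require Import freeg.
From mathcomp Require Import zify ring lra.
Require Import Defs.

Set Implicit Arguments.
Unset Strict Implicit.
Unset Printing Implicit Defensive.

Import Order.TTheory GRing.Theory Num.Theory.
Import numFieldNormedType.Exports.

Local Open Scope classical_set_scope.
Local Open Scope ring_scope.

(** * Cochains on vertex lists *)

(** The antipode stands in for subtraction. For a graph in R^3 the degree would be that of the
    direction of f(y) - f(x) over pairs of points on disjoint edges; for unit vectors of R^4 the
    segment from - f(x) to f(y) misses the origin exactly when f(x) and f(y) differ, so the join
    plays that part.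

    The third homology group of the sphere is never computed. A degree is the value on a cycle of
    one explicit function [D] of four vectors, and topology enters only through [locally_cocycle]:
    the coboundary of [D] vanishes on simplices whose hull misses the origin. Reversal of
    orientation provides a chain bounded by h(z) + z; after enough subdivisions each of its pieces
    has its image in a small ball, where [D] is a cocycle, so [D] takes opposite values on h(z) and
    z.

    The half-line behind [D] has to be generic for the sample points of the ladder and is therefore
    chosen last. This is why every bound on the sampling density [M] and on the number [m] of
    subdivisions is stated uniformly in [D]. *)

Section Cochains.
Variable T : eqType.
Implicit Types (F G : seq T -> int) (s : seq T).

(* Coboundary in the augmented complex: s is a simplex given by the list of its
   vertices, and the empty list is the (-1)-dimensional simplex. *)
Fixpoint cob F s : int :=
  if s is x :: s' then F s' - cob (fun u => F (x :: u)) s' else 0.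

Lemma cobE F s :
  cob F s = \sum_(i < size s) (-1) ^+ i * F (take i s ++ drop i.+1 s).
Proof.
elim: s F => [|x s IH] F /=; first by rewrite big_ord0.
rewrite big_ord_recl /= drop0 expr0 mul1r IH; congr (_ + _).
by rewrite -sumrN; apply: eq_bigr => i _; rewrite /= exprS mulN1r mulNr.
Qed.

Lemma eq_cob_face F G s :
  (forall s', (size s').+1 = size s -> {subset s' <= s} -> F s' = G s') ->
  cob F s = cob G s.
Proof.
move=> FG; rewrite !cobE; apply: eq_bigr => i _; congr (_ * _); apply: FG.
  by rewrite size_cat size_take size_drop ltn_ord; have := ltn_ord i; lia.
by move=> y; rewrite mem_cat => /orP[/mem_take|/mem_drop].
Qed.

Lemma eq_cob F G s : F =1 G -> cob F s = cob G s.
Proof. by move=> FG; apply: eq_cob_face => u _ _; exact: FG. Qed.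

Lemma cob_face0 F s :
  (forall s', (size s').+1 = size s -> {subset s' <= s} -> F s' = 0) ->
  cob F s = 0.
Proof.
move=> F0; rewrite (@eq_cob_face F (fun=> 0))//.
by elim: s {F F0} => //= x s ->; rewrite subr0.
Qed.

Lemma cobZ (a : int) F s : cob (fun u => a * F u) s = a * cob F s.
Proof.
by elim: s F => [|x s IH] F /=; rewrite ?mulr0// IH mulrBr.
Qed.

Lemma cobB F G s : cob (fun u => F u - G u) s = cob F s - cob G s.
Proof.
elim: s F G => [|x s IH] F G /=; rewrite ?subr0// IH; ring.
Qed.

Lemma cob_cob F s : cob (cob F) s = 0.
Proof.
elim: s F => //= x s IH F.
by rewrite cobB IH subr0 subrr.
Qed.

Definition alternating F :=
  forall s1 x y s2, F (s1 ++ x :: y :: s2) = - F (s1 ++ y :: x :: s2).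

Lemma alternating_cob F : alternating F -> alternating (cob F).
Proof.
move=> altF s1; elim: s1 F altF => [|a s1 IH] F altF x y s2 /=.
  have -> : cob (fun u => F [:: y, x & u]) s2
      = - cob (fun u => F [:: x, y & u]) s2.
    rewrite -[RHS]mulN1r -cobZ; apply: eq_cob => u.
    by rewrite mulN1r -(altF [::]).
  by ring.
rewrite altF (IH (fun u => F (a :: u))) ?opprD// => s' *.
by rewrite -!cat_cons altF.
Qed.

End Cochains.

Lemma cob_map (T U : eqType) (g : T -> U) (F : seq U -> int) s :
  cob F (map g s) = cob (fun u => F (map g u)) s.
Proof. by elim: s F => //= x s IH F; rewrite IH. Qed.

(* Acyclic carriers: two chain maps, written as the maps Phi and F |-> F \o map
   psi that they induce on cochains, agree on cycles as soon as all simplices of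
   the cone construction stay in the carriers [P s]. *)
Section Carrier.
Variables (T U : eqType) (Phi : (seq U -> int) -> seq T -> int).
Variables (psi : T -> U) (apex : seq T -> U).
Hypothesis Phi_nil : forall F, Phi F [::] = F [::].
Hypothesis PhiB : forall F G s, Phi (fun u => F u - G u) s = Phi F s - Phi G s.
Hypothesis Phi_cob : forall F s, cob (Phi F) s = Phi (cob F) s.

(** Dual of the inductive chain homotopy H(s) = b * (Phi(s) - psi(s) - H(ds)), where b * c is the
    cone over c with apex b = [apex s]. The argument [n] is fuel: each recursive call drops one
    dimension. *)
Fixpoint carrier_htpy (n : nat) (F : seq U -> int) (s : seq T) : int :=
  if n is n'.+1 then
    let G u := F (apex s :: u) in
    Phi G s - G (map psi s) - cob (carrier_htpy n' G) s
  else 0.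

Lemma carrier_htpyB n F G s :
  carrier_htpy n (fun u => F u - G u) s =
  carrier_htpy n F s - carrier_htpy n G s.
Proof.
elim: n F G s => [|n IH] F G s /=; first by rewrite subr0.
rewrite PhiB (eq_cob (G := fun u => carrier_htpy n (fun u => F (apex s :: u)) u
   - carrier_htpy n (fun u => G (apex s :: u)) u)); last by move=> u; rewrite IH.
by rewrite cobB; ring.
Qed.

(** The boundary of a cone is its base minus the cone over the boundary of its base:
    [cob F (apex s :: u)] unfolds to [F u - cob G u]. The formula for [G] on the faces of [s], known
    by induction, then leaves only a double coboundary. *)
Lemma carrier_htpyE n F s : (size s <= n)%N ->
  Phi F s - F (map psi s) =
  cob (carrier_htpy n F) s + carrier_htpy n.+1 (cob F) s.
Proof.
elim: n F s => [|n IH] F s sn.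
  by case: s sn => // _ /=; rewrite !Phi_nil !subrr.
pose G u := F (apex s :: u).
have -> : carrier_htpy n.+2 (cob F) s =
    Phi (fun u => F u - cob G u) s - (F (map psi s) - cob G (map psi s)) -
    cob (carrier_htpy n.+1 (fun u => F u - cob G u)) s by [].
rewrite PhiB; have -> : cob (carrier_htpy n.+1 (fun u => F u - cob G u)) s =
    cob (carrier_htpy n.+1 F) s - (Phi (cob G) s - cob G (map psi s)).
  rewrite (eq_cob _ (carrier_htpyB n.+1 F (cob G))) cobB; congr (_ - _).
  rewrite -Phi_cob cob_map -cobB -[RHS]subr0 -(cob_cob (carrier_htpy n G) s).
  rewrite -cobB; apply: eq_cob_face => s' ss' _.
  by rewrite IH ?addrK ?[_ + carrier_htpy _ _ _]addrC ?addrK//; lia.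
ring.
Qed.

(** [P s u] reads: the simplex [u] lies in the carrier of [s]. The four hypotheses say that [Phi]
    and [psi] respect carriers, that coning from [apex s] stays inside, and that carriers are
    monotone; the recursion then evaluates [F] inside the carrier of [s] only. *)
Lemma carrier_htpy0 (P : seq T -> seq U -> Prop) n F (s0 s : seq T) :
  (forall (s : seq T) H, (size s <= size s0)%N -> {subset s <= s0} ->
    (forall u, P s u -> H u = 0) -> Phi H s = 0) ->
  (forall s : seq T, {subset s <= s0} -> P s (map psi s)) ->
  (forall (s : seq T) u, s != [::] -> {subset s <= s0} -> P s u -> P s (apex s :: u)) ->
  (forall (s s' : seq T) u, {subset s <= s0} -> {subset s' <= s} -> P s' u -> P s u) ->
  (size s <= size s0)%N -> {subset s <= s0} -> (forall u, P s u -> F u = 0) ->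
  carrier_htpy n F s = 0.
Proof.
move=> PPhi Ppsi Papex Psub; elim: n F s => //= n IH F s sz ss0 F0.
have [->|s_neq0] := eqVneq s [::].
  by rewrite /= Phi_nil subrr subr0.
have G0 u : P s u -> F (apex s :: u) = 0 by move/(Papex _ _ s_neq0 ss0)/F0.
rewrite (PPhi _ _ sz ss0 G0) (G0 _ (Ppsi _ ss0)) subrr sub0r.
rewrite cob_face0 ?oppr0// => s' ss' s's; apply: IH => [|y /s's/ss0//|u Pu].
  by apply: leq_trans sz; rewrite -ss'.
exact/G0/(Psub _ _ _ _ s's).
Qed.

End Carrier.

(** * Intersection numbers with half-spaces *)

Section Hull.
Variables (R : realType) (V : lmodType R).
Implicit Types (C : V -> Prop) (s : seq V) (u v w : V).

Definition is_convex C := forall u v (t : R),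
  C u -> C v -> 0 <= t <= 1 -> C (t *: u + (1 - t) *: v).

(** Encoded as an intersection of convex sets, so that a property of all points of a hull follows
    from one convex predicate, without barycentric coordinates. *)
Definition hull s w :=
  forall C, is_convex C -> (forall v, v \in s -> C v) -> C w.

Lemma hull_mem s v : v \in s -> hull s v.
Proof. by move=> vs C _; apply. Qed.

Lemma hullS s s' w : {subset s <= s'} -> hull s w -> hull s' w.
Proof. by move=> ss' hw C convC Cs'; apply: hw => // v /ss'/Cs'. Qed.

Lemma hull_convex s : is_convex (hull s).
Proof.
by move=> u v t hu hv t01 C convC Cs; apply: (convC) => //; [apply: hu|apply: hv].
Qed.

Lemma hull_nil w : ~ hull [::] w.
Proof. by move=> /(_ (fun=> False)); apply. Qed.

Lemma hullN s w : hull (map -%R s) w -> hull s (- w).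
Proof.
move=> /(_ (fun w => hull s (- w))); apply.
  by move=> u v t hu hv t01; rewrite opprD -!scalerN; exact: hull_convex.
by move=> _ /mapP[v vs ->]; rewrite opprK; exact: hull_mem.
Qed.

Lemma hullNE s w : hull (map -%R s) w <-> hull s (- w).
Proof.
split; first exact: hullN.
rewrite -{1}[s](mapK opprK) => h.
by move: (hullN (s := map -%R s) (w := - w)); rewrite opprK; apply.
Qed.

End Hull.

Section Degree.
Variables (R : realType) (V : lmodType R) (l : nat -> V -> R).
Hypothesis l_lin : forall k a u v, l k (a *: u + v) = a * l k u + l k v.
Implicit Types (s : seq V) (u v w : V).

Definition flat k w := forall j, (j < k)%N -> l j w = 0.

Definition half_hit k s := exists2 w, hull s w & flat k w /\ 0 < l k w.

(* The signed number of intersections of the simplex [s] with the half-space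
   l_0 = ... = l_(k-2) = 0 < l_(k-1). *)
Fixpoint degc k s : int :=
  if k is k'.+1 then (if `[< half_hit k' s >] then cob (degc k') s else 0)
  else (s == [::])%:Z.

Definition avoids k s := forall w, hull s w -> ~ flat k w.

Lemma l_comb k a b u v : l k (a *: u + b *: v) = a * l k u + b * l k v.
Proof.
rewrite l_lin; congr (_ + _).
have l0 : l k 0 = 0.
  by have := l_lin k 1 0 0; rewrite scale1r addr0 mul1r => /eqP; rewrite addrC -subr_eq subrr => /eqP.
by have := l_lin k b v 0; rewrite addr0 l0 addr0.
Qed.

Lemma l_opp k v : l k (- v) = - l k v.
Proof.
have := l_comb k (- 1) 0 v v; rewrite scaleN1r scale0r addr0 => ->.
by rewrite mul0r addr0 mulN1r.
Qed.

Lemma flat_comb k a b u v : flat k u -> flat k v -> flat k (a *: u + b *: v).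
Proof. by move=> fu fv j jk; rewrite l_comb fu// fv// !mulr0 addr0. Qed.

Lemma flat_opp k v : flat k v -> flat k (- v).
Proof. by move=> fv j jk; rewrite l_opp fv// oppr0. Qed.

Lemma flatSr k v : flat k v -> l k v = 0 -> flat k.+1 v.
Proof. by move=> fv lv j; rewrite ltnS leq_eqVlt => /predU1P[->//|/fv]. Qed.

Lemma hull_same_side k s u v : avoids k.+1 s -> hull s u -> hull s v ->
  flat k u -> flat k v -> 0 < l k u -> 0 < l k v.
Proof.
move=> av hu hv fu fv lu; rewrite ltNge; apply/negP => lv.
(* The parameter at which [l k] vanishes on the segment from [v] to [u]. *)
pose t := (- l k v) / (l k u - l k v).
have d_gt0 : 0 < l k u - l k v by lra.
have t01 : 0 <= t <= 1.
  by apply/andP; split; [apply: divr_ge0; lra|rewrite ler_pdivrMr//; lra].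
apply: (av _ (hull_convex hu hv t01)); apply: flatSr.
  exact: flat_comb.
rewrite l_comb /t; field; lra.
Qed.

(** The points of the hull on the flat of the first [k] equations all lie on one side of the next
    hyperplane. If it is the positive side, a face that misses the half-space misses the whole flat,
    so [degc k.+1] equals [cob (degc k)] on every face and [cob_cob] concludes; otherwise no face
    meets the half-space. *)
Lemma cob_degc k s : avoids k s -> cob (degc k) s = 0.
Proof.
elim: k s => [|k IH] s av.
  by case: s av => // v s /(_ v (hull_mem (mem_head _ _))) [].
have [hs|nhs] := pselect (half_hit k s); last first.
  apply: cob_face0 => s' _ s's /=; case: asboolP => // -[w hw fw].
  by case: nhs; exists w => //; exact: hullS hw.
have [w hw [fw lw]] := hs.
rewrite -(cob_cob (degc k) s); apply: eq_cob_face => s' _ s's /=.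
case: asboolP => // ns'; rewrite IH// => v hv fv; apply: ns'.
exists v => //; split=> //.
exact: hull_same_side av hw (hullS s's hv) fw fv lw.
Qed.

Lemma alternating_degc k : alternating (degc k).
Proof.
elim: k => [|k IH] s1 x y s2 /=; first by case: s1.
have -> : `[< half_hit k (s1 ++ x :: y :: s2) >]
    = `[< half_hit k (s1 ++ y :: x :: s2) >].
  apply/asbool_equiv_eq; split=> -[w hw fw]; exists w => //; apply: hullS hw => v;
  by rewrite !mem_cat !inE => /orP[->//|/or3P[->|->|->]]; rewrite ?orbT.
by case: ifP => _; rewrite ?oppr0// (alternating_cob IH).
Qed.

(** The inductive step of Borsuk-Ulam. The half-space and its opposite lie in a flat of codimension
    [k.-1], which [s] meets [cob (degc k.-1) s] times; in general position it does so on one side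
    only, so one of the two terms on the left carries the whole number. *)
Lemma degc_antipode k s :
  (0 < k)%N -> size s = k -> 
  (forall s', {subset s' <= s} -> (size s' <= k)%N -> avoids (size s') s') ->
  degc k s - (-1) ^+ k * degc k (map -%R s) = cob (degc k.-1) s.
Proof.
case: k => // k _; elim: k s => [|k IH] s ss gen.
  case: s ss gen => [|v [|//]] //= _ /(_ [:: v]) /(_ (fun _ => id) isT) av.
  have hv w : hull [:: v] w -> w = v.
    move/(_ (fun w => w = v)); apply; last by move=> u; rewrite inE => /eqP.
    by move=> ? ? t -> -> _; rewrite -scalerDl addrC subrK scale1r.
  have lv : l 0 v != 0.
    by apply/eqP => lv; apply: (av v) => //; [exact: hull_mem (mem_head _ _)|case].
  have pos u : (forall w, hull [:: u] w -> w = u) -> `[< half_hit 0 [:: u] >] = (0 < l 0 u).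
    move=> hu; apply/asboolP/idP => [[w /hu -> []//]|lu].
    by exists u; [exact: hull_mem (mem_head _ _)|split].
  rewrite pos// pos => [|w /(hullNE [:: v])/hv <-]; last by rewrite opprK.
  by rewrite l_opp oppr_gt0; case: (ltgtP (l 0 v) 0) lv.
have av : avoids k.+2 s by rewrite -ss; apply: gen => //; rewrite ss.
rewrite [degc k.+2 s]/= [degc k.+2 (map _ _)]/=.
(* On faces, the induction hypothesis gives this equality up to a coboundary, which [cob_cob]
   removes. *)
have -> : cob (degc k.+1) (map -%R s) = (-1) ^+ k.+1 * cob (degc k.+1) s.
  have E s' : {subset s' <= s} -> size s' = k.+1 ->
      degc k.+1 (map -%R s') = (-1) ^+ k.+1 * (degc k.+1 s' - cob (degc k) s').
    move=> s's ss'; rewrite -IH//.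
      rewrite subKr mulrA -exprD addnn -mul2n exprM sqrrN !expr1n mul1r //.
    move=> s'' s''s' sk; apply: gen; last by lia.
    by move=> x /s''s'/s's.
  rewrite cob_map.
  transitivity (cob (fun s' =>
      (-1) ^+ k.+1 * (degc k.+1 s' - cob (degc k) s')) s).
    apply: eq_cob_face => s' ss' s's; apply: E => //.
    exact: succn_inj (etrans ss' ss).
  by rewrite cobZ (cobB (degc k.+1)) cob_cob subr0.
have side : cob (degc k.+1) s != 0 ->
    `[< half_hit k.+1 s >] = ~~ `[< half_hit k.+1 (map -%R s) >].
  move=> nz.
  have [w hw fw] : exists2 w, hull s w & flat k.+1 w.
    apply: contrapT => nex; case/eqP: nz; apply: cob_degc => w hw fw.
    by apply: nex; exists w.
  have lw : l k.+1 w != 0.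
    by apply/eqP => lw; apply: (av w) => //; exact: flatSr.
  apply/asboolP/idP => [[u hu [fu lu]]|/asboolP nh].
    apply/asboolPn => -[v /hullNE hv [fv lv]].
    have := hull_same_side av hu hv fu (flat_opp fv) lu.
    by rewrite l_opp; lra.
  case: (ltgtP (l k.+1 w) 0) lw => // lw0 _; last by exists w.
  case: nh; exists (- w); first by apply/hullNE; rewrite opprK.
  by split; [exact: flat_opp|rewrite l_opp oppr_gt0].
have [->|/side ->] := eqVneq (cob (degc k.+1) s) 0.
  by rewrite mulr0 !if_same mulr0 subr0.
case: asboolP => _ /=; last by rewrite mulr0 subr0.
rewrite mulrA -exprD addSn exprS addnn -mul2n exprM sqrrN !expr1n mulr1 sub0r mulN1r opprK//.
Qed.

End Degree.

(** * Barycentric subdivision *)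

Section Subdivision.
Variables (R : realType) (V : lmodType R).
Implicit Types (F G : seq V -> int) (s : seq V).

Definition bary s : V := (size s)%:R^-1 *: \sum_(v <- s) v.

(** Dual of the recursion Sd(s) = b * Sd(ds) for the barycentric subdivision of chains, with b the
    barycentre of s; [n] is the number of vertices. *)
Fixpoint sdn n F s : int :=
  if n is n'.+1 then cob (sdn n' (fun u => F (bary s :: u))) s else F s.

Definition sd F s : int := sdn (size s) F s.

Lemma sdE F s : s != [::] -> sd F s = cob (sd (fun u => F (bary s :: u))) s.
Proof.
case: s => // x s _.
transitivity (cob (sdn (size s) (fun u => F (bary (x :: s) :: u))) (x :: s)) => //.
by apply: eq_cob_face => s' [<-].
Qed.

Lemma sd_ext F G s : F =1 G -> sd F s = sd G s.
Proof.
rewrite /sd; move: (size s) => n; elim: n F G s => [|n IH] F G s FG //=.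
by apply: eq_cob => u; apply: IH => ?; exact: FG.
Qed.

Lemma sdB F G s : sd (fun u => F u - G u) s = sd F s - sd G s.
Proof.
rewrite /sd; move: (size s) => n; elim: n F G s => [|n IH] F G s //=.
by rewrite -cobB; apply: eq_cob => u; rewrite IH.
Qed.

Lemma cob_sd F s : cob (sd F) s = sd (cob F) s.
Proof.
have [n] := ubnP (size s); elim: n F s => // n IH F s sn.
have [->//|s_neq0] := eqVneq s [::].
rewrite [RHS]sdE//; set b := bary s.
rewrite [RHS](eq_cob _ (G := fun u => sd F u - sd (cob (fun u => F (b :: u))) u)).
  rewrite cobB; suff -> : cob (sd (cob (fun u => F (b :: u)))) s = 0.
    by rewrite subr0.
  rewrite -(cob_cob (sd (fun u => F (b :: u))) s).
  by apply: eq_cob_face => s' ss' _; rewrite IH//; exact: leq_trans (eq_leq ss') sn.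
by move=> u; rewrite -sdB.
Qed.

Lemma sd_face0 F s (P : V -> Prop) :
  (forall s', s' != [::] -> (forall v, v \in s' -> P v) -> P (bary s')) ->
  (forall v, v \in s -> P v) ->
  (forall u, size u = size s -> (forall v, v \in u -> P v) -> F u = 0) ->
  sd F s = 0.
Proof.
move=> Pbary; have [n] := ubnP (size s); elim: n F s => // n IH F s sn Ps F0.
have [s0|s_neq0] := eqVneq s [::]; first by rewrite s0 /sd /= -s0 F0.
rewrite sdE//; apply: cob_face0 => s' ss' s's; apply: IH => [|v /s's/Ps//|u us' Pu].
  exact: leq_trans (eq_leq ss') sn.
apply: F0 => [|v]; first by rewrite /= us'.
by rewrite inE => /predU1P[->|/Pu//]; exact: Pbary.
Qed.

Lemma iter_sdB m F G s :
  iter m sd (fun u => F u - G u) s = iter m sd F s - iter m sd G s.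
Proof.
by elim: m s => //= m IH s; rewrite -sdB; apply: sd_ext => u; rewrite IH.
Qed.

Lemma cob_iter_sd m F s : cob (iter m sd F) s = iter m sd (cob F) s.
Proof.
by elim: m s => //= m IH s; rewrite cob_sd; apply: sd_ext => u; rewrite IH.
Qed.

Lemma iter_sd_nil m F : iter m sd F [::] = F [::].
Proof. by elim: m. Qed.

Lemma iter_sd_ext m F G s : F =1 G -> iter m sd F s = iter m sd G s.
Proof. by move=> FG; elim: m s => //= m IH s; apply: sd_ext. Qed.

Lemma iter_sd_face0 m F s (P : V -> Prop) :
  (forall s', s' != [::] -> (forall v, v \in s' -> P v) -> P (bary s')) ->
  (forall v, v \in s -> P v) ->
  (forall u, size u = size s -> (forall v, v \in u -> P v) -> F u = 0) ->
  iter m sd F s = 0.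
Proof.
move=> Pbary; elim: m s => [|m IH] s Ps F0; first exact: F0.
apply: (sd_face0 Pbary Ps) => u us Pu; apply: IH => // w wu; exact/F0/(etrans wu).
Qed.

Lemma bary_convex (C : V -> Prop) s : is_convex C -> s != [::] ->
  (forall v, v \in s -> C v) -> C (bary s).
Proof.
move=> convC; elim: s => // v s IH _ Cs.
have Cv : C v by apply: Cs; exact: mem_head.
have [->|s0] := eqVneq s [::]; first by rewrite /bary big_seq1 invr1 scale1r.
have Cb : C (bary s) by apply: IH => // w ws; apply: Cs; rewrite inE ws orbT.
have n_gt0 : 0 < (size s)%:R :> R by rewrite ltr0n lt0n size_eq0.
have nE : (size s).+1%:R = 1 + (size s)%:R :> R by rewrite -natr1 addrC.
have -> : bary (v :: s) = (size s).+1%:R^-1 *: v +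
    (1 - (size s).+1%:R^-1) *: bary s.
  rewrite /bary big_cons scalerDr scalerA; congr (_ + _ *: _).
  by rewrite nE; field; lra.
apply: convC => //; rewrite nE; apply/andP; split.
  by rewrite invr_ge0; lra.
by rewrite invf_le1; lra.
Qed.

End Subdivision.
Arguments sd {R V} F s.

Lemma bary_linear (R : realType) (V W : lmodType R) (A : {linear V -> W}) s :
  bary (map A s) = A (bary s).
Proof. by rewrite /bary size_map big_map linearZ_LR (linear_sum A). Qed.

Lemma sd_linear (R : realType) (V W : lmodType R) (A : {linear V -> W})
    (F : seq W -> int) (s : seq V) :
  sd F (map A s) = sd (fun u => F (map A u)) s.
Proof.
rewrite /sd size_map; move: (size s) => n; elim: n F s => //= n IH F s.
by rewrite cob_map bary_linear; apply: eq_cob => u; rewrite IH.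
Qed.

Lemma iter_sd_linear (R : realType) (V W : lmodType R) (A : {linear V -> W})
    m (F : seq W -> int) (s : seq V) :
  iter m sd F (map A s) = iter m sd (fun u => F (map A u)) s.
Proof.
by elim: m s => //= m IH s; rewrite sd_linear; apply: sd_ext => u; rewrite IH.
Qed.

Section Mesh.
Variables (R : realType) (V : normedModType R).
Implicit Types (F : seq V -> int) (s : seq V).

Definition mesh_le s (d : R) := forall u v, u \in s -> v \in s -> `|u - v| <= d.

Lemma convex_ball_le (b : V) (d : R) : is_convex (fun v => `|b - v| <= d).
Proof.
move=> u v t ud vd /andP[t0 t1].
have -> : b - (t *: u + (1 - t) *: v) = t *: (b - u) + (1 - t) *: (b - v).
  rewrite !scalerBr opprD addrACA -scalerDl [t + _]addrC subrK scale1r//.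
rewrite (le_trans (ler_normD _ _))// !normrZ !ger0_norm ?subr_ge0//.
rewrite (_ : d = t * d + (1 - t) * d); last by ring.
by apply: lerD; rewrite ler_wpM2l// subr_ge0.
Qed.

(** The usual factor (k - 1) / k for k vertices. Simplices with 5 vertices are the largest that
    occur, because a 3-cycle is compared with the boundary of a 4-chain; hence 4 / 5. *)
Lemma bary_mesh s v d : (0 < size s <= 5)%N -> mesh_le s d -> v \in s ->
  `|bary s - v| <= 4 / 5 * d.
Proof.
move=> /andP[n_gt0 n5] sd vs.
have n0 : 0 < (size s)%:R :> R by rewrite ltr0n.
have d0 : 0 <= d by have := sd v v vs vs; rewrite subrr normr0.
have -> : bary s - v = (size s)%:R^-1 *: \sum_(u <- rem v s) (u - v).
  have -> : \sum_(u <- rem v s) (u - v) = \sum_(u <- s) (u - v).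
    by rewrite [RHS](perm_big _ (perm_to_rem vs)) big_cons /= subrr add0r.
  rewrite sumrB big_const_seq count_predT iter_addr_0 scalerBr -(scaler_nat _ v).
  by rewrite scalerA mulVf ?gt_eqF// scale1r.
rewrite normrZ ger0_norm ?invr_ge0// ler_pdivrMl//.
apply: (@le_trans _ _ ((size s).-1%:R * d)).
  rewrite (le_trans (ler_norm_sum _ _ _))// -(size_rem vs).
  rewrite mulr_natl -iter_addr_0 -(count_predT (rem v s)) -big_const_seq.
  rewrite big_seq [leRHS]big_seq; apply: ler_sum => u /mem_rem us; exact: sd.
rewrite mulrA ler_wpM2r// -(prednK n_gt0) -natr1.
have : (size s).-1%:R <= 4 :> R by rewrite ler_nat; lia.
lra.
Qed.

Lemma sd_mesh0 F s (C : V -> Prop) d : is_convex C -> (size s <= 5)%N ->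
  (forall v, v \in s -> C v) -> mesh_le s d ->
  (forall u, size u = size s -> (forall v, v \in u -> C v) ->
     mesh_le u (4 / 5 * d) -> F u = 0) ->
  sd F s = 0.
Proof.
move=> convC; have [n] := ubnP (size s); elim: n C F s convC => // n IH C F s convC sn s5 Cs sm F0.
have [s0|s_neq0] := eqVneq s [::].
  by rewrite s0 /sd /= -s0 F0 => // u v; rewrite s0.
have d0 : 0 <= d.
  by case: (s) s_neq0 sm => // v ? _ /(_ v v); rewrite !mem_head subrr normr0; apply.
have s_gt0 : (0 < size s <= 5)%N by rewrite s5 lt0n size_eq0 s_neq0.
rewrite sdE//; apply: cob_face0 => s' ss' s's.
(* The induction runs over all convex sets so that faces can be confined to the ball about the
   barycentre; the new vertex is then close to every vertex produced later. *)
apply: (IH (fun v => C v /\ `|bary s - v| <= 4 / 5 * d)) => //.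
- move=> u v t [Cu du] [Cv dv] t01; split; [exact: convC|].
  exact: convex_ball_le.
- exact: leq_trans (eq_leq ss') sn.
- by apply: leq_trans s5; rewrite -ss'.
- by move=> v /s's vs; split; [exact: Cs|exact: bary_mesh].
- by move=> u v /s's us /s's vs; exact: sm.
move=> u us' Cu du; apply: F0.
- by rewrite /= us'.
- move=> v; rewrite inE => /predU1P[->|/Cu[]//].
  exact: bary_convex.
move=> v w; rewrite !inE => /predU1P[->|vu] /predU1P[->|wu].
- by rewrite subrr normr0; lra.
- by have [] := Cu _ wu.
- by rewrite distrC; have [] := Cu _ vu.
- exact: du.
Qed.

Lemma iter_sd_mesh0 m F s (C : V -> Prop) d : is_convex C -> (size s <= 5)%N ->
  (forall v, v \in s -> C v) -> mesh_le s d ->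
  (forall u, size u = size s -> (forall v, v \in u -> C v) ->
     mesh_le u ((4 / 5) ^+ m * d) -> F u = 0) ->
  iter m sd F s = 0.
Proof.
move=> convC; elim: m s d => [|m IH] s d s5 Cs sm F0.
  by apply: F0; rewrite // expr0 mul1r.
apply: (sd_mesh0 convC s5 Cs sm) => u us Cu ud.
apply: (IH _ _ _ Cu ud); first by rewrite us.
by move=> w wu Cw; rewrite mulrA -exprSr; apply: F0; rewrite // wu.
Qed.

Lemma mesh_small (d e : R) : 0 < e -> exists m0, forall m, (m0 <= m)%N ->
  (4 / 5) ^+ m * d < e.
Proof.
move=> e0; have q0 : 0 <= 4 / 5 :> R by lra.
pose N := Num.bound (4 * `|d| / e).
(* Inductive step: 4 / 5 times 5 + m equals 4 + 4m / 5, which is at most 4 + m. *)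
have bound m : (4 / 5 : R) ^+ m * (4 + m%:R) <= 4.
  elim: m => [|m IH]; first by rewrite mul1r addr0.
  apply: le_trans IH; rewrite exprSr -mulrA; apply: ler_wpM2l.
    exact: exprn_ge0.
  by rewrite -(natr1 m); have := ler0n R m; lra.
exists N => m Nm; have m_gt0 : 0 < 4 + m%:R :> R by have := ler0n R m; lra.
apply: (@le_lt_trans _ _ ((4 / 5) ^+ m * `|d|)).
  by rewrite ler_wpM2l ?exprn_ge0 ?ler_norm.
have le4 : (4 / 5) ^+ m <= 4 / (4 + m%:R) :> R by rewrite ler_pdivlMr.
apply: (@le_lt_trans _ _ (4 / (4 + m%:R) * `|d|)); first by rewrite ler_wpM2r.
have : 4 * `|d| / e < N%:R.
  by apply: archi_boundP; rewrite divr_ge0 ?mulr_ge0// ltW.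
have : e * N%:R <= e * m%:R by rewrite ler_pM2l// ler_nat.
rewrite ltr_pdivrMr// mulrAC ltr_pdivrMr//; lra.
Qed.

End Mesh.

(** * The linking number of K_{3,3} is odd *)

#[local] Arguments degc : simpl never.

(* The graph K_{3,3} as a hexagon 0 - 1 - ... - 5 - 0 (edges 0..5) with three
   long diagonals (edges 6, 7, 8). *)
Definition hex_src (j : nat) : nat := nth 0%N [:: 0; 1; 2; 3; 4; 5; 0; 1; 2]%N j.
Definition hex_tgt (j : nat) : nat := nth 0%N [:: 1; 2; 3; 4; 5; 0; 3; 4; 5]%N j.

(* The pairs of disjoint edges, with the signs making the sum of the e x f a
   2-cycle (the fundamental class of the deleted product, a closed surface). *)
Definition hex_pairs : seq (int * (nat * nat)) :=
  [:: (1, (0, 2)%N); (1, (0, 3)%N); (1, (0, 4)%N); (1, (1, 3)%N); (1, (1, 4)%N);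
      (1, (1, 5)%N); (1, (2, 4)%N); (1, (2, 5)%N); (1, (3, 5)%N);
      (1, (1, 6)%N); (-1, (4, 6)%N); (1, (2, 7)%N); (-1, (5, 7)%N); (1, (3, 8)%N);
      (-1, (0, 8)%N); (-1, (6, 7)%N); (1, (6, 8)%N); (-1, (7, 8)%N)].

(** Both orders of a pair carry the same sign. As exchanging the factors changes [degc] by a
    coboundary only, the sum is twice a sum over unordered pairs plus correction terms, and these
    decide its parity. *)
Definition hex_sum (b : nat -> nat -> int) : int :=
  \sum_(e <- hex_pairs) e.1 * (b e.2.1 e.2.2 + b e.2.2 e.2.1).

Lemma eq_hex_sum b b' :
  (forall e, e \in hex_pairs -> b e.2.1 e.2.2 = b' e.2.1 e.2.2
    /\ b e.2.2 e.2.1 = b' e.2.2 e.2.1) -> hex_sum b = hex_sum b'.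
Proof.
move=> bb'; rewrite /hex_sum !big_seq; apply: eq_bigr => e /bb'[-> ->] //.
Qed.

Section Hexagon.
Variables (P : eqType) (a : nat -> seq (P * P)) (p : nat -> P).

(** The 1-chain [a j] has boundary target minus source, tested against all integer functions on
    points. *)
Definition edge_path := forall (G : P -> int) j, (j < 9)%N ->
  \sum_(q <- a j) (G q.2 - G q.1) = G (p (hex_tgt j)) - G (p (hex_src j)).

Definition join_simplex (q q' : P * P) : seq (bool * P) :=
  [:: (true, q.1); (true, q.2); (false, q'.1); (false, q'.2)].

(* The 3-cycle [sum +- e * (- f)], given by its values on cochains; the label
   [true] marks the factor that will be reflected in the origin. *)
Definition join_cycle (F : seq (bool * P) -> int) : int :=
  hex_sum (fun j k => \sum_(q <- a j) \sum_(q' <- a k) F (join_simplex q q')).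

Lemma eq_join_cycle F F' :
  (forall e q q', e \in hex_pairs ->
     (q \in a e.2.1 /\ q' \in a e.2.2) \/ (q \in a e.2.2 /\ q' \in a e.2.1) ->
     F (join_simplex q q') = F' (join_simplex q q')) ->
  join_cycle F = join_cycle F'.
Proof.
move=> FF'; apply: eq_hex_sum => e he; split; rewrite !big_seq.
  apply: eq_bigr => q qa; rewrite !big_seq; apply: eq_bigr => q' q'a.
  by apply: (FF' e) => //; left.
apply: eq_bigr => q qa; rewrite !big_seq; apply: eq_bigr => q' q'a.
by apply: (FF' e) => //; right.
Qed.

Lemma join_cycleD F F' :
  join_cycle (fun s => F s + F' s) = join_cycle F + join_cycle F'.
Proof.
rewrite /join_cycle /hex_sum -big_split; apply: eq_bigr => e _ /=.
under eq_bigr do rewrite big_split.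
under [X in _ * (_ + X)]eq_bigr do rewrite big_split.
by rewrite !big_split /=; ring.
Qed.

Hypothesis ap : edge_path.

(** Leibniz rule for the join of two paths; inner vertices cancel by [ap]. *)
Let face1 F j k : (j < 9)%N -> (k < 9)%N ->
  \sum_(q <- a j) \sum_(q' <- a k) cob F (join_simplex q q') =
  \sum_(q' <- a k) F [:: (true, p (hex_tgt j)); (false, q'.1); (false, q'.2)] -
  \sum_(q' <- a k) F [:: (true, p (hex_src j)); (false, q'.1); (false, q'.2)] +
  (\sum_(q <- a j) F [:: (true, q.1); (true, q.2); (false, p (hex_tgt k))] -
   \sum_(q <- a j) F [:: (true, q.1); (true, q.2); (false, p (hex_src k))]).
Proof.
move=> j9 k9; rewrite -!sumrB.
under [X in _ = X + _]eq_bigr => q' _.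
  rewrite -(ap (fun x => F [:: (true, x); (false, q'.1); (false, q'.2)]))//.
  over.
under [X in _ = _ + X]eq_bigr => q _.
  rewrite -(ap (fun y => F [:: (true, q.1); (true, q.2); (false, y)]))//.
  over.
rewrite [X in _ = X + _]exchange_big -big_split; apply: eq_bigr => q _ /=.
by rewrite -big_split; apply: eq_bigr => q' _ /=; ring.
Qed.

(** A vertex [w] off the edge [k] is adjacent to exactly one end of [k], so exactly two of the three
    edges at [w] are disjoint from [k]. Each [A w k] and each [B k w] thus occurs twice, with
    opposite signs: the surface has no boundary. *)
Lemma join_cycle_cob F : join_cycle (cob F) = 0.
Proof.
pose A w k := \sum_(q' <- a k) F [:: (true, p w); (false, q'.1); (false, q'.2)].
pose B j w := \sum_(q <- a j) F [:: (true, q.1); (true, q.2); (false, p w)].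
rewrite /join_cycle (@eq_hex_sum _ (fun j k => A (hex_tgt j) k - A (hex_src j) k
   + (B j (hex_tgt k) - B j (hex_src k)))).
  by rewrite /hex_sum /hex_pairs !big_cons big_nil /hex_tgt /hex_src /=; ring.
move=> e he; split; apply: face1; move: e he; exact/allP.
Qed.

Section Parity.
Variables (R : realType) (V : lmodType R) (l : nat -> V -> R) (g : P -> V).
Hypothesis l_lin : forall k a u v, l k (a *: u + v) = a * l k u + l k v.

Definition reflect_label (x : bool * P) : V := if x.1 then - g x.2 else g x.2.

Hypothesis path_src : forall j, (j < 9)%N -> exists2 q, q \in a j & q.1 = p (hex_src j).
Hypothesis path_tgt : forall j, (j < 9)%N -> exists2 q, q \in a j & q.2 = p (hex_tgt j).

Definition join_generic := forall e q q', e \in hex_pairs ->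
  q \in a e.2.1 -> q' \in a e.2.2 ->
  forall s : seq V, {subset s <= map reflect_label (join_simplex q q')} ->
  (size s <= 4)%N -> avoids l (size s) s.

Hypothesis gen : join_generic.

Let D k := degc l k.
Let D1 (x : V) := D 1 [:: x].
Let D2 (x y : V) := D 2 [:: x; y].
Let D3 (x y z : V) := D 3 [:: x; y; z].

(** Counts left over by successive antipodal steps: exchanging the factors of a join leaves [A] and
    [B], expressing [B] through [A] leaves [Q] and [C], and exchanging the arguments of [C] leaves
    [d] and a constant. *)
Let C w v := D2 (- g (p w)) (g (p v)).
Let d w := D1 (g (p w)).
Let A w k := \sum_(q <- a k) D3 (- g (p w)) (g q.1) (g q.2).
Let B j w := \sum_(q <- a j) D3 (- g q.1) (- g q.2) (g (p w)).
Let Q j := \sum_(q <- a j) D2 (g q.1) (g q.2).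

Let avoidsN k (s : seq V) : avoids l k s -> avoids l k (map -%R s).
Proof. by move=> av w /hullNE/av nf fw; exact/nf/flat_opp. Qed.

Let gen_sym e q q' s : e \in hex_pairs ->
  q \in a e.2.2 -> q' \in a e.2.1 ->
  {subset s <= map reflect_label (join_simplex q q')} ->
  (size s <= 4)%N -> avoids l (size s) s.
Proof.
move=> he qa q'a ss s4.
suff : avoids l (size (map -%R s)) (map -%R s).
  by move/avoidsN; rewrite size_map (mapK opprK).
apply: (gen he q'a qa); last by rewrite size_map.
move=> _ /mapP[v /ss vs ->]; move: vs; rewrite /join_simplex /= /reflect_label /= !inE.
by move=> /or4P[]/eqP->; rewrite ?opprK eqxx ?orbT.
Qed.

Let vertex_seg w j : w = hex_src j \/ w = hex_tgt j -> (j < 9)%N ->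
  exists2 q, q \in a j & p w = q.1 \/ p w = q.2.
Proof.
move=> [->|->] j9.
  by have [q qa <-] := path_src j9; exists q => //; left.
by have [q qa <-] := path_tgt j9; exists q => //; right.
Qed.

Definition hex_far w j := has (fun e : int * (nat * nat) =>
  ((w == hex_src e.2.1) || (w == hex_tgt e.2.1)) && (j == e.2.2) ||
  ((w == hex_src e.2.2) || (w == hex_tgt e.2.2)) && (j == e.2.1)) hex_pairs.

Let hex_lt9 e : e \in hex_pairs -> (e.2.1 < 9)%N /\ (e.2.2 < 9)%N.
Proof. by move=> he; split; move: e he; exact/allP. Qed.

Let gen3 w j q (s : seq V) : hex_far w j -> q \in a j ->
  {subset s <= [:: - g (p w); g q.1; g q.2]} ->
  (size s <= 4)%N -> avoids l (size s) s.
Proof.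
move=> /hasP[e he /orP[] /andP[/orP hw /eqP ej]] qa ss; subst j.
  have [q' q'a pw] : exists2 q', q' \in a e.2.1 & p w = q'.1 \/ p w = q'.2.
    apply: vertex_seg; last by case: (hex_lt9 he).
    by case: hw => /eqP; auto.
  apply: (gen he q'a qa) => v /ss; rewrite /reflect_label /= !inE.
  by case: pw => -> /or3P[] ->; rewrite ?orbT.
have [q' q'a pw] : exists2 q', q' \in a e.2.2 & p w = q'.1 \/ p w = q'.2.
  apply: vertex_seg; last by case: (hex_lt9 he).
  by case: hw => /eqP; auto.
apply: (gen_sym he q'a qa) => v /ss; rewrite /reflect_label /= !inE.
by case: pw => -> /or3P[] ->; rewrite ?orbT.
Qed.

Let swap3 (x y z : V) : D3 x y z = D3 z x y.
Proof.
rewrite /D3 /D (alternating_degc l 3 [:: x] y z [::]) /=.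
by rewrite (alternating_degc l 3 [::] x z [:: y]) /= opprK.
Qed.

Let antip3 w j q : hex_far w j -> q \in a j ->
  D3 (- g q.1) (- g q.2) (g (p w)) = - D3 (- g (p w)) (g q.1) (g q.2)
    + D2 (g q.1) (g q.2) - (D2 (- g (p w)) (g q.2) - D2 (- g (p w)) (g q.1)).
Proof.
move=> wj qa; rewrite swap3.
have E : D3 (- g (p w)) (g q.1) (g q.2) -
    (-1) ^+ 3 * D3 (g (p w)) (- g q.1) (- g q.2) = D2 (g q.1) (g q.2) -
    (D2 (- g (p w)) (g q.2) - (D2 (- g (p w)) (g q.1) - 0)).
  have := @degc_antipode R V l l_lin 3 [:: - g (p w); g q.1; g q.2] isT erefl
    (fun s ss s3 => gen3 wj qa ss (leqW s3)).
  by rewrite [map _ _]/= opprK.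
by rewrite !exprS expr0 in E; lia.
Qed.

Let BA j w : hex_far w j -> (j < 9)%N ->
  B j w = - A w j + Q j - (C w (hex_tgt j) - C w (hex_src j)).
Proof.
move=> wj j9; rewrite /C -(ap (fun x => D2 (- g (p w)) (g x)) j9).
rewrite /B /A /Q -sumrN -big_split -sumrB [LHS]big_seq [RHS]big_seq.
by apply: eq_bigr => q qa /=; rewrite (antip3 wj qa).
Qed.

Let gen2 w j v (s : seq V) : hex_far w j -> (j < 9)%N ->
  v = hex_src j \/ v = hex_tgt j ->
  {subset s <= [:: - g (p w); g (p v)]} -> (size s <= 4)%N -> avoids l (size s) s.
Proof.
move=> wj j9 hv ss; have [q qa pv] := vertex_seg hv j9.
apply: (gen3 wj qa) => x /ss; rewrite !inE.
by case: pv => -> /orP[] ->; rewrite ?orbT.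
Qed.

Let gen1 w j v : hex_far w j -> (j < 9)%N -> v = hex_src j \/ v = hex_tgt j ->
  D1 (- g (p w)) = 1 - d w.
Proof.
move=> wj j9 hv; rewrite /d.
have E : D1 (- g (p w)) - (-1) ^+ 1 * D1 (g (p w)) = 1 - 0.
  have := @degc_antipode R V l l_lin 1 [:: - g (p w)] isT erefl.
  rewrite [map _ _]/= opprK; apply => s ss s1.
  apply: (gen2 wj j9 hv); last exact: leq_trans s1 _.
  by move=> x /ss; rewrite !inE => ->.
by rewrite expr1 in E; lia.
Qed.

Let CC w j v : hex_far w j -> (j < 9)%N -> v = hex_src j \/ v = hex_tgt j ->
  C v w = - C w v + d v + d w - 1.
Proof.
move=> wj j9 hv; rewrite /C.
have E : D2 (- g (p w)) (g (p v)) - (-1) ^+ 2 * D2 (g (p w)) (- g (p v))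
    = D1 (g (p v)) - (D1 (- g (p w)) - 0).
  have := @degc_antipode R V l l_lin 2 [:: - g (p w); g (p v)] isT erefl
    (fun s ss s2 => gen2 wj j9 hv ss (leq_trans s2 (isT : (2 <= 4)%N))).
  by rewrite [map _ _]/= opprK.
rewrite (gen1 wj j9 hv) -/(d v) !exprS expr0 in E.
have -> : D2 (- g (p v)) (g (p w)) = - D2 (g (p w)) (- g (p v)).
  exact: (alternating_degc l 2 [::] _ _ [::]).
lia.
Qed.

Let antip4 e q q' : e \in hex_pairs -> q \in a e.2.1 -> q' \in a e.2.2 ->
  D 4 (map reflect_label (join_simplex q' q)) =
  D 4 (map reflect_label (join_simplex q q')) -
  cob (D 3) (map reflect_label (join_simplex q q')).
Proof.
move=> he qa q'a.
have E : D 4 (map reflect_label (join_simplex q q')) -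
    (-1) ^+ 4 * D 4 [:: g q.1; g q.2; - g q'.1; - g q'.2] =
    cob (D 3) (map reflect_label (join_simplex q q')).
  have := @degc_antipode R V l l_lin 4 (map reflect_label (join_simplex q q')) isT erefl
    (gen he qa q'a).
  by rewrite [map -%R _]/= /reflect_label /= !opprK.
transitivity (D 4 [:: g q.1; g q.2; - g q'.1; - g q'.2]).
  rewrite /D /join_simplex /reflect_label /=.
  rewrite [LHS](alternating_degc l 4 [:: _] _ _ [:: _]).
  rewrite [in LHS](alternating_degc l 4 [::] _ _ [:: _; _]) opprK.
  rewrite [LHS](alternating_degc l 4 [:: _; _] _ _ [::]).
  by rewrite [in LHS](alternating_degc l 4 [:: _] _ _ [:: _]) opprK.
by rewrite !exprS expr0 in E; lia.
Qed.

Let b j k := \sum_(q <- a j) \sum_(q' <- a k) D 4 (map reflect_label (join_simplex q q')).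

Let bb e : e \in hex_pairs -> b e.2.2 e.2.1 = b e.2.1 e.2.2 -
  (A (hex_tgt e.2.1) e.2.2 - A (hex_src e.2.1) e.2.2
   + (B e.2.1 (hex_tgt e.2.2) - B e.2.1 (hex_src e.2.2))).
Proof.
move=> he; have [j9 k9] := hex_lt9 he.
have <- := face1 (fun s => D 3 (map reflect_label s)) j9 k9.
rewrite /b exchange_big -sumrB [LHS]big_seq [RHS]big_seq; apply: eq_bigr => q qa /=.
rewrite -sumrB [LHS]big_seq [RHS]big_seq; apply: eq_bigr => q' q'a.
by rewrite (antip4 he)// cob_map.
Qed.

(** Once [bb], [BA] and [CC] have eliminated one order of each pair, every remaining count has an
    even coefficient, while the constants of [CC] add up to an odd number. *)
Lemma join_cycle_odd m :
  join_cycle (fun s => degc l 4 (map reflect_label s)) <> 2 * m.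
Proof.
rewrite /join_cycle -[hex_sum _]/(hex_sum b) /hex_sum.
have BA' (j w : nat) : hex_far w j && (j < 9)%N ->
  B j w = - A w j + Q j - (C w (hex_tgt j) - C w (hex_src j)).
  by move=> /andP[]; exact: BA.
have CC' (w j : nat) : hex_far w j && (j < 9)%N ->
   C (hex_src j) w = - C w (hex_src j) + d (hex_src j) + d w - 1.
  by move=> /andP[wj j9]; apply: (CC wj j9); left.
have E : \sum_(e <- hex_pairs) e.1 * (b e.2.1 e.2.2 + b e.2.2 e.2.1) =
  \sum_(e <- hex_pairs) e.1 * (2 * b e.2.1 e.2.2 -
  (A (hex_tgt e.2.1) e.2.2 - A (hex_src e.2.1) e.2.2
   + (B e.2.1 (hex_tgt e.2.2) - B e.2.1 (hex_src e.2.2)))).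
  by rewrite [LHS]big_seq [RHS]big_seq; apply: eq_bigr => e he; rewrite (bb he); ring.
rewrite {}E /hex_pairs !big_cons big_nil.
rewrite /hex_src /hex_tgt /= !BA' // /hex_src /hex_tgt /=.
(* Vertex 0 lies on edge 5, which closes the hexagon, so this pair is handled through edge 0 and
   vertex 5 instead. *)
have C50 : C 5 0 = - C 0 5 + d 0 + d 5 - 1.
  by have := CC' 5%N 0%N isT; rewrite /hex_src /=; lia.
have CCs (v w : nat) : [&& w < v, v < 6 & hex_far w v]%N -> C v w = - C w v + d v + d w - 1.
  move=> /and3P[_ v6 wv]; have := CC' w v; rewrite wv (leq_trans v6)//.
  have -> : hex_src v = v by move: v6 {wv}; move: v; do 6?case=> //.
  by apply.
rewrite C50 ?(CCs 1%N 0%N isT) ?(CCs 2%N 0%N isT) ?(CCs 2%N 1%N isT)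
  ?(CCs 3%N 0%N isT) ?(CCs 3%N 1%N isT) ?(CCs 3%N 2%N isT)
  ?(CCs 4%N 0%N isT) ?(CCs 4%N 1%N isT) ?(CCs 4%N 2%N isT)
  ?(CCs 4%N 3%N isT) ?(CCs 5%N 1%N isT) ?(CCs 5%N 2%N isT)
  ?(CCs 5%N 3%N isT) ?(CCs 5%N 4%N isT).
lia.
Qed.

End Parity.
End Hexagon.

(** * General position from the moment curve *)

Section MomentCurve.
Variable R : realType.
Implicit Types (w : 'rV[R]_4) (t : nat -> R).

Definition moment (x : R) w : R := \sum_(i < 4) w 0 i * x ^+ i.

Lemma moment_linear x a (u v : 'rV[R]_4) :
  moment x (a *: u + v) = a * moment x u + moment x v.
Proof.
rewrite /moment mulr_sumr -big_split; apply: eq_bigr => i _.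
by rewrite !mxE /=; ring.
Qed.

Definition moment_col (x : R) : 'cV[R]_4 := \col_i x ^+ i.

Lemma momentE x w : w *m moment_col x = (moment x w)%:M.
Proof.
apply/matrixP => i j; rewrite !ord1 !mxE eqxx mulr1n.
by apply: eq_bigr => k _; rewrite mxE.
Qed.

(** A vector, read as the coefficients of a polynomial of degree at most 3, has value [moment x] at
    [x]. A nonzero row is taken from each nonzero subspace, and [x] avoids the roots of all these
    polynomials. *)
Lemma moment_avoid (Us : seq 'M[R]_4) :
  exists x, forall U, U \in Us -> U != 0 -> U *m moment_col x != 0.
Proof.
pose q (U : 'M[R]_4) : {poly R} := if U == 0 then 1 else rVpoly (nz_row U).
have q0 U : q U != 0.
  rewrite /q; case: (eqVneq U) => [_|U0]; first exact: (oner_neq0 {poly R}).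
  apply: contra_neq U0 => E; apply/eqP.
  by rewrite -nz_row_eq0 -[nz_row U]rVpolyK E linear0.
pose Q := \prod_(U <- Us) q U.
have Q0 : Q != 0 by rewrite /Q prodf_seq_neq0; apply/allP => U _; rewrite q0.
have [x xQ] : exists x, ~~ root Q x.
  apply: contrapT => nex.
  have rQ x : root Q x by apply: contrapT => /negP ?; apply: nex; exists x.
  suff : (size [seq i%:R : R | i <- iota 0 (size Q)] < size Q)%N.
    by rewrite size_map size_iota ltnn.
  apply: max_poly_roots => //; first by apply/allP => y _; exact: rQ.
  by rewrite map_inj_uniq ?iota_uniq// => m n /eqP; rewrite eqr_nat => /eqP.
exists x => U UUs U0; apply: contraNneq xQ => Ux.
rewrite /Q /root horner_prod prodf_seq_eq0; apply/hasP; exists U => //=.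
have : nz_row U *m moment_col x = 0.
  by have /submxP[D ->] := nz_row_sub U; rewrite -mulmxA Ux mulmx0.
rewrite momentE => /matrixP/(_ 0 0); rewrite !mxE eqxx mulr1n => E.
rewrite /q (negbTE U0); apply/eqP; rewrite -[RHS]E.
rewrite (@horner_coef_wide _ 4) ?size_poly//.
by apply: eq_bigr => i _; rewrite coef_rVpoly_ord.
Qed.

(** Each hyperplane lowers the rank of every nonzero listed subspace by at least one, so [j] of them
    meet a subspace of rank at most [j] only in 0. *)
Lemma moment_flags k (Us : seq 'M[R]_4) : exists t, forall U, U \in Us ->
  forall j w, (j <= k)%N -> (w <= U)%MS -> (\rank U <= j)%N ->
  flat (fun i => moment (t i)) j w -> w = 0.
Proof.
elim: k Us => [|k IH] Us.
  exists (fun=> 0) => U _ j w; rewrite leqn0 => /eqP-> wU.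
  by rewrite leqn0 mxrank_eq0 => /eqP U0 _; apply/eqP; rewrite -submx0 -U0.
have [x xUs] := moment_avoid Us.
have [t tP] := IH [seq (U :&: kermx (moment_col x))%MS | U <- Us].
exists (fun i => if i is i'.+1 then t i' else x) => U UUs [|j] w.
  by move=> _ wU; rewrite leqn0 mxrank_eq0 => /eqP U0 _; apply/eqP; rewrite -submx0 -U0.
rewrite ltnS => jk wU rU fw.
apply: (tP _ (map_f _ UUs) j w jk); last by move=> i ij; exact: (fw i.+1).
  rewrite sub_capmx wU /=; apply/sub_kermxP; rewrite momentE.
  by rewrite (fw 0%N)// raddf0.
have [U0|U0] := eqVneq U 0; first by rewrite U0 cap0mx mxrank0.
rewrite -(leq_add2l 1); apply: leq_trans rU.
by rewrite -(mxrank_mul_ker U (moment_col x)) leq_add2r lt0n mxrank_eq0 xUs.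
Qed.

Lemma rank_span (s : seq 'rV[R]_4) : (\rank (\sum_(v <- s) <<v>>)%MS <= size s)%N.
Proof.
elim: s => [|v s IH]; first by rewrite big_nil mxrank0.
rewrite big_cons (leq_trans (mxrank_adds_leqif _ _))//.
by apply: (@leq_add _ _ 1) => //; rewrite mxrank_gen rank_leq_row.
Qed.

Lemma hull_span (s : seq 'rV[R]_4) w : hull s w -> (w <= \sum_(v <- s) <<v>>)%MS.
Proof.
move=> /(_ (fun w => (w <= \sum_(v <- s) <<v>>)%MS)); apply.
  by move=> u v a uS vS _; rewrite addmx_sub ?scalemx_sub.
move=> v vs; rewrite (big_rem _ vs) /=; apply: submx_trans (addsmxSl _ _).
by rewrite genmxE.
Qed.

Fixpoint words (T : eqType) n (P : seq T) : seq (seq T) :=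
  if n is n'.+1 then [seq v :: s | v <- P, s <- words n' P] else [:: [::]].

Lemma mem_words (T : eqType) (P s : seq T) :
  {subset s <= P} -> s \in words (size s) P.
Proof.
elim: s => //= v s IH sP; apply: allpairs_f.
  exact/sP/mem_head.
by apply: IH => u us; apply: sP; rewrite inE us orbT.
Qed.

(** The lists of at most four vectors of [P] have finitely many spans. A hull lies in its span, so a
    hull point on the flat is 0; the full space [1%:M] is listed as well to get the first claim. *)
Lemma generic_flag (P : seq 'rV[R]_4) : exists t,
  (forall w, flat (fun i => moment (t i)) 4 w -> w = 0) /\
  forall s, {subset s <= P} -> (size s <= 4)%N -> ~ hull s 0 ->
    avoids (fun i => moment (t i)) (size s) s.
Proof.
pose sp (s : seq 'rV[R]_4) := (\sum_(v <- s) <<v>>)%MS.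
have [t tP] := moment_flags 4 (1%:M :: flatten [seq map sp (words n P) | n <- iota 0 5]).
have f4 w : flat (fun i => moment (t i)) 4 w -> w = 0.
  by apply: (tP 1%:M (mem_head _ _) 4) => //; rewrite ?submx1// mxrank1.
exists t; split=> // s sP s4 s0 w hw fw; apply: s0.
suff -> : 0 = w by [].
apply/esym/(tP (sp s) _ (size s)) => //; last 2 first.
- exact: hull_span.
- exact: rank_span.
rewrite inE; apply/orP; right; apply/flatten_mapP; exists (size s).
  by rewrite mem_iota.
exact/map_f/mem_words.
Qed.

End MomentCurve.

(** * Uniform continuity and Euclidean geometry *)

Section UniformContinuity.
Variables (R : realType) (V W : normedModType R).
Implicit Types (K : set V) (f : V -> W).

Definition cont_on K f := forall x, K x -> forall e, 0 < e ->
  exists2 d, 0 < d & forall y, K y -> `|x - y| < d -> `|f x - f y| < e.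

Lemma uc_on K f : compact K -> cont_on K f -> forall e, 0 < e ->
  exists2 d, 0 < d & forall x y, K x -> K y -> `|x - y| < d -> `|f x - f y| < e.
Proof.
move=> /compact_near_coveringP cK cf e e0.
have : \forall d \near 0^'+, K `<=` (fun x => K x -> forall y, K y -> `|x - y| < d -> `|f x - f y| < e).
  apply: cK => x Kx; have e2 : 0 < e / 2 by rewrite divr_gt0.
  have [d d0 xd] := cf x Kx _ e2; have d2 : 0 < d / 2 by rewrite divr_gt0.
  near=> x' d' => /= Kx' y Ky yd'.
  have x'd : `|x - x'| < d / 2 by near: x'; apply: cvgr_dist_lt d2.
  have d'd : d' < d / 2 by near: d'; exact: nbhs_right_lt.
  have h1 : `|f x - f x'| < e / 2 by apply: xd => //; lra.
  have h2 : `|f x - f y| < e / 2.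
    by apply: xd => //; have := ler_distD x' x y; lra.
  by have := ler_distD (f x) (f x') (f y); rewrite (distrC (f x') (f x)); lra.
move=> Kd; have : \forall d \near (0 : R)^'+, K `<=` (fun x => K x -> forall y, K y -> `|x - y| < d -> `|f x - f y| < e) /\ 0 < d.
  by near=> d; split; near: d => //; exact: nbhs_right_gt.
by move=> /filter_ex[d [H d0]]; exists d => // x y Kx; exact: H.
Unshelve. all: by end_near. Qed.

Lemma near_pair (x y : V) d1 d2 : 0 < d1 -> 0 < d2 ->
  \forall z \near (x, y), `|x - z.1| < d1 /\ `|y - z.2| < d2.
Proof.
move=> d10 d20; exists (ball x d1, ball y d2) => /=.
  by split; exact: nbhsx_ballx.
by move=> [u v] /=; rewrite -!ball_normE.
Qed.

(** Uniform continuity of the inverse of [f], by covering [K] times [K]: around pairs closer than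
    [e] the claim is vacuous, around the others the distance of the images stays above a third of
    its value. *)
Lemma sep_on K f : compact K -> cont_on K f ->
  (forall x y, K x -> K y -> f x = f y -> x = y) -> forall e, 0 < e ->
  exists2 d, 0 < d & forall x y, K x -> K y -> e <= `|x - y| -> d <= `|f x - f y|.
Proof.
move=> cK cf fI e e0.
have /compact_near_coveringP cKK := compact_setX cK cK.
have : \forall d \near (0 : R)^'+, (K `*` K) `<=` (fun z => K z.1 -> K z.2 -> e <= `|z.1 - z.2| -> d <= `|f z.1 - f z.2|).
  apply: cKK => -[x y] [/= Kx Ky].
  have [xye|exy] := ltP `|x - y| e.
    have d0 : 0 < (e - `|x - y|) / 2 by rewrite divr_gt0// subr_gt0.
    near=> z d => /= _ _ exz; exfalso.
    have [xz yz] : `|x - z.1| < (e - `|x - y|) / 2 /\ `|y - z.2| < (e - `|x - y|) / 2.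
      by near: z; exact: near_pair.
    have := ler_distD x z.1 z.2; have := ler_distD y x z.2.
    by rewrite (distrC z.1 x); lra.
  have f0 : 0 < `|f x - f y|.
    rewrite normr_gt0 subr_eq0; apply/eqP => /(fI _ _ Kx Ky) xy.
    by move: exy; rewrite xy subrr normr0; lra.
  have f3 : 0 < `|f x - f y| / 3 by rewrite divr_gt0.
  have [d1 d10 xd1] := cf x Kx _ f3; have [d2 d20 yd2] := cf y Ky _ f3.
  near=> z d => /= Kz1 Kz2 _.
  have [xz yz] : `|x - z.1| < d1 /\ `|y - z.2| < d2.
    by near: z; exact: near_pair.
  have h1 : `|f x - f z.1| < `|f x - f y| / 3.
    exact: xd1.
  have h2 : `|f y - f z.2| < `|f x - f y| / 3.
    exact: yd2.
  have dl : d <= `|f x - f y| / 3 by near: d; exact: nbhs_right_ltW.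
  have := ler_distD (f z.1) (f x) (f y); have := ler_distD (f z.2) (f z.1) (f y).
  by rewrite (distrC (f z.2) (f y)); lra.
move=> Kd; have : \forall d \near (0 : R)^'+, ((K `*` K) `<=` (fun z => K z.1 -> K z.2 -> e <= `|z.1 - z.2| -> d <= `|f z.1 - f z.2|)) /\ 0 < d.
  by near=> d; split; near: d => //; exact: nbhs_right_gt.
by move=> /filter_ex[d [H d0]]; exists d => // x y Kx Ky; exact: (H (x, y)).
Unshelve. all: by end_near. Qed.

End UniformContinuity.

Lemma ivt_on (R : realType) (f : R -> R) (a b v : R) : a <= b ->
  cont_on `[a, b]%classic f -> f a <= v <= f b \/ f b <= v <= f a ->
  exists2 c, a <= c <= b & f c = v.
Proof.
move=> ab cf vab.
have [||c cab fc] := @IVT R f a b v ab; last by exists c => //; move: cab; rewrite in_itv.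
  apply/subspace_continuousP => x xab; apply/cvgrPdist_lt => e e0.
  have [d d0 fd] := cf x xab e e0.
  rewrite near_withinE; apply/nbhs_ballP; exists d => // y.
  by rewrite -ball_normE => xy yab; exact: fd.
by rewrite ge_min le_max; case: vab => /andP[-> ->]; rewrite ?orbT.
Qed.

Lemma coord_le_norm (R : realType) n (u : 'rV[R]_n) i : `|u 0 i| <= `|u|.
Proof. by rewrite [leRHS]mx_normrE (le_bigmax _ (fun i => `|u i.1 i.2|) (0, i)). Qed.

Lemma norm_le_coord (R : realType) n (u : 'rV[R]_n) (d : R) :
  0 <= d -> (forall i, `|u 0 i| <= d) -> `|u| <= d.
Proof.
move=> d0 ud; rewrite [leLHS]mx_normrE; apply/bigmax_leP; split => // -[i j] _ /=.
by rewrite (ord1 i).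
Qed.

Section Euclid.
Variable R : realType.
Local Notation V := 'rV[R]_4.
Implicit Types (u v w a q : V).

Definition dotv u v : R := \sum_i u 0 i * v 0 i.

Lemma dotvC u v : dotv u v = dotv v u.
Proof. by apply: eq_bigr => i _; rewrite mulrC. Qed.

Lemma dotvDr u v w : dotv u (v + w) = dotv u v + dotv u w.
Proof. by rewrite -big_split; apply: eq_bigr => i _; rewrite mxE mulrDr. Qed.

Lemma dotvZr u (b : R) v : dotv u (b *: v) = b * dotv u v.
Proof. by rewrite mulr_sumr; apply: eq_bigr => i _; rewrite mxE mulrCA. Qed.

Lemma dotvNr u v : dotv u (- v) = - dotv u v.
Proof. by rewrite -scaleN1r dotvZr mulN1r. Qed.

Lemma dotvBr u v w : dotv u (v - w) = dotv u v - dotv u w.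
Proof. by rewrite dotvDr dotvNr. Qed.

Lemma dotvBl u v w : dotv (v - w) u = dotv v u - dotv w u.
Proof. by rewrite ![dotv _ u]dotvC dotvBr. Qed.

(** The factor 4 is the dimension: the norm is the sup norm, the product Euclidean. *)
Lemma dotv_le u v : `|dotv u v| <= 4 * (`|u| * `|v|).
Proof.
rewrite (le_trans (ler_norm_sum _ _ _))//.
have -> : 4 * (`|u| * `|v|) = \sum_(i < 4) `|u| * `|v|.
  by rewrite sumr_const card_ord mulr_natl.
by apply: ler_sum => i _; rewrite normrM ler_pM ?coord_le_norm.
Qed.

Lemma sq_le_dotv u : `|u| ^+ 2 <= dotv u u.
Proof.
have d0 : 0 <= dotv u u by apply: sumr_ge0 => i _; rewrite -expr2 sqr_ge0.
rewrite -(sqr_sqrtr d0) ler_pXn2r ?nnegrE ?sqrtr_ge0//.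
apply: norm_le_coord => [|i]; first exact: sqrtr_ge0.
rewrite -sqrtr_sqr ler_sqrt// /dotv (bigD1 i) //= -expr2 lerDl.
by apply: sumr_ge0 => j _; rewrite -expr2 sqr_ge0.
Qed.

Lemma dotv_gt0 u : u != 0 -> 0 < dotv u u.
Proof.
rewrite -normr_gt0 => u0; apply: lt_le_trans (sq_le_dotv u).
by rewrite exprn_gt0.
Qed.

Lemma unit_norm_le u : dotv u u = 1 -> `|u| <= 1.
Proof.
by move=> u1; have := sq_le_dotv u; rewrite u1 -[X in _ <= X](expr1n _ 2) ler_pXn2r ?nnegrE.
Qed.

Lemma unit_norm_ge u : dotv u u = 1 -> 1 / 2 <= `|u|.
Proof.
move=> u1; have := dotv_le u u; rewrite u1 normr1 -expr2 => le4.
rewrite leNgt; apply/negP => lt2.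
have : `|u| ^+ 2 < (1 / 2) ^+ 2 by rewrite ltr_pXn2r ?nnegrE//; lra.
by rewrite expr2 in le4 *; lra.
Qed.

Lemma half_space_hull s w : (forall v, v \in s -> 0 < dotv w v) -> ~ hull s 0.
Proof.
move=> ws /(_ (fun v => 0 < dotv w v)) H.
suff : 0 < dotv w 0 by rewrite -(subrr w) dotvBr subrr ltxx.
apply: H => // u v t u0 v0 /andP[t0 t1]; rewrite dotvDr !dotvZr.
have [->|tn0] := eqVneq t 0; first by rewrite mul0r add0r subr0 mul1r.
apply: ltr_wpDr; first by apply: mulr_ge0; [rewrite subr_ge0|exact: ltW].
by rewrite mulr_gt0 // lt0r tn0.
Qed.

(* The vector [q - a] has the same inner product [|q - a|^2 / 2] with [q] and [- a]. *)
Lemma cluster_hull s a q (e r : R) : dotv a a = 1 -> dotv q q = 1 ->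
  e <= `|q - a| -> 0 <= e -> 16 * r <= e ^+ 2 ->
  (forall v, v \in s -> `|v + a| < r \/ `|v - q| < r) -> ~ hull s 0.
Proof.
move=> a1 q1 eqa e0 er sP; apply: (@half_space_hull s (q - a)) => v vs.
have sq : e ^+ 2 <= dotv (q - a) (q - a).
  by apply: le_trans (sq_le_dotv _); rewrite ler_pXn2r ?nnegrE.
have n2 : `|q - a| <= 2.
  by have := ler_normB q a; have := unit_norm_le a1; have := unit_norm_le q1; lra.
(* By [dotv_le] the error is below 4 * 2 * r, and 8 * r is at most half of [e ^+ 2], hence at most
   the inner product of [q - a] with [q] and with [- a]. *)
have small w : `|w| < r -> - (8 * r) < dotv (q - a) w.
  move=> wr; have := dotv_le (q - a) w; rewrite ler_norml => /andP[+ _].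
  have : `|q - a| * `|w| <= 2 * `|w| by rewrite ler_wpM2r.
  lra.
move: sq; rewrite dotvBl !dotvBr a1 q1 (dotvC a q) => sq.
case: (sP v vs) => /small.
  by rewrite dotvDr [dotv (q - a) a]dotvBl a1; lra.
by rewrite dotvBr [dotv (q - a) q]dotvBl q1 (dotvC a q); lra.
Qed.

Definition normalize u : V := (Num.sqrt (dotv u u))^-1 *: u.

Lemma normalize_unit u : u != 0 -> dotv (normalize u) (normalize u) = 1.
Proof.
move=> u0; have d0 := dotv_gt0 u0.
rewrite /normalize dotvZr dotvC dotvZr mulrA -expr2 exprVn sqr_sqrtr ?ltW//.
by rewrite mulVf ?gt_eqF.
Qed.

Lemma normalize_id u : dotv u u = 1 -> normalize u = u.
Proof. by rewrite /normalize => ->; rewrite sqrtr1 invr1 scale1r. Qed.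

Lemma dotv_normalize_gt0 w u : u != 0 -> 0 < dotv w u -> 0 < dotv w (normalize u).
Proof. by move=> /dotv_gt0 u0 wu; rewrite dotvZr mulr_gt0// invr_gt0 sqrtr_gt0. Qed.

Lemma dotv_self_continuous : continuous (fun u => dotv u u).
Proof.
apply: (@continuous_big R 'I_4 +%R 0 xpredT _ V _ (fun i u => u 0 i * u 0 i)).
  exact: add_continuous.
by move=> i _ u; apply: continuousM; exact: coord_continuous.
Qed.

Lemma normalize_continuous u : u != 0 -> {for u, continuous normalize}.
Proof.
move=> u0; apply: (@continuousZ _ _ _ (fun u => (Num.sqrt (dotv u u))^-1) id).
  apply: continuousV; first by rewrite gt_eqF// sqrtr_gt0 dotv_gt0.
  apply: (@continuous_comp _ _ _ (fun u => dotv u u) Num.sqrt).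
    exact: dotv_self_continuous.
  exact: sqrt_continuous.
exact: cvg_id.
Qed.

Lemma compact_closed_bounded (n : nat) (K : set 'rV[R]_n) (M : R) :
  closed K -> (forall x, K x -> `|x| <= M) -> compact K.
Proof.
move=> clK bK; apply: bounded_closed_compact => //.
exists M; split; first exact: num_real.
by move=> x Mx u /bK uM; exact: le_trans uM (ltW Mx).
Qed.

Lemma sphere3E : sphere3 R = [set u | dotv u u = 1].
Proof.
by apply/seteqP; split=> u; rewrite /sphere3 /dotv /= => u1; rewrite -[RHS]u1; apply: eq_bigr => i _; rewrite expr2.
Qed.

Lemma sphere3P u : sphere3 R u <-> dotv u u = 1.
Proof. by rewrite sphere3E. Qed.

Lemma sphere_compact : compact (sphere3 R).
Proof.
rewrite sphere3E; apply: (@compact_closed_bounded _ _ 1); last first.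
  by move=> u; exact: unit_norm_le.
rewrite (_ : [set _ | _] = (fun u => dotv u u) @^-1` [set 1])//.
apply: (@closed_comp V R); last exact: closed_eq.
by move=> u _; exact: dotv_self_continuous.
Qed.

Lemma annulus_compact (c M : R) : compact [set u : V | c <= `|u| <= M].
Proof.
apply: (@compact_closed_bounded _ _ M); last by move=> u /andP[].
rewrite (_ : [set _ | _] = (fun u : V => `|u|) @^-1` `[c, M]%classic); last first.
  by apply/seteqP; split=> u /=; rewrite in_itv.
apply: (@closed_comp V R); last exact: itv_closed.
by move=> u _; exact: norm_continuous.
Qed.

Lemma normalize_uc (c M e : R) : 0 < c -> 0 < e ->
  exists2 d, 0 < d & forall u v : V, c <= `|u| <= M -> c <= `|v| <= M ->
    `|u - v| < d -> `|normalize u - normalize v| < e.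
Proof.
move=> c0 e0.
have cN : cont_on [set u : V | c <= `|u| <= M] normalize.
  move=> u /andP[cu _] e' e'0.
  have u0 : u != 0 by rewrite -normr_gt0; lra.
  have /cvgrPdist_lt/(_ e' e'0)/nbhs_ballP[d /= d0 ud] := normalize_continuous u0.
  by exists d => // v _ uv; apply: ud; rewrite -ball_normE.
have [d d0 dP] := uc_on (@annulus_compact c M) cN e0.
by exists d => // u v ? ?; exact: dP.
Qed.

End Euclid.

(** * Comparison of join cycles *)

Section JoinCompare.
Variables (R : realType) (P : eqType).
Local Notation V := 'rV[R]_4.
Implicit Types (u : seq V) (g : P -> V) (q : P * P).

Definition locally_cocycle (D : seq V -> int) :=
  forall u, ~ hull u 0 -> cob D u = 0.

(** The carrier of a join: a cluster at the antipode of the fixed point [c], and one at a point [q]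
    that may change from simplex to simplex. [cluster_hull] keeps such hulls off the origin. *)
Definition two_clusters (c : V) (e r : R) u :=
  exists2 q : V, dotv q q = 1 /\ e <= `|q - c| &
    forall v, v \in u -> `|v + c| < r \/ `|v - q| < r.

(** A reflected vertex is preferred as apex: it lies near [- c] and can be added to any
    [two_clusters] simplex, whatever the second centre of that simplex. *)
Definition join_apex g (s : seq (bool * P)) : V :=
  if [seq z <- s | z.1] is z :: _ then reflect_label g z
  else if s is z :: _ then reflect_label g z else 0.

Lemma join_apex_mem g s : s != [::] -> exists2 z, z \in s &
  join_apex g s = reflect_label g z /\ (has fst s -> z.1).
Proof.
rewrite /join_apex has_filter => s0.
case E : ([seq z <- s | z.1]) => [|z t].
  by case: s s0 {E} => // z s _; exists z; rewrite ?mem_head.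
have : z \in [seq z <- s | z.1] by rewrite E mem_head.
by rewrite mem_filter => /andP[z1 zs]; exists z.
Qed.

Variables (Phi : (seq V -> int) -> seq (bool * P) -> int) (g : P -> V).
Hypothesis Phi_nil : forall F, Phi F [::] = F [::].
Hypothesis PhiB : forall F G s, Phi (fun u => F u - G u) s = Phi F s - Phi G s.
Hypothesis Phi_cob : forall F s, cob (Phi F) s = Phi (cob F) s.

Record join_carrier (e r : R) q q' : Prop := JoinCarrier {
  jc_unit : dotv (g q.1) (g q.1) = 1 /\ dotv (g q'.1) (g q'.1) = 1;
  jc_far : e <= `|g q'.1 - g q.1|;
  jc_small : `|g q.2 - g q.1| < r /\ `|g q'.2 - g q'.1| < r;
  jc_Phi : forall s H, (size s <= 4)%N -> {subset s <= join_simplex q q'} ->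
    (forall u, two_clusters (g q.1) e r u -> H u = 0) -> Phi H s = 0;
  jc_Phi_right : forall s H, {subset s <= [:: (false, q'.1); (false, q'.2)]} ->
    (forall u, (forall v, v \in u -> `|v - g q'.1| < r) -> H u = 0) ->
    Phi H s = 0 }.

Lemma join_carrier_htpy e r q q' n F : 0 < e -> 0 < r -> 16 * r <= e ^+ 2 ->
  join_carrier e r q q' -> (forall u, ~ hull u 0 -> F u = 0) ->
  carrier_htpy Phi (reflect_label g) (join_apex g) n F (join_simplex q q') = 0.
Proof.
case: q q' => x x' [y y'] e0 r0 er [/= [ux uy] far [xx' yy'] PhiL PhiR] F0.
(* A face without reflected vertex is coned from an unreflected one, which requires a carrier with
   fixed centre: the ball about [g y]. *)
pose Pc (s : seq (bool * P)) u := if has fst s then two_clusters (g x) e r u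
  else forall v, v \in u -> `|v - g y| < r.
have near_two u : (forall v, v \in u -> `|v - g y| < r) -> two_clusters (g x) e r u.
  by move=> uy'; exists (g y) => // v /uy'; right.
have Pc_two s u : Pc s u -> two_clusters (g x) e r u.
  by rewrite /Pc; case: ifP => // _; exact: near_two.
have label z : z \in join_simplex (x, x') (y, y') ->
    if z.1 then `|reflect_label g z + g x| < r else `|reflect_label g z - g y| < r.
  rewrite !inE => /or4P[] /eqP-> /=; rewrite /reflect_label /=.
  - by rewrite addNr normr0.
  - by rewrite addrC distrC.
  - by rewrite subrr normr0.
  - by [].
apply: (@carrier_htpy0 _ _ _ _ _ Phi_nil Pc n F (join_simplex (x, x') (y, y'))) => //.
- move=> s H s4 ss; rewrite /Pc; case: (boolP (has fst s)) => hs H0.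
    exact: (PhiL s).
  apply: (PhiR s) => // z zs; have := ss z zs.
  have : ~~ z.1 by apply: contraNN hs => z1; apply/hasP; exists z.
  by case: z {zs} => -[|] z //= _; rewrite !inE.
- move=> s ss; rewrite /Pc; case: (boolP (has fst s)) => hs.
    exists (g y) => // _ /mapP[z /ss /label + ->].
    by case: ifP => _; [left|right].
  move=> _ /mapP[z zs ->]; have := label z (ss z zs).
  by case: ifP => // z1; move: hs; rewrite (introT hasP)//; exists z.
- move=> s u s0 ss; have [z zs [-> hz]] := join_apex_mem g s0.
  have := label z (ss z zs); rewrite /Pc; case: (boolP (has fst s)) => hs.
    rewrite hz// => lz [q uq qu]; exists q => // v.
    by rewrite inE => /predU1P[->|/qu//]; left.
  rewrite ifF; last by apply: contraNF hs => z1; apply/hasP; exists z.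
  by move=> lz qu v; rewrite inE => /predU1P[->|/qu].
- move=> s s' u ss s's; rewrite {2}/Pc; case: (boolP (has fst s)) => hs; first exact: Pc_two.
  rewrite /Pc ifF//; apply: contraNF hs => /hasP[z /s's zs z1].
  by apply/hasP; exists z.
- move=> u /Pc_two[q [uq eq] qu]; apply: F0.
  exact: (cluster_hull ux uq eq (ltW e0) er qu).
Qed.

(** The homotopy term in [cob D] vanishes on the carriers, so the two cochains differ by a
    coboundary, which the cycle does not see. *)
Lemma join_cycle_compare e r a p D : 0 < e -> 0 < r -> 16 * r <= e ^+ 2 ->
  edge_path a p -> locally_cocycle D ->
  (forall t q q', t \in hex_pairs ->
     (q \in a t.2.1 /\ q' \in a t.2.2) \/ (q \in a t.2.2 /\ q' \in a t.2.1) ->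
     join_carrier e r q q') ->
  join_cycle a (Phi D) = join_cycle a (fun s => D (map (reflect_label g) s)).
Proof.
move=> e0 r0 er ap cD jc.
pose K := carrier_htpy Phi (reflect_label g) (join_apex g).
have -> : join_cycle a (Phi D) =
    join_cycle a (fun s => D (map (reflect_label g) s) + cob (K 4 D) s).
  apply: eq_join_cycle => t q q' ht hq.
  have E := carrier_htpyE (reflect_label g) (join_apex g) Phi_nil PhiB Phi_cob D
    (s := join_simplex q q') (n := 4) isT.
  rewrite (join_carrier_htpy 5 e0 r0 er (jc t q q' ht hq) cD) addr0 in E.
  by rewrite -[cob _ _]E addrC subrK.
by rewrite join_cycleD (join_cycle_cob ap) addr0.
Qed.

End JoinCompare.

Section JoinMoves.
Variables (R : realType) (P : eqType).
Local Notation V := 'rV[R]_4.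

Lemma join_small_move (g g2 : P -> V) e r a p D :
  0 < e -> 0 < r -> 16 * r <= e ^+ 2 ->
  edge_path a p -> locally_cocycle D ->
  (forall t q q', t \in hex_pairs ->
     (q \in a t.2.1 /\ q' \in a t.2.2) \/ (q \in a t.2.2 /\ q' \in a t.2.1) ->
     e <= `|g q'.1 - g q.1|) ->
  (forall j q, (j < 9)%N -> q \in a j -> [/\ dotv (g q.1) (g q.1) = 1,
     `|g q.2 - g q.1| < r, `|g2 q.1 - g q.1| < r & `|g2 q.2 - g q.1| < r]) ->
  join_cycle a (fun s => D (map (reflect_label g2) s)) =
  join_cycle a (fun s => D (map (reflect_label g) s)).
Proof.
move=> e0 r0 er ap cD far near.
pose Phi (F : seq V -> int) s := F (map (reflect_label g2) s).
apply: (@join_cycle_compare R P Phi g _ _ _ e r a p D) => //.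
  by move=> F s; rewrite /Phi -cob_map.
move=> t q q' ht hq.
have lt9 : (t.2.1 < 9)%N && (t.2.2 < 9)%N by move: t ht {hq}; exact/allP.
have [[ux xx' x2 x2'] [uy yy' y2 y2']] : [/\ dotv (g q.1) (g q.1) = 1,
     `|g q.2 - g q.1| < r, `|g2 q.1 - g q.1| < r & `|g2 q.2 - g q.1| < r] /\
  [/\ dotv (g q'.1) (g q'.1) = 1,
     `|g q'.2 - g q'.1| < r, `|g2 q'.1 - g q'.1| < r & `|g2 q'.2 - g q'.1| < r].
  case: hq lt9 => -[qa q'a] /andP[h1 h2].
    by split; [exact: near _ _ h1 qa|exact: near _ _ h2 q'a].
  by split; [exact: near _ _ h2 qa|exact: near _ _ h1 q'a].
split=> //; first exact: far hq.
- move=> s H _ ss H0; apply: H0; exists (g q'.1); first by split=> //; exact: far hq.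
  move=> _ /mapP[z /ss zs ->]; move: zs; rewrite !inE => /or4P[] /eqP->;
    rewrite /reflect_label /=; [left|left|right|right]; rewrite ?[- _ + _]addrC 1?distrC//.
  + by rewrite distrC.
  + by rewrite distrC.
- move=> s H ss H0; apply: H0 => _ /mapP[z /ss zs ->].
  by move: zs; rewrite !inE => /orP[] /eqP->.
Qed.

End JoinMoves.

Section JoinRefine.
Variable R : realType.
Local Notation V := 'rV[R]_4.
Variable hh : V -> V.
Hypothesis hh_unit : forall u, dotv u u = 1 -> dotv (hh u) (hh u) = 1.
Hypothesis hh_cont : cont_on (sphere3 R) hh.
Hypothesis hh_inj : forall u v, sphere3 R u -> sphere3 R v -> hh u = hh v -> u = v.

Let hn (u : V) : V := hh (normalize u).

(** The pieces of a subdivided join spread all the way from [- g x] to [g y], but each is small and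
    all stay away from [g x]. So [hh] sends each of them into one ball whose centre [q] is far from
    [hh (g x)], as [two_clusters] demands. *)
Lemma join_refine (dl : R) : 0 < dl -> exists2 r0, 0 < r0 &
  exists m0, forall m, (m0 <= m)%N ->
  forall (P : eqType) (g : P -> V) a p D, edge_path a p -> locally_cocycle D ->
  (forall t q q', t \in hex_pairs ->
     (q \in a t.2.1 /\ q' \in a t.2.2) \/ (q \in a t.2.2 /\ q' \in a t.2.1) ->
     dl <= `|g q'.1 - g q.1|) ->
  (forall j q, (j < 9)%N -> q \in a j -> [/\ dotv (g q.1) (g q.1) = 1,
     dotv (g q.2) (g q.2) = 1 & `|g q.2 - g q.1| < r0]) ->
  join_cycle a (fun s => iter m sd (fun u => D (map hn u)) (map (reflect_label g) s)) =
  join_cycle a (fun s => D (map (reflect_label (fun x => hh (g x))) s)).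
Proof.
move=> dl0.
have dl2 : 0 < dl ^+ 2 / 32 by rewrite divr_gt0 ?exprn_gt0.
(* Distances before [hh] is applied: [dl] between [g y] and [g x], and [dl ^+ 2 / 32] between [g x]
   and the projected pieces of a join. *)
pose d1 := Num.min dl (dl ^+ 2 / 32).
have d10 : 0 < d1 by rewrite lt_min dl0.
have [e e0 sep] := sep_on (@sphere_compact R) hh_cont hh_inj d10.
pose r := e ^+ 2 / 16.
have r_gt0 : 0 < r by rewrite divr_gt0 ?exprn_gt0.
have er : 16 * r <= e ^+ 2 by rewrite /r; lra.
have [dh dh0 uch] := uc_on (@sphere_compact R) hh_cont r_gt0.
(* A lower bound for the norms of points to be projected: on a join the inner product with [w] is at
   least [dl ^+ 2 / 4] and at most 8 times the norm, and points within 1 / 4 of a unit vector have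
   sup norm at least 1 / 4. *)
pose c := Num.min (dl ^+ 2 / 32) (1 / 4).
have c0 : 0 < c by rewrite lt_min dl2; lra.
have [dN dN0 ucN] := @normalize_uc R c 2 dh c0 dh0.
pose r0 := Num.min (Num.min (1 / 4) (dl ^+ 2 / 32)) (Num.min dN dh).
have r0P x : x < r0 -> [/\ x < 1 / 4, x < dl ^+ 2 / 32, x < dN & x < dh].
  by rewrite !lt_min => /andP[/andP[? ?] /andP[? ?]].
exists r0; first by rewrite !lt_min dl2 dN0 dh0; lra.
have [m0 m0P] := @mesh_small R 2 dN dN0.
exists m0 => m /m0P md P g a p D ap cD far near.
have sphE := @sphere3P R.
have hn_unit u : u != 0 -> dotv (hn u) (hn u) = 1.
  by move=> u0; exact/hh_unit/normalize_unit.
have hn_close u v : c <= `|u| <= 2 -> c <= `|v| <= 2 -> `|u - v| < dN -> `|hn u - hn v| < r.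
  move=> cu cv uv; have u0 : u != 0 by rewrite -normr_gt0; lra.
  have v0 : v != 0 by rewrite -normr_gt0; lra.
  apply: uch; [exact/sphE/normalize_unit|exact/sphE/normalize_unit|exact: ucN].
have hn_id u : dotv u u = 1 -> hn u = hh u by move=> u1; rewrite /hn normalize_id.
pose Phi (F : seq V -> int) s := iter m sd (fun u => F (map hn u)) (map (reflect_label g) s).
apply: (@join_cycle_compare R P Phi (fun x => hh (g x)) _ _ _ e r a p D) => //.
- by move=> F; rewrite /Phi iter_sd_nil.
- by move=> F G s; rewrite /Phi -iter_sdB.
- move=> F s; rewrite /Phi -[LHS]cob_map cob_iter_sd; apply: iter_sd_ext => u.
  by rewrite cob_map.
move=> t q q' ht hq.
have lt9 : (t.2.1 < 9)%N && (t.2.2 < 9)%N by move: t ht {hq}; exact/allP.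
have [[ux ux' xx'] [uy uy' yy']] : [/\ dotv (g q.1) (g q.1) = 1,
     dotv (g q.2) (g q.2) = 1 & `|g q.2 - g q.1| < r0] /\
  [/\ dotv (g q'.1) (g q'.1) = 1,
     dotv (g q'.2) (g q'.2) = 1 & `|g q'.2 - g q'.1| < r0].
  case: hq lt9 => -[qa q'a] /andP[h1 h2].
    by split; [exact: near _ _ h1 qa|exact: near _ _ h2 q'a].
  by split; [exact: near _ _ h2 qa|exact: near _ _ h1 q'a].
have xy := far _ _ _ ht hq.
case: q q' {hq} ux ux' xx' uy uy' yy' xy => x x' [y y'] /= ux ux' xx' uy uy' yy' xy.
have {xx'} [xx4 xxd xxN xxh] := r0P _ xx'.
have {yy'} [yy4 yyd yyN yyh] := r0P _ yy'.
have unit_ann u : dotv u u = 1 -> c <= `|u| <= 2.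
  move=> u1; have := unit_norm_ge u1; have := unit_norm_le u1.
  by rewrite /c ge_min; lra.
split => /=.
- by split; exact: hh_unit.
- apply: sep; [exact/sphE|exact/sphE|].
  by rewrite ge_min xy.
- by split; apply: uch => //; exact/sphE.
- move=> s H s4 ss H0; rewrite /Phi.
  pose w := g y - g x; pose k := dotv w (g y).
  have kE : k = dotv w w / 2.
    by rewrite /k /w dotvBl !dotvBl !dotvBr ux uy [dotv (g y) (g x)]dotvC; lra.
  have kx : dotv w (g x) = - k.
    by rewrite /k /w !dotvBl ux uy [dotv (g y) (g x)]dotvC; lra.
  have kdl : dl ^+ 2 / 2 <= k.
    suff : dl ^+ 2 <= dotv w w by rewrite kE; lra.
    by apply: le_trans (sq_le_dotv _); rewrite ler_pXn2r ?nnegrE// ltW.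
  have w2 : `|w| <= 2.
    by have := ler_normB (g y) (g x); have := unit_norm_le ux; have := unit_norm_le uy; rewrite /w; lra.
  have wle z : `|dotv w z| <= 8 * `|z|.
    have := dotv_le w z; have : `|w| * `|z| <= 2 * `|z| by rewrite ler_wpM2r.
    lra.
  (* A convex set containing the join: the product of [w] with [- g x] and with [g y] is [k], at
     least [dl ^+ 2 / 2], and moving by [dl ^+ 2 / 32] costs at most [dl ^+ 2 / 4]. The point [g x],
     with product [- k], lies on the other side. *)
  pose C z := dl ^+ 2 / 4 <= dotv w z /\ `|z| <= 1.
  have convC : is_convex C.
    move=> z1 z2 b [z1w z11] [z2w z21] b01; have [b0 b1] := andP b01; split.
      rewrite dotvDr !dotvZr.
      have : b * (dl ^+ 2 / 4) <= b * dotv w z1 by rewrite ler_wpM2l.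
      have : (1 - b) * (dl ^+ 2 / 4) <= (1 - b) * dotv w z2 by rewrite ler_wpM2l// subr_ge0.
      lra.
    rewrite -[X in `|X|]opprK normrN -sub0r.
    apply: (@convex_ball_le R V 0 1) => //=; by rewrite sub0r normrN.
  have Cann z : C z -> c <= `|z| <= 2.
    move=> [zw z1]; have := wle z; rewrite ler_norml => /andP[_ h].
    by rewrite /c ge_min; lra.
  have label z : z \in join_simplex (x, x') (y, y') -> C (reflect_label g z).
    have wx : dotv w (- g x') >= dl ^+ 2 / 4.
      have := wle (g x' - g x); rewrite dotvBr kx dotvNr ler_norml; lra.
    have wy : dotv w (g y') >= dl ^+ 2 / 4.
      have := wle (g y' - g y); rewrite dotvBr -/k ler_norml; lra.
    rewrite !inE => /or4P[] /eqP-> /=; rewrite /reflect_label /C /= ?normrN; split=> //;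
      rewrite ?dotvNr ?kx; try exact: unit_norm_le; rewrite -?/k; lra.
  apply: (iter_sd_mesh0 (C := C) (d := 2) convC).
  + by rewrite size_map (leq_trans s4).
  + by move=> _ /mapP[z /ss /label Cz ->].
  + move=> _ _ /mapP[z1 /ss /label[_ h1] ->] /mapP[z2 /ss /label[_ h2] ->].
    by rewrite (le_trans (ler_normB _ _))//; lra.
  move=> [|z u] _ Cu um; apply: H0.
    by exists (hh (g y)); rewrite ?hh_unit//; split; rewrite ?hh_unit//; apply: sep; [exact/sphE|exact/sphE|rewrite ge_min xy].
  have Cz : C z by apply: Cu; exact: mem_head.
  have z0 : z != 0 by have := Cann z Cz; rewrite -normr_gt0; lra.
  exists (hn z); first split; first exact: hn_unit.
    apply: sep; [exact/sphE/normalize_unit|exact/sphE|].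
    rewrite ge_min; apply/orP; right.
    have := dotv_normalize_gt0 (w := w) z0; have := wle (normalize z - g x).
    rewrite dotvBr kx ler_norml; case: Cz; lra.
  move=> _ /mapP[z' z'u ->]; right; apply: hn_close.
  + exact/Cann/Cu.
  + exact: Cann.
  + by apply: le_lt_trans md; apply: um => //; exact: mem_head.
- move=> s H ss H0; rewrite /Phi.
  apply: (@iter_sd_face0 R V m _ _ (fun z => `|g y - z| <= `|g y' - g y|)).
  + by move=> s' s'0; apply: bary_convex => //; exact: convex_ball_le.
  + move=> _ /mapP[z /ss zs ->]; move: zs; rewrite !inE => /orP[] /eqP->;
      by rewrite /reflect_label /= ?subrr ?normr0// distrC.
  move=> u _ uB; apply: H0 => _ /mapP[z zu ->].
  have zB := uB z zu; rewrite -[hh (g y)]hn_id//; apply: hn_close.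
  + have := unit_norm_le uy; have := unit_norm_ge uy.
    have := ler_distD 0 (g y) z; have := ler_normB (g y) (g y - z).
    have := ler_normB (g y) z; have := ler_normD z (g y - z).
    by rewrite addrC subrK subKr /c ge_min; lra.
  + exact: unit_ann.
  + by rewrite distrC; lra.
Qed.

End JoinRefine.

(** * Singular chains of the sphere *)

Section Extension.
Variables (R : realType) (U W : normedModType R) (X : set U) (Y : set W) (f : X -> Y).

Definition extend (x : U) : W :=
  if pselect (X x) is left p then set_val (f (exist _ x (mem_set p))) else 0.

Lemma extendE (x : X) : extend (set_val x) = set_val (f x).
Proof.
rewrite /extend; case: pselect => [p|[]]; last exact: set_valP.
by congr (set_val (f _)); apply: val_inj.
Qed.

Lemma extend_in x : X x -> Y (extend x).
Proof.
by move=> Xx; rewrite (extendE (exist _ x (mem_set Xx))); exact: set_valP.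
Qed.

Lemma extend_cont : continuous f -> cont_on X extend.
Proof.
move=> cf x Xx e e0; pose x0 : X := exist _ x (mem_set Xx).
have cv : continuous (set_val \o f : X -> W).
  by move=> y; apply: continuous_comp; [exact: cf|exact: initial_continuous].
have /cvgrPdist_lt/(_ e e0) := cv x0.
rewrite nbhsE => -[_ [[B oB <-] Bx]] sB.
have /nbhs_ballP[d /= d0 dB] : nbhs x B by apply: open_nbhs_nbhs.
exists d => // y Xy xy.
have := sB (exist _ y (mem_set Xy)); rewrite /= -!extendE; apply.
by apply: dB; rewrite -ball_normE.
Qed.

End Extension.

Lemma extend_unit (R : realType) (U : normedModType R) (X : set U)
    (f : X -> sphere3 R) x : X x -> dotv (extend f x) (extend f x) = 1.
Proof. by move=> Xx; exact: (iffLR (sphere3P _) (extend_in f Xx)). Qed.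

Section Simplices.
Variable R : realType.
Local Notation V := 'rV[R]_4.
Implicit Types (s : seq V) (C : V -> Prop).

Lemma convex_comb C n (t : 'I_n -> R) (v : 'I_n -> V) : is_convex C ->
  (forall i, 0 <= t i) -> 0 < \sum_i t i -> (forall i, C (v i)) ->
  C ((\sum_i t i)^-1 *: \sum_i t i *: v i).
Proof.
move=> convC; elim: n t v => [|n IH] t v t0 + Cv; first by rewrite big_ord0 ltxx.
rewrite !big_ord_recl; set T := \sum_(i < n) _; set W := \sum_(i < n) _ *: _.
have T0 : 0 <= T by apply: sumr_ge0.
have [TE|Tn0] := eqVneq T 0 => S0.
  have -> : W = 0.
    apply: big1 => i _; suff -> : t (fintype.lift ord0 i) = 0 by rewrite scale0r.
    by apply/eqP; move/eqP: TE; rewrite psumr_eq0// => /allP/(_ i (mem_index_enum _)).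
  move: S0; rewrite TE !addr0 => S0; rewrite scalerA mulVf ?gt_eqF// scale1r.
  exact: Cv.
have Tp : 0 < T by rewrite lt0r Tn0.
have -> : (t ord0 + T)^-1 *: (t ord0 *: v ord0 + W) =
   (t ord0 / (t ord0 + T)) *: v ord0 + (1 - t ord0 / (t ord0 + T)) *: (T^-1 *: W).
  rewrite scalerDr !scalerA; congr (_ *: _ + _ *: _); first by rewrite mulrC.
  by field; rewrite (gt_eqF Tp) (gt_eqF S0).
apply: convC; first exact: Cv.
  by apply: IH.
have := t0 ord0; rewrite ler_pdivrMr// mul1r lerDl T0 andbT => h.
by rewrite divr_ge0// ltW.
Qed.

Definition simplex_mx k s : 'M[R]_(k.+1, 4) := \matrix_(i < k.+1) nth 0 s i.

Definition simplex_lin k s : {linear 'rV[R]_k.+1 -> V} := mulmxr (simplex_mx k s).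

Lemma simplex_linE k s x : simplex_lin k s x = \sum_i x 0 i *: nth 0 s i.
Proof.
by rewrite /= mulmx_sum_row; apply: eq_bigr => i _; rewrite rowK.
Qed.

Lemma simplex_lin_hull k s x : size s = k.+1 -> @stdsimplex R k x ->
  hull s (simplex_lin k s x).
Proof.
move=> ss [x0 x1]; rewrite simplex_linE.
have := @convex_comb (hull s) _ (x 0) (fun i : 'I_k.+1 => nth 0 s i)
  (@hull_convex _ _ s) x0.
rewrite x1 invr1 scale1r => H; apply: H => // i.
by refine (hull_mem (mem_nth _ _)); rewrite ss.
Qed.

Lemma simplex_lin_continuous k s : continuous (simplex_lin k s).
Proof.
rewrite (_ : (simplex_lin k s : _ -> _) = fun x => \sum_i x 0 i *: nth 0 s i); last first.
  by apply/funext => x; rewrite simplex_linE.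
apply: (@continuous_big V 'I_k.+1 +%R 0 xpredT _ _ _ (fun i (x : 'rV[R]_k.+1) => x 0 i *: nth 0 s i)).
  exact: add_continuous.
by move=> i _ x; apply: continuousZr_tmp; exact: coord_continuous.
Qed.

Section Rho.
Variables (k : nat) (s : seq V).
Hypothesis (sk : size s = k.+1) (s0 : ~ hull s 0).

Lemma simplex_lin_neq0 x : @stdsimplex R k x -> simplex_lin k s x != 0.
Proof.
by move=> kx; apply: contra_notN s0 => /eqP <-; exact: simplex_lin_hull.
Qed.

Lemma rho_sphere (x : @stdsimplex R k) :
  normalize (simplex_lin k s (set_val x)) \in sphere3 R.
Proof.
apply/mem_set; rewrite sphere3E; apply: normalize_unit.
exact/simplex_lin_neq0/set_valP.
Qed.

Definition rho_fun (x : @stdsimplex R k) : sphere3 R :=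
  exist (fun y => y \in sphere3 R) _ (rho_sphere x).

Lemma rho_continuous : continuous rho_fun.
Proof.
apply: (@continuous_comp_initial (sphere3 R) _ _ set_val).
move=> x; apply: (@continuous_comp _ _ _ (simplex_lin k s \o set_val) (@normalize R)).
  apply: (@continuous_comp _ _ _ set_val (simplex_lin k s)).
    exact: initial_continuous.
  exact: simplex_lin_continuous.
exact/normalize_continuous/simplex_lin_neq0/set_valP.
Qed.

Definition rho : @sing R k (sphere3 R) := mkcts rho_continuous.

End Rho.

Lemma nth_del (T : Type) (x0 : T) (s : seq T) i j : (i < size s)%N ->
  nth x0 (take i s ++ drop i.+1 s) j = nth x0 s (bump i j).
Proof.
move=> si; rewrite nth_cat size_take si /bump.
case: ltnP => ji; first by rewrite nth_take.
by rewrite nth_drop addSn subnKC.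
Qed.

Lemma size_del (T : Type) (s : seq T) i : (i < size s)%N ->
  size (take i s ++ drop i.+1 s) = (size s).-1.
Proof. by move=> si; rewrite size_cat size_take si size_drop; lia. Qed.

Lemma simplex_lin_insert0 k s (i : 'I_k.+2) x : size s = k.+2 ->
  simplex_lin k.+1 s (insert0 i x) = simplex_lin k (take i s ++ drop i.+1 s) x.
Proof.
move=> ss; rewrite !simplex_linE (bigD1_ord i) //= mxE unlift_none scale0r add0r.
by apply: eq_bigr => j _; rewrite mxE liftK nth_del// ss.
Qed.

Lemma rho_face k s (sk : size s = k.+2) (s0 : ~ hull s 0) (i : 'I_k.+2)
    (sk' : size (take i s ++ drop i.+1 s) = k.+1)
    (s0' : ~ hull (take i s ++ drop i.+1 s) 0) :
  (rho sk s0 \o face i : @sing R k (sphere3 R)) = rho sk' s0'.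
Proof.
apply/continuousEP => x; apply: val_inj => /=.
by congr (normalize _); exact: (simplex_lin_insert0 i (set_val x) sk).
Qed.

Definition std_vertices k : seq 'rV[R]_k.+1 :=
  [seq delta_mx 0 i | i <- enum 'I_k.+1].

Lemma size_std_vertices k : size (std_vertices k) = k.+1.
Proof. by rewrite size_map size_enum_ord. Qed.

Lemma nth_std_vertices k (i : 'I_k.+1) : nth 0 (std_vertices k) i = delta_mx 0 i.
Proof. by rewrite (nth_map i) ?size_enum_ord// nth_ord_enum. Qed.

Lemma simplex_lin_std k s : size s = k.+1 ->
  map (simplex_lin k s) (std_vertices k) = s.
Proof.
move=> ss; apply: (@eq_from_nth _ 0); rewrite size_map size_std_vertices// => i ik.
rewrite (nth_map 0) ?size_std_vertices// (nth_std_vertices (Ordinal ik)).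
by rewrite /= -rowE rowK.
Qed.

Lemma insert0_is_linear k (i : 'I_k.+2) : linear (@insert0 R k i).
Proof.
move=> b u v; apply/rowP => j; rewrite !mxE.
by case: unlift => [j'|] /=; rewrite ?mxE ?mulr0 ?addr0.
Qed.

HB.instance Definition _ k (i : 'I_k.+2) :=
  GRing.isLinear.Build R _ _ _ (@insert0 R k i) (insert0_is_linear i).

Lemma std_vertices_face k (i : 'I_k.+2) :
  take i (std_vertices k.+1) ++ drop i.+1 (std_vertices k.+1) =
  map (@insert0 R k i) (std_vertices k).
Proof.
have ik : (i < size (std_vertices k.+1))%N by rewrite size_std_vertices.
have sz : size (take i (std_vertices k.+1) ++ drop i.+1 (std_vertices k.+1)) = k.+1.
  by rewrite size_del// size_std_vertices.
apply: (@eq_from_nth _ 0) => [|j jk].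
  by rewrite sz size_map size_std_vertices.
rewrite sz in jk.
rewrite nth_del// [RHS](nth_map 0) ?size_std_vertices//.
have -> : nth 0 (std_vertices k) j = delta_mx 0 (Ordinal jk).
  exact: (nth_std_vertices (Ordinal jk)).
have -> : nth 0 (std_vertices k.+1) (bump i j) =
    delta_mx 0 (fintype.lift i (Ordinal jk)).
  exact: (nth_std_vertices (fintype.lift i (Ordinal jk))).
apply/rowP => l; rewrite !mxE /=.
case: unliftP => [l' ->|->] /=; last by rewrite (negbTE (neq_lift _ _)).
by rewrite mxE (inj_eq (@lift_inj _ i)).
Qed.

Lemma stdsimplex_convex k : is_convex (@stdsimplex R k).
Proof.
move=> u v b [u0 u1] [v0 v1] /andP[b0 b1]; split.
  by move=> j; rewrite !mxE addr_ge0 ?mulr_ge0 ?subr_ge0.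
under eq_bigr do rewrite !mxE.
by rewrite big_split /= -!mulr_sumr u1 v1 !mulr1 addrC subrK.
Qed.

Lemma std_vertices_simplex k x : x \in std_vertices k -> @stdsimplex R k x.
Proof.
move=> /mapP[i _ ->]; split=> [j|]; first by rewrite mxE ler0n.
rewrite (bigD1 i) //= mxE !eqxx big1 ?addr0// => j ji.
by rewrite mxE (negbTE ji) andbF.
Qed.

Lemma stdsimplex_norm k x : @stdsimplex R k x -> `|x| <= 1.
Proof.
move=> [x0 x1]; apply: norm_le_coord => // i; rewrite ger0_norm// -x1 (bigD1 i)//= lerDl.
exact: sumr_ge0.
Qed.

Lemma stdsimplex_compact k : compact (@stdsimplex R k).
Proof.
apply: (@compact_closed_bounded _ _ _ 1); last exact: stdsimplex_norm.
rewrite (_ : @stdsimplex R k = (\bigcap_(j in setT) (fun x : 'rV[R]_k.+1 => x 0 j) @^-1` [set y | 0 <= y])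
   `&` (fun x => \sum_j x 0 j) @^-1` [set 1]); last first.
  by apply/seteqP; split=> x [x0 x1]; split=> // j; [move=> _; exact: x0|exact: x0].
apply: closedI.
  apply: closed_bigI => j _; apply: closed_comp; last exact: closed_ge.
  by move=> x _; exact: coord_continuous.
apply: closed_comp; last exact: closed_eq.
move=> x _; apply: (@continuous_big R 'I_k.+1 +%R 0 xpredT _ _ _ (fun i (x : 'rV[R]_k.+1) => x 0 i)).
  exact: add_continuous.
by move=> i _; exact: coord_continuous.
Qed.

End Simplices.

Section SingularChains.
Variables (R : realType) (X Y : topologicalType) (k : nat).

HB.instance Definition _ (M : lmodType int) (f : sing R k X -> M) :=
  GRing.isZmodMorphism.Build (chain R k X) M (fglift f) (lift_is_additive f).

HB.instance Definition _ :=
  GRing.isZmodMorphism.Build (chain R k.+1 X) (chain R k X) (@boundary R k X)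
    (lift_is_additive _).

HB.instance Definition _ (h : continuousType X Y) :=
  GRing.isZmodMorphism.Build (chain R k X) (chain R k Y) (@pushforward R k X Y h)
    (lift_is_additive _).

Lemma fgliftU1 (M : lmodType int) (f : sing R k X -> M) (s : sing R k X) :
  fglift f << s >> = f s.
Proof. by rewrite liftU scale1r. Qed.

End SingularChains.

Lemma boundaryU (R : realType) (X : topologicalType) k (s : sing R k.+1 X) :
  boundary (<< s >> : chain R k.+1 X) =
  \sum_(i < k.+2) (-1) ^+ i *: << (s \o face i : sing R k X) >>.
Proof. exact: fgliftU1. Qed.

Lemma pushforwardU (R : realType) (X Y : topologicalType)
    (h : continuousType X Y) k (s : sing R k X) :
  pushforward h (<< s >> : chain R k X) = << (h \o s : sing R k Y) >>.
Proof. exact: fgliftU1. Qed.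

Lemma scalez (M : lmodType int) (n : int) (v : M) : n *: v = v *~ n.
Proof. by rewrite -{1}(intz n) scaler_int. Qed.

Lemma raddf_scalez (M N : lmodType int) (f : {additive M -> N}) n v :
  f (n *: v) = n *: f v.
Proof. by rewrite !scalez raddfMz. Qed.

(** The join cycle with coefficients in any abelian group, chains in particular; [join_cycle] is its
    counterpart on cochains. *)
Definition join_sum (P : eqType) (a : nat -> seq (P * P)) (M : zmodType)
    (c : seq (bool * P) -> M) : M :=
  \sum_(e <- hex_pairs)
    (\sum_(q <- a e.2.1) \sum_(q' <- a e.2.2) c (join_simplex q q') +
     \sum_(q <- a e.2.2) \sum_(q' <- a e.2.1) c (join_simplex q q')) *~ e.1.

Lemma join_sum_additive (P : eqType) (a : nat -> seq (P * P)) (M : zmodType)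
    (c : seq (bool * P) -> M) (f : M -> int) : zmod_morphism f ->
  f (join_sum a c) = join_cycle a (fun s => f (c s)).
Proof.
move=> fB; pose g : {additive M -> int} := HB.pack f (GRing.isZmodMorphism.Build M int f fB).
rewrite -[LHS]/(g (join_sum a c)) -[RHS]/(join_cycle a (fun s => g (c s))).
rewrite raddf_sum; apply: eq_bigr => e _; rewrite raddfMz mulrzz mulrC raddfD.
congr (_ * (_ + _)); rewrite raddf_sum; apply: eq_bigr => q _;
  by rewrite raddf_sum.
Qed.

(** * Pairing singular chains with cochains *)

Section Theta.
Variable R : realType.
Local Notation V := 'rV[R]_4.
Local Notation S3 := (sphere3 R).
Implicit Types (D : seq V -> int).

(** Extends [D] from linear to singular simplices: [s] is subdivided [m] times and each piece
    replaced by the linear simplex on the images of its vertices. *)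
Definition theta D m k (s : sing R k S3) : int^o :=
  iter m sd (fun u => D (map (extend s) u)) (std_vertices R k).

Lemma theta_face D m k (s : sing R k.+1 S3) (i : 'I_k.+2) :
  theta D m (s \o face i : sing R k S3) =
  iter m sd (fun u => D (map (extend s) u))
    (take i (std_vertices R k.+1) ++ drop i.+1 (std_vertices R k.+1)).
Proof.
rewrite std_vertices_face (iter_sd_linear (@insert0 R k i)).
apply: iter_sd_ext => u; congr D; rewrite -map_comp; apply: eq_map => x.
have E : @stdsimplex R k.+1 (insert0 i x) -> @stdsimplex R k x.
  move=> [x0 x1]; split.
    by move=> j; have := x0 (fintype.lift i j); rewrite mxE liftK.
  rewrite -x1 (bigD1_ord i) //= mxE unlift_none add0r.
  by apply: eq_bigr => j _; rewrite mxE liftK.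
rewrite /extend /=; case: pselect => Xx; case: pselect => Xi.
- by congr (set_val (s _)); apply: val_inj.
- by case: Xi; exact/set_mem/(insert0_stdsimplex i (exist _ x (mem_set Xx))).
- by case: Xx; exact: E.
- by [].
Qed.

(** Subdivision commutes with the coboundary, and pieces with images in balls of radius 1 / 16 miss
    the origin, so that [cob D] vanishes there. The bound depends on [s], not on [D]. *)
Lemma theta_boundary1 k (s : sing R k.+1 S3) : (k <= 3)%N -> exists m0, forall m, (m0 <= m)%N ->
  forall D, locally_cocycle D ->
  fglift (theta D m (k := k)) (boundary (<< s >> : chain R k.+1 S3)) = 0.
Proof.
move=> k3; have e0 : 0 < 1 / 16 :> R by lra.
have [d' d'0 usd] := uc_on (@stdsimplex_compact R k.+1)
  (extend_cont (@cts_fun _ _ s)) e0.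
have [m0 m0P] := @mesh_small R 2 _ d'0.
exists m0 => m /m0P md D cD.
have -> : fglift (theta D m (k := k)) (boundary (<< s >> : chain R k.+1 S3)) =
   cob (iter m sd (fun u => D (map (extend s) u))) (std_vertices R k.+1).
  rewrite boundaryU raddf_sum cobE size_std_vertices.
  apply: eq_bigr => i _.
  by rewrite raddf_scalez /= fgliftU1 theta_face.
rewrite cob_iter_sd.
apply: (iter_sd_mesh0 (C := @stdsimplex R k.+1) (d := 2) (@stdsimplex_convex R k.+1)).
- by rewrite size_std_vertices.
- exact: std_vertices_simplex.
- move=> u v /std_vertices_simplex/stdsimplex_norm u1 /std_vertices_simplex/stdsimplex_norm v1.
  by rewrite (le_trans (ler_normB _ _))//; lra.
move=> u _ Cu um; rewrite -cob_map; apply: cD.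
case: u Cu um => [|x u] Cu um; first exact: hull_nil.
have Cx : stdsimplex x by apply: Cu; exact: mem_head.
have ux := extend_unit s Cx.
(* With [a] the antipode of [q] the two clusters coincide, and the sup norm of [q - a], twice that
   of a unit vector, is at least 1; this allows the radius 1 / 16. *)
apply: (@cluster_hull R _ (- extend s x) (extend s x) 1 (1 / 16)) => //; last 1 first.
- move=> _ /mapP[y yu ->]; right; apply: usd => //; first exact: Cu.
  by apply: le_lt_trans md; apply: um => //; exact: mem_head.
- by rewrite dotvNr dotvC dotvNr opprK.
- rewrite opprK -mulr2n normrMn; have := unit_norm_ge ux; lra.
- by rewrite expr1n; lra.
Qed.

Lemma theta_boundary k (w : chain R k.+1 S3) : (k <= 3)%N -> exists m0, forall m, (m0 <= m)%N ->
  forall D, locally_cocycle D -> fglift (theta D m (k := k)) (boundary w) = 0.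
Proof.
move=> k3.
have [m0 m0P] : exists m0, forall s, s \in dom w -> forall m, (m0 <= m)%N ->
  forall D, locally_cocycle D ->
  fglift (theta D m (k := k)) (boundary (<< s >> : chain R k.+1 S3)) = 0.
  elim: (dom w) => [|s t [m1 H1]]; first by exists 0%N.
  have [m2 H2] := theta_boundary1 s k3; exists (maxn m1 m2) => s' + m.
  rewrite inE geq_max => /predU1P[->|st] /andP[m1m m2m]; first exact: H2.
  exact: H1.
exists m0 => m mm0 D cD; rewrite -{1}(freeg_sumE w) !raddf_sum big_seq big1// => s sw.
have -> : << coeff s w *g s >> = coeff s w *: << s >> :> chain R k.+1 S3.
  apply/eqP/freeg_eqP => s'; rewrite coeffZ !coeffU; ring.
by rewrite !raddf_scalez /= (m0P s sw m mm0 D cD) scaler0.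
Qed.

Section Cycle.
Variables (P : eqType) (g : P -> V) (a : nat -> seq (P * P)) (p : nat -> P).
Hypothesis ap : edge_path a p.
Hypothesis adm : forall t q q', t \in hex_pairs ->
     (q \in a t.2.1 /\ q' \in a t.2.2) \/ (q \in a t.2.2 /\ q' \in a t.2.1) ->
     ~ hull (map (reflect_label g) (join_simplex q q')) 0.

Definition rho_chain k (s : seq V) : chain R k S3 :=
  if pselect (size s = k.+1 /\ ~ hull s 0) is left H
  then << rho (proj1 H) (proj2 H) >> else 0.

Lemma rho_chainE k s (sk : size s = k.+1) (s0 : ~ hull s 0) :
  rho_chain k s = << rho sk s0 >>.
Proof.
rewrite /rho_chain; case: pselect => [[h1 h2]|[]//].
by congr << _ >>; apply/continuousEP => x; apply: val_inj.
Qed.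

Lemma boundary_rho k s (sk : size s = k.+2) (s0 : ~ hull s 0) :
  boundary (rho_chain k.+1 s) =
  \sum_(i < k.+2) (-1) ^+ i *: rho_chain k (take i s ++ drop i.+1 s).
Proof.
rewrite (rho_chainE sk s0) boundaryU; apply: eq_bigr => i _.
have sk' : size (take i s ++ drop i.+1 s) = k.+1 by rewrite size_del sk.
have s0' : ~ hull (take i s ++ drop i.+1 s) 0.
  move=> h; apply: s0; apply: hullS h => v.
  by rewrite mem_cat => /orP[/mem_take|/mem_drop].
by rewrite (rho_chainE sk' s0') (rho_face sk s0 sk' s0').
Qed.

Definition join_chain : chain R 3 S3 :=
  join_sum a (fun s => rho_chain 3 (map (reflect_label g) s)).

(** For fixed [s], the coefficient of the boundary at [s] is the join cycle evaluated on the
    coboundary of an integer function, so [join_cycle_cob] applies to each coefficient. *)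
Lemma join_chain_cycle : boundary join_chain = 0.
Proof.
apply/eqP/freeg_eqP => s; rewrite coeff0.
rewrite (join_sum_additive _ _ (f := fun c => coeff s (boundary c))); last first.
  by move=> c c'; rewrite !raddfB.
rewrite -(join_cycle_cob ap
   (fun u => coeff s (rho_chain 2 (map (reflect_label g) u)))).
apply: eq_join_cycle => t q q' ht hq; have H := adm ht hq.
rewrite cobE [LHS]/= boundary_rho// raddf_sum.
apply: eq_bigr => i _; apply: etrans (coeffZ _ _ _) _.
congr (_ * coeff s (rho_chain 2 _)).
by rewrite map_cat map_take map_drop.
Qed.

Lemma theta_rho D m (f : continuousType S3 S3) (ff : V -> V) s (s4 : size s = 4%N)
    (s0 : ~ hull s 0) :
  (forall x : S3, ff (set_val x) = set_val (f x)) ->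
  theta D m (f \o rho s4 s0 : sing R 3 S3) =
  iter m sd (fun u => D (map (fun v => ff (normalize v)) u)) s.
Proof.
move=> fE; rewrite -[X in _ = iter m sd _ X](simplex_lin_std s4) iter_sd_linear.
apply/eqP; rewrite -subr_eq0 -iter_sdB; apply/eqP.
apply: (@iter_sd_face0 R _ m _ _ (@stdsimplex R 3)).
- by move=> u u0; apply: bary_convex => //; exact: stdsimplex_convex.
- exact: std_vertices_simplex.
move=> u _ uP; apply/eqP; rewrite subr_eq0; apply/eqP; congr D.
rewrite -map_comp; apply/eq_in_map => x /uP Xx.
rewrite (extendE _ (exist _ x (mem_set Xx))) /= -fE.
by [].
Qed.

(** Orientation reversal gives [w] with boundary h(z) + z for the join cycle z, and [theta] vanishes
    on that boundary. Since [rho] is a projected linear simplex, [theta] of h(z) and of z are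
    subdivided values of linear joins. *)
Lemma join_reverse (h : continuousType S3 S3) (hh : V -> V) :
  orientation_reversing h ->
  (forall x : S3, hh (set_val x) = set_val (h x)) ->
  exists m0, forall m, (m0 <= m)%N -> forall D, locally_cocycle D ->
  join_cycle a (fun s => iter m sd (fun u => D (map (fun v => hh (normalize v)) u))
    (map (reflect_label g) s)) =
  - join_cycle a (fun s => iter m sd (fun u => D (map (@normalize R) u))
    (map (reflect_label g) s)).
Proof.
move=> hrev hhE; have [w bw] := hrev _ join_chain_cycle.
have [m0 m0P] := theta_boundary w isT.
exists m0 => m mm0 D cD; have := m0P m mm0 D cD.
rewrite bw opprK raddfD /= => /eqP; rewrite addr_eq0 => /eqP E.
transitivity (fglift (theta D m (k := 3)) (pushforward h join_chain)).
  rewrite (join_sum_additive _ _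
    (f := fun c => fglift (theta D m (k := 3)) (pushforward h c))); last first.
    by move=> c c'; rewrite !raddfB.
  apply: eq_join_cycle => t q q' ht hq /=.
  have s4 : size (map (reflect_label g) (join_simplex q q')) = 4%N by [].
  rewrite (rho_chainE s4 (adm ht hq)) pushforwardU fgliftU1.
  by rewrite (theta_rho _ _ _ _ hhE).
rewrite E; congr (- _).
rewrite (join_sum_additive _ _ (f := fglift (theta D m (k := 3)))); last first.
  by move=> c c'; rewrite raddfB.
apply: eq_join_cycle => t q q' ht hq /=.
have s4 : size (map (reflect_label g) (join_simplex q q')) = 4%N by [].
rewrite (rho_chainE s4 (adm ht hq)) fgliftU1.
have -> : rho s4 (adm ht hq) = (idfun \o rho s4 (adm ht hq) : @sing R 3 S3).
  exact/continuousEP.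
exact: (@theta_rho D m idfun id).
Qed.

End Cycle.
End Theta.

(** * Paths and symmetries of Moebius ladders *)

Lemma sum_iota_telescope (T : Type) (V : zmodType) (G : T -> V) (c : nat -> T) m l :
  \sum_(k <- iota m l) (G (c k.+1) - G (c k)) = G (c (m + l)%N) - G (c m).
Proof.
elim: l m => [|l IH] m /=; first by rewrite big_nil addn0 subrr.
by rewrite big_cons IH addSnnS addrC addrA subrK.
Qed.

Lemma sum_iota_shift (V : nmodType) (G : nat -> V) m l b :
  \sum_(k <- iota (m + b) l) G k = \sum_(k <- iota m l) G (k + b)%N.
Proof.
elim: l m => [|l IH] m /=; first by rewrite !big_nil.
by rewrite !big_cons -IH addSn.
Qed.

Lemma sum_iota_rev (V : nmodType) (G : nat -> V) m l b : (m + l <= b)%N ->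
  \sum_(k <- iota m l) G (b - k.+1)%N = \sum_(k <- iota (b - (m + l)) l) G k.
Proof.
elim: l m => [|l IH] m mb; first by rewrite !big_nil.
rewrite [iota m _]/= big_cons IH ?addSnnS//.
have -> : iota (b - (m + l.+1)) l.+1 =
    iota (b - (m + l.+1)) l ++ [:: (b - m.+1)%N].
  by rewrite -(addn1 l) iotaD /=; congr (_ ++ [:: _]); lia.
by rewrite big_cat /= big_seq1 addrC.
Qed.

Section HexSymmetry.
Variables (P : eqType) (V : eqType).
Implicit Types (a : nat -> seq (P * P)).

Lemma join_cycle_map (P' : eqType) (phi : P' -> P) (a' : nat -> seq (P' * P'))
    a (F : seq (bool * P) -> int) :
  (forall j, (j < 9)%N -> a j = [seq (phi q.1, phi q.2) | q <- a' j]) ->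
  join_cycle a F = join_cycle a' (fun s => F [seq (z.1, phi z.2) | z <- s]).
Proof.
move=> aE; apply: eq_hex_sum => e he.
have /andP[j9 k9] : (e.2.1 < 9)%N && (e.2.2 < 9)%N by move: e he; exact/allP.
rewrite !aE// !big_map; split; apply: eq_bigr => q _; rewrite big_map;
  exact: eq_bigr.
Qed.

Lemma join_cycle_signed (pi : nat -> nat) (sg : nat -> bool) a a'
    (F : seq (bool * P) -> int) : alternating F ->
  (forall j, (j < 9)%N -> forall G : P * P -> int,
     \sum_(q <- a' j) G q =
     \sum_(q <- a (pi j)) G (if sg j then (q.2, q.1) else q)) ->
  join_cycle a' F = hex_sum (fun j k => (-1) ^+ (sg j + sg k) *
    \sum_(q <- a (pi j)) \sum_(q' <- a (pi k)) F (join_simplex q q')).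
Proof.
move=> altF aE.
have E j k : (j < 9)%N -> (k < 9)%N ->
    \sum_(q <- a' j) \sum_(q' <- a' k) F (join_simplex q q') =
    (-1) ^+ (sg j + sg k) *
      \sum_(q <- a (pi j)) \sum_(q' <- a (pi k)) F (join_simplex q q').
  move=> j9 k9; rewrite aE// mulr_sumr; apply: eq_bigr => q _.
  rewrite aE// mulr_sumr; apply: eq_bigr => q' _.
  have s1 (q1 q2 : P * P) : F (join_simplex (q1.2, q1.1) q2) = - F (join_simplex q1 q2).
    exact: (altF [::] _ _ [:: _; _]).
  have s2 (q1 q2 : P * P) : F (join_simplex q1 (q2.2, q2.1)) = - F (join_simplex q1 q2).
    exact: (altF [:: _; _] _ _ [::]).
  by case: (sg j); case: (sg k); rewrite ?s1 ?s2 ?opprK ?addn0 ?add0n ?expr0 ?expr1 ?mul1r ?mulN1r ?opprK // mul1r.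
apply: eq_hex_sum => e he.
have /andP[j9 k9] : (e.2.1 < 9)%N && (e.2.2 < 9)%N by move: e he; exact/allP.
by rewrite !E.
Qed.

(* Rotation of the hexagon by a half-turn reverses the diagonals. *)
Lemma join_cycle_half_turn a a' (F : seq (bool * P) -> int) : alternating F ->
  (forall j, (j < 9)%N -> forall G : P * P -> int, \sum_(q <- a' j) G q =
     \sum_(q <- a (nth 0 [:: 3; 4; 5; 0; 1; 2; 6; 7; 8] j)%N)
        G (if (5 < j)%N then (q.2, q.1) else q)) ->
  join_cycle a' F = join_cycle a F.
Proof.
move=> altF aE; rewrite (join_cycle_signed altF aE) /join_cycle.
set b := fun j k => \sum_(q <- a j) _; rewrite -[RHS]/(hex_sum b).
rewrite -[LHS]/(hex_sum (fun j k => (-1) ^+ ((5 < j) + (5 < k))%N *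
  b (nth 0 [:: 3; 4; 5; 0; 1; 2; 6; 7; 8] j)%N (nth 0 [:: 3; 4; 5; 0; 1; 2; 6; 7; 8] k)%N)).
rewrite /hex_sum /hex_pairs !big_cons !big_nil /=.
by ring.
Qed.

(** The reflection sending vertex v of the hexagon to 5 - v. It reverses all nine edges, hence two
    in each join, and no sign remains. *)
Lemma join_cycle_reversal a a' (F : seq (bool * P) -> int) : alternating F ->
  (forall j, (j < 9)%N -> forall G : P * P -> int, \sum_(q <- a' j) G q =
     \sum_(q <- a (nth 0 [:: 4; 3; 2; 1; 0; 5; 8; 7; 6] j)%N) G (q.2, q.1)) ->
  join_cycle a' F = join_cycle a F.
Proof.
move=> altF aE; rewrite (@join_cycle_signed _ (fun=> true) _ _ _ altF aE) /join_cycle.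
set b := fun j k => \sum_(q <- a j) _; rewrite -[RHS]/(hex_sum b).
rewrite -[LHS]/(hex_sum (fun j k => (-1) ^+ 2 *
  b (nth 0 [:: 4; 3; 2; 1; 0; 5; 8; 7; 6] j)%N (nth 0 [:: 4; 3; 2; 1; 0; 5; 8; 7; 6] k)%N)).
rewrite /hex_sum /hex_pairs !big_cons !big_nil /=.
by ring.
Qed.

End HexSymmetry.

Section MoebiusPaths.
Variables (R : realType) (n M : nat).
Hypotheses (n3 : (3 < n)%N) (M0 : (0 < M)%N).
Local Notation P := 'rV[R]_(2 * n).

Definition vt (v : nat) : P := \row_j (j == v %% (2 * n) :> nat)%N%:R.

Definition ept (u v : nat) (t : R) : P := (1 - t) *: vt u + t *: vt v.

(** Sample points are numbered along the whole circle, with period [2 * n * M], so that the arcs of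
    a sub-ladder are intervals of indices. *)
Definition cpt (k : nat) : P := ept (k %/ M) (k %/ M).+1 ((k %% M)%:R / M%:R).

Definition rpt (v k : nat) : P := ept v (v + n) (k%:R / M%:R).

(** The ends of three consecutive rungs in cyclic order. The long arcs, numbers 2 and 5, consist of
    [n - 2] ladder edges each; the last one stops at [2 * n] rather than 0, so that its length is a
    difference. *)
Definition hex_start (j : nat) : nat := nth 0%N [:: 0; 1; 2; n; n.+1; n.+2]%N j.
Definition hex_stop (j : nat) : nat :=
  nth 0%N [:: 1; 2; n; n.+1; n.+2; 2 * n]%N j.

(* The sub-ladder formed by the outer circle and the rungs at i, i+1, i+2. *)
Definition sub_ladder (i j : nat) : seq (P * P) :=
  if (j < 6)%N then
    [seq (cpt k, cpt k.+1) |
      k <- iota ((i + hex_start j) * M) ((hex_stop j - hex_start j) * M)]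
  else [seq (rpt (i + (j - 6)) k, rpt (i + (j - 6)) k.+1) | k <- iota 0 M].

Definition hex_vertex (i j : nat) : P := vt (i + hex_start j).

Lemma vt_mod u v : u = v %[mod 2 * n] -> vt u = vt v.
Proof. by move=> uv; apply/rowP => j; rewrite !mxE uv. Qed.

Lemma vt_addn u : vt (u + 2 * n) = vt u.
Proof. by apply: vt_mod; rewrite modnDr. Qed.

Lemma ept0 u v : ept u v 0 = vt u.
Proof. by rewrite /ept subr0 scale1r scale0r addr0. Qed.

Lemma ept1 u v : ept u v 1 = vt v.
Proof. by rewrite /ept subrr scale0r scale1r add0r. Qed.

Lemma ept_sym u v t : ept u v (1 - t) = ept v u t.
Proof. by rewrite /ept subKr addrC. Qed.

Lemma cpt_vt u : cpt (u * M) = vt u.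
Proof. by rewrite /cpt mulnK// modnMl mul0r ept0. Qed.

Let Mr : M%:R != 0 :> R. Proof. by rewrite pnatr_eq0 -lt0n. Qed.

Lemma cptE u r : (r <= M)%N -> cpt (u * M + r) = ept u u.+1 (r%:R / M%:R).
Proof.
rewrite leq_eqVlt => /predU1P[->|rM].
  by rewrite -mulSnr cpt_vt divff// ept1.
by rewrite /cpt divnMDl// divn_small// addn0 modnMDl modn_small.
Qed.

Lemma rpt0 v : rpt v 0 = vt v.
Proof. by rewrite /rpt mul0r ept0. Qed.

Lemma rptM v : rpt v M = vt (v + n).
Proof. by rewrite /rpt divff// ept1. Qed.

Lemma cpt_addn k u : cpt (k + u * M) = ept (k %/ M + u) (k %/ M + u).+1 ((k %% M)%:R / M%:R).
Proof. by rewrite /cpt addnC divnMDl// modnMDl addnC. Qed.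

Lemma cpt_period k : cpt (k + 2 * n * M) = cpt k.
Proof. by rewrite cpt_addn /ept -addSn !vt_addn. Qed.

Lemma hex_start_lt j : (j < 6)%N -> (hex_start j < hex_stop j)%N.
Proof.
by do 6?[case: j => [|j]] => // _; rewrite /hex_start /hex_stop /=; lia.
Qed.

Lemma vt_hex_stop i j : (j < 6)%N ->
  vt (i + hex_stop j) = hex_vertex i (hex_tgt j).
Proof.
rewrite /hex_vertex; do 6?[case: j => [|j]] => // _.
by rewrite -[RHS]vt_addn; congr vt; rewrite /hex_start /hex_stop /=; lia.
Qed.

Lemma vt_hex_start i j : (j < 6)%N -> vt (i + hex_start j) = hex_vertex i (hex_src j).
Proof. by do 6?[case: j => [|j]]. Qed.

Lemma vt_rung_start i j : (5 < j < 9)%N ->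
  vt (i + (j - 6)) = hex_vertex i (hex_src j).
Proof.
by do 9?[case: j => [|j]] => // _; congr vt; rewrite /hex_start /=; lia.
Qed.

Lemma vt_rung_stop i j : (5 < j < 9)%N ->
  vt (i + (j - 6) + n) = hex_vertex i (hex_tgt j).
Proof.
by do 9?[case: j => [|j]] => // _; congr vt; rewrite /hex_start /=; lia.
Qed.

Lemma sub_ladder_path i : edge_path (sub_ladder i) (hex_vertex i).
Proof.
move=> G j j9; rewrite /sub_ladder; case: ltnP => j6; rewrite big_map /=.
  rewrite (sum_iota_telescope G cpt) -mulnDl !cpt_vt vt_hex_start//.
  by rewrite -addnA subnKC ?vt_hex_stop// ltnW ?hex_start_lt.
rewrite (sum_iota_telescope G (rpt _)) add0n rptM rpt0.
by rewrite vt_rung_start ?vt_rung_stop ?j6.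
Qed.

Lemma sub_ladder_src i j : (j < 9)%N ->
  exists2 q, q \in sub_ladder i j & q.1 = hex_vertex i (hex_src j).
Proof.
move=> j9; rewrite /sub_ladder; case: ltnP => j6.
  exists (cpt ((i + hex_start j) * M), cpt ((i + hex_start j) * M).+1).
    apply: map_f; rewrite mem_iota leqnn -[X in (X < _)%N]addn0 ltn_add2l.
    by rewrite muln_gt0 M0 andbT subn_gt0 hex_start_lt.
  by rewrite /= cpt_vt vt_hex_start.
exists (rpt (i + (j - 6)) 0, rpt (i + (j - 6)) 1).
  by apply: (map_f (fun k => (rpt _ k, rpt _ k.+1))); rewrite mem_iota.
by rewrite /= rpt0 vt_rung_start ?j6.
Qed.

Lemma sub_ladder_tgt i j : (j < 9)%N ->
  exists2 q, q \in sub_ladder i j & q.2 = hex_vertex i (hex_tgt j).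
Proof.
move=> j9; rewrite /sub_ladder; case: ltnP => j6.
  have jj := hex_start_lt j6; pose k := ((i + hex_stop j) * M).-1.
  have kE : k.+1 = ((i + hex_stop j) * M)%N.
    by rewrite /k prednK// muln_gt0 M0 andbT; lia.
  exists (cpt k, cpt k.+1).
    apply: map_f; rewrite mem_iota -mulnDl -addnA (subnKC (ltnW jj)).
    by rewrite -kE ltnS leqnn andbT -ltnS kE ltn_pmul2r// ltn_add2l.
  by rewrite /= kE cpt_vt vt_hex_stop.
exists (rpt (i + (j - 6)) M.-1, rpt (i + (j - 6)) M.-1.+1).
  apply: (map_f (fun k => (rpt _ k, rpt _ k.+1))).
  by rewrite mem_iota add0n /= prednK.
by rewrite /= prednK// rptM vt_rung_stop ?j6.
Qed.

Definition on_edge (u v : nat) (x : P) := exists2 t : R, 0 <= t <= 1 & x = ept u v t.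

Definition sub_edge i j u v :=
  [/\ (j < 6)%N, v = u.+1 & (i + hex_start j <= u < i + hex_stop j)%N] \/
  [/\ (5 < j)%N, u = (i + (j - 6))%N & v = (u + n)%N].

Let frac01 r : (r <= M)%N -> 0 <= (r%:R / M%:R : R) <= 1.
Proof.
move=> rM; rewrite divr_ge0//= ler_pdivrMr ?ltr0n// mul1r ler_nat//.
Qed.

Let ept_diff u v (r : nat) :
  ept u v (r.+1%:R / M%:R) - ept u v (r%:R / M%:R) = M%:R^-1 *: (vt v - vt u).
Proof.
apply/rowP => k; rewrite !mxE -natr1; field.
exact: Mr.
Qed.

Lemma sub_ladder_edge i j q : (j < 9)%N -> q \in sub_ladder i j ->
  exists u v, [/\ sub_edge i j u v, on_edge u v q.1, on_edge u v q.2
    & q.2 - q.1 = M%:R^-1 *: (vt v - vt u)].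
Proof.
move=> j9; rewrite /sub_ladder; case: ltnP => j6 /mapP[k]; rewrite mem_iota.
  have -> : ((i + hex_start j) * M + (hex_stop j - hex_start j) * M =
      (i + hex_stop j) * M)%N.
    by rewrite -mulnDl -addnA (subnKC (ltnW (hex_start_lt j6))).
  move=> /andP[k1 k2] -> {q}.
  pose u := (k %/ M)%N; pose r := (k %% M)%N; have rM : (r < M)%N by rewrite ltn_pmod.
  have kE : k = (u * M + r)%N by exact: divn_eq.
  exists u, u.+1; rewrite kE -addnS !cptE// ?(ltnW rM)//; split => //.
  - left; split=> //; apply/andP; split; first by rewrite /u leq_divRL.
    by rewrite /u ltn_divLR.
  - by exists (r%:R / M%:R) => //; exact/frac01/ltnW.
  - by exists (r.+1%:R / M%:R) => //; exact/frac01.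
  - exact: ept_diff.
rewrite add0n => /andP[_ kM] -> /=; exists (i + (j - 6))%N, (i + (j - 6) + n)%N.
split; first by right.
- by exists (k%:R / M%:R) => //; exact/frac01/ltnW.
- by exists (k.+1%:R / M%:R) => //; exact/frac01.
- exact: ept_diff.
Qed.

Lemma mod_window i a b : (i <= a <= i + 2 * n)%N -> (i <= b <= i + 2 * n)%N ->
  a = b %[mod 2 * n] ->
  [\/ a = b, a = i /\ b = (i + 2 * n)%N | a = (i + 2 * n)%N /\ b = i].
Proof.
move=> ai bi /eqP ab.
have d1 : (a <= b)%N -> exists c, b = (a + c * (2 * n))%N.
  move=> le_ab; move: ab; rewrite eq_sym eqn_mod_dvd// => /dvdnP[c bac].
  by exists c; rewrite -bac subnKC.
have d2 : (b <= a)%N -> exists c, a = (b + c * (2 * n))%N.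
  move=> le_ba; move: ab; rewrite eqn_mod_dvd// => /dvdnP[c bac].
  by exists c; rewrite -bac subnKC.
case: (leqP a b) => [/d1|/ltnW/d2] [[|[|c]] E].
- by constructor 1; lia.
- by constructor 2; lia.
- by exfalso; nia.
- by constructor 1; lia.
- by constructor 3; lia.
- by exfalso; nia.
Qed.

Definition disjoint_edges u v u' v' :=
  [/\ u <> u' %[mod 2 * n], u <> v' %[mod 2 * n], v <> u' %[mod 2 * n]
    & v <> v' %[mod 2 * n]].

Lemma sub_edge_window i j u v : (j < 9)%N -> sub_edge i j u v ->
  (i <= u <= i + 2 * n)%N /\ (i <= v <= i + 2 * n)%N.
Proof.
by do 9?[case: j => [|j]] => // _; rewrite /sub_edge /hex_start /hex_stop /=;
  move=> [[//_ -> /andP[h1 h2]]|[//_ -> ->]]; lia.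
Qed.

Lemma sub_edge_disjoint i e u v u' v' : e \in hex_pairs ->
  sub_edge i e.2.1 u v -> sub_edge i e.2.2 u' v' -> disjoint_edges u v u' v'.
Proof.
move=> he s1 s2.
have /andP[j9 k9] : (e.2.1 < 9)%N && (e.2.2 < 9)%N by move: e he {s1 s2}; exact/allP.
have [w1 w2] := sub_edge_window j9 s1; have [w3 w4] := sub_edge_window k9 s2.
(* Within a window of length [2 * n], congruent numbers are equal or are the two ends; this turns
   the claim into linear arithmetic. *)
suff H : [/\ u <> u', u <> v', v <> u' & v <> v'] /\
  [/\ ~ (u = i /\ (u' = i + 2 * n)%N), ~ (u = i /\ v' = (i + 2 * n)%N),
     ~ (v = i /\ (u' = i + 2 * n)%N) & ~ (v = i /\ v' = (i + 2 * n)%N)] /\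
  [/\ ~ (u = (i + 2 * n)%N /\ u' = i), ~ (u = (i + 2 * n)%N /\ v' = i),
     ~ (v = (i + 2 * n)%N /\ u' = i) & ~ (v = (i + 2 * n)%N /\ v' = i)].
  case: H => -[h1 h2 h3 h4] [[h5 h6 h7 h8] [h9 h10 h11 h12]].
  split; [move=> /(mod_window w1 w3)|move=> /(mod_window w1 w4)|
    move=> /(mod_window w2 w3)|move=> /(mod_window w2 w4)] => -[|//|//]; by [].
move: s1 s2; rewrite /sub_edge /hex_start /hex_stop.
move: he {w1 w2 w3 w4 j9 k9}; rewrite /hex_pairs !inE.
by do 17?[move=> /orP[]]; move=> /eqP-> /=; move=> [[//_ -> /andP[h1 h2]]|[//_ -> ->]] [[//_ -> /andP[h3 h4]]|[//_ -> ->]];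
  (split; [split|split; split]); lia.
Qed.

Let n0 : (0 < 2 * n)%N. Proof. lia. Qed.

(** One of the two barycentric coordinates of [x] is at least 1 / 2, and that coordinate vanishes on
    the edge of [y]. *)
Lemma on_edge_far u v u' v' x y : u <> v %[mod 2 * n] ->
  disjoint_edges u v u' v' -> on_edge u v x -> on_edge u' v' y ->
  1 / 2 <= `|y - x|.
Proof.
move=> /eqP uv [/eqP h1 /eqP h2 /eqP h3 /eqP h4] [t /andP[t0 t1] ->] [t' _ ->].
have lu : (u %% (2 * n) < 2 * n)%N by rewrite ltn_pmod.
have lv : (v %% (2 * n) < 2 * n)%N by rewrite ltn_pmod.
have [t2|t2] := lerP t (1 / 2).
  apply: le_trans (coord_le_norm _ (Ordinal lu)).
  rewrite !mxE /= eqxx (negbTE h1) (negbTE h2) (negbTE uv) !mulr0 !addr0 mulr1.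
  by rewrite ?sub0r normrN ger0_norm; lra.
apply: le_trans (coord_le_norm _ (Ordinal lv)).
rewrite !mxE /= eqxx (negbTE h3) (negbTE h4) eq_sym (negbTE uv) !mulr0 !addr0 add0r mulr1.
by rewrite ?sub0r normrN ger0_norm; lra.
Qed.

Lemma vt_diff_norm u v : `|vt v - vt u| <= 1.
Proof.
apply: norm_le_coord => // j; rewrite !mxE.
by do 2!case: (_ == _); rewrite ?subrr ?subr0 ?sub0r ?normrN ?normr0 ?normr1.
Qed.

End MoebiusPaths.

Lemma periodic_sum (L : nat -> int) n m : (forall i, L (i + n)%N = L i) ->
  \sum_(i <- iota m n) L i = \sum_(i <- iota 0 n) L i.
Proof.
move=> Ln; elim: m => // m <-; case: n Ln => [|n] Ln; first by rewrite !big_nil.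
have -> : iota m.+1 n.+1 = iota m.+1 n ++ [:: (m + n.+1)%N].
  by rewrite -[X in iota _ X](addn1 n) iotaD /= addSnnS.
by rewrite big_cat /= big_seq1 big_cons Ln addrC.
Qed.

Section LadderSymmetry.
Variables (R : realType) (n M : nat).
Hypotheses (n3 : (3 < n)%N) (M0 : (0 < M)%N).
Local Notation P := 'rV[R]_(2 * n).
Local Notation a := (sub_ladder R n M).
Local Notation c := (cpt R n M).
Local Notation d := (rpt R n M).

Let Mr : M%:R != 0 :> R. Proof. by rewrite pnatr_eq0 -lt0n. Qed.

Lemma rpt_addn v k : (k <= M)%N -> d (v + n) k = d v (M - k).
Proof.
move=> kM; rewrite /rpt natrB// mulrBl divff// ept_sym /ept.
by rewrite -addnA addnn -mul2n vt_addn.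
Qed.

Lemma rpt_rev_sum (G : P * P -> int) v :
  \sum_(k <- iota 0 M) G (d v (M - k.+1), d v (M - k)) =
  \sum_(k <- iota 0 M) G (d v k, d v k.+1).
Proof.
have := @sum_iota_rev _ (fun k => G (d v k, d v k.+1)) 0 M M (leqnn M).
rewrite add0n subnn => <-; rewrite [LHS]big_seq [RHS]big_seq; apply: eq_bigr => k.
by rewrite mem_iota => /andP[_ kM]; rewrite subnSK.
Qed.

Variable F : seq (bool * P) -> int.
Hypothesis altF : alternating F.

(** The three rungs at [i + n] are those at [i] traversed backwards, so [i] matters modulo [n]
    only. *)
Lemma ladder_half_turn i : join_cycle (a (i + n)) F = join_cycle (a i) F.
Proof.
apply: join_cycle_half_turn => // j j9 G; rewrite /sub_ladder.
have [j6|j6] := ltnP j 6.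
  rewrite ifT; last by case: j j6 {j9} => [|[|[|[|[|[|j]]]]]] j6 //.
  rewrite /= !big_map.
  have [j3|j3] := ltnP j 3.
    rewrite (_ : (i + n + hex_start n j = i + hex_start n (nth 0 [:: 3; 4; 5; 0; 1; 2; 6; 7; 8] j))%N).
      rewrite (_ : (hex_stop n j - hex_start n j = hex_stop n (nth 0 [:: 3; 4; 5; 0; 1; 2; 6; 7; 8] j) -
         hex_start n (nth 0 [:: 3; 4; 5; 0; 1; 2; 6; 7; 8] j))%N)//.
      by case: j j3 {j6 j9} => [|[|[|j]]] j3 //; rewrite /hex_start /hex_stop /=; lia.
    by case: j j3 {j6 j9} => [|[|[|j]]] j3 //; rewrite /hex_start /=; lia.
  rewrite (_ : (i + n + hex_start n j = i + hex_start n (nth 0 [:: 3; 4; 5; 0; 1; 2; 6; 7; 8] j) + 2 * n)%N).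
    rewrite (_ : (hex_stop n j - hex_start n j = hex_stop n (nth 0 [:: 3; 4; 5; 0; 1; 2; 6; 7; 8] j) -
         hex_start n (nth 0 [:: 3; 4; 5; 0; 1; 2; 6; 7; 8] j))%N).
      rewrite mulnDl sum_iota_shift; apply: eq_bigr => k _.
      by rewrite -addSn !cpt_period.
    by case: j j3 j6 {j9} => [|[|[|[|[|[|j]]]]]] j3 j6 //; rewrite /hex_start /hex_stop /=; lia.
  by case: j j3 j6 {j9} => [|[|[|[|[|[|j]]]]]] j3 j6 //; rewrite /hex_start /=; lia.
rewrite ifF; last by case: j j6 j9 => [|[|[|[|[|[|[|[|[|j]]]]]]]]] j6 j9 //.
rewrite !big_map.
have -> : (nth 0 [:: 3; 4; 5; 0; 1; 2; 6; 7; 8] j - 6 = j - 6)%N.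
  by case: j j6 j9 => [|[|[|[|[|[|[|[|[|j]]]]]]]]] j6 j9 //.
rewrite addnAC -(rpt_rev_sum (fun q => G (q.2, q.1))) [LHS]big_seq [RHS]big_seq.
apply: eq_bigr => k; rewrite mem_iota => /andP[_ kM] /=.
by rewrite !rpt_addn// ltnW.
Qed.

Lemma ladder_rotation (phi : P -> P) C i :
  (forall u v t, phi (ept n u v t) = ept n (u + C) (v + C) t) ->
  join_cycle (a i) (fun s => F [seq (z.1, phi z.2) | z <- s]) =
  join_cycle (a (i + C)) F.
Proof.
move=> phiE; apply/esym/join_cycle_map => j j9; rewrite /sub_ladder.
case: ifP => j6; rewrite -map_comp.
  rewrite addnAC mulnDl [X in iota X]addnC iotaDl -map_comp; apply: eq_map => k /=.
  have cptC k' : c (C * M + k')%N = phi (c k').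
    by rewrite addnC (cpt_addn _ _ M0) /cpt phiE addSn.
  by rewrite -addnS !cptC.
by apply: eq_map => k /=; rewrite /rpt !phiE addnAC [(_ + n + C)%N]addnAC.
Qed.

(** The rung at i + 2 becomes the one joining C - n - i - 2 to C - i - 2, the first of the new
    triple. The bound on [C] prevents truncated subtractions. *)
Lemma ladder_reflection (phi : P -> P) C i : (i + 2 * n <= C)%N ->
  (forall u v t, (u <= C)%N -> (v <= C)%N ->
     phi (ept n u v t) = ept n (C - u) (C - v) t) ->
  join_cycle (a i) (fun s => F [seq (z.1, phi z.2) | z <- s]) =
  join_cycle (a (C - n.+1 - i.+1)) F.
Proof.
move=> iC phiE.
rewrite -(@join_cycle_map _ _ phi _ (fun j => [seq (phi q.1, phi q.2) | q <- a i j]) F)//.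
apply/esym/join_cycle_reversal => // j j9 G; rewrite /sub_ladder.
have phic k : (k <= C * M)%N -> phi (c k) = c (C * M - k)%N.
  move=> kC; pose u := (k %/ M)%N; pose r := (k %% M)%N.
  have rM : (r < M)%N by rewrite ltn_pmod.
  have kE : k = (u * M + r)%N by exact: divn_eq.
  have uC : (u <= C)%N by rewrite -(leq_pmul2r M0); lia.
  have [r0|r0] := posnP r.
    rewrite kE r0 addn0 -mulnBl !cpt_vt// -[vt _ _ u](ept0 _ _ u u) phiE//.
    by rewrite ept0.
  have uC' : (u < C)%N by rewrite -(ltn_pmul2r M0); lia.
  rewrite kE (cptE _ _ M0)// ?(ltnW rM)// phiE//.
  have -> : (C * M - (u * M + r) = (C - u.+1) * M + (M - r))%N.
    by rewrite mulnBl mulSn; nia.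
  rewrite (cptE _ _ M0) ?leq_subr// -subSn// subSS natrB ?(ltnW rM)// mulrBl divff//.
  by rewrite ept_sym.
have [j6|j6] := ltnP j 6.
  rewrite ifT; last by case: j j6 {j9} => [|[|[|[|[|[|j]]]]]] j6 //.
  set j' := nth 0%N _ j.
  have [jj jj'] : (hex_start n j < hex_stop n j)%N /\ (hex_start n j' < hex_stop n j')%N.
    split; apply: (hex_start_lt R n3 M0) => //.
    by rewrite /j'; case: j j6 {j9 j'} => [|[|[|[|[|[|j]]]]]] j6 //.
  have lE : (hex_stop n j - hex_start n j = hex_stop n j' - hex_start n j')%N.
    by rewrite /j'; case: j j6 {j9 j' jj jj'} => [|[|[|[|[|[|j]]]]]] j6 //; rewrite /hex_start /hex_stop /=; lia.
  have stop2 : (hex_stop n j' <= 2 * n)%N.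
    by rewrite /j'; case: j j6 {j9 j' jj jj' lE} => [|[|[|[|[|[|j]]]]]] j6 //; rewrite /hex_stop /=; lia.
  have E : \sum_(q <- [seq (phi q.1, phi q.2) | q <- [seq (c k, c k.+1) | k <- iota ((i + hex_start n j') * M) ((hex_stop n j' - hex_start n j') * M)]]) G (q.2, q.1) =
     \sum_(k <- iota ((C - i - hex_stop n j') * M) ((hex_stop n j' - hex_start n j') * M)) G (c k, c k.+1).
    have bE : (((i + hex_start n j') * M) + ((hex_stop n j' - hex_start n j') * M) = (i + hex_stop n j') * M)%N.
      by rewrite -mulnDl -addnA (subnKC (ltnW jj')).
    have bC : ((i + hex_stop n j') * M <= C * M)%N by rewrite leq_mul2r; lia.
    rewrite !big_map.
    have -> : ((C - i - hex_stop n j') * M = C * M - (i + hex_stop n j') * M)%N.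
      by rewrite -subnDA mulnBl.
    rewrite -bE -(sum_iota_rev (fun k => G (c k, c k.+1))) ?bE//.
    rewrite [LHS]big_seq [RHS]big_seq; apply: eq_bigr => k; rewrite mem_iota bE => /andP[_ kC] /=.
    rewrite !phic ?(leq_trans kC)// ?(leq_trans (ltnW kC))// subnSK//.
    exact: leq_trans kC bC.
  rewrite E big_map lE.
  have [j5|j5] := ltnP j 5.
    congr (\sum_(k <- iota (_ * M) _) _).
    by rewrite /j'; case: j j5 {j6 j9 j' jj jj' lE E stop2} => [|[|[|[|[|j]]]]] j5 //; rewrite /hex_start /hex_stop /=; lia.
  rewrite (_ : (C - n.+1 - i.+1 + hex_start n j = C - i - hex_stop n j' + 2 * n)%N).
    by rewrite mulnDl sum_iota_shift; apply: eq_bigr => k _; rewrite -addSn !cpt_period.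
  by rewrite /j'; case: j j5 j6 {j9 j' jj jj' lE E stop2} => [|[|[|[|[|[|j]]]]]] j5 j6 //; rewrite /hex_start /hex_stop /=; lia.
rewrite ifF; last by case: j j6 j9 => [|[|[|[|[|[|[|[|[|j]]]]]]]]] j6 j9 //.
rewrite !big_map -rpt_rev_sum [LHS]big_seq [RHS]big_seq; apply: eq_bigr => k.
rewrite mem_iota => /andP[_ kM] /=.
set v := (i + _)%N; set w := (C - _ - _ + _)%N.
have [vw wv] : (C - v = w + n)%N /\ (C - (v + n) = w)%N.
  by rewrite /v /w; case: j j6 j9 {v w} => [|[|[|[|[|[|[|[|[|j]]]]]]]]] j6 j9 // => /=; lia.
have vC : (v + n <= C)%N.
  by rewrite /v; case: j j6 j9 {v w vw wv} => [|[|[|[|[|[|[|[|[|j]]]]]]]]] j6 j9 // => /=; lia.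
have dE r : (r <= M)%N -> phi (d v r) = d w (M - r).
  move=> rM; rewrite /rpt phiE ?vw ?wv//; last by apply: leq_trans vC; rewrite leq_addr.
  by rewrite natrB// mulrBl divff// ept_sym.
by rewrite !dE// ltnW.
Qed.

Lemma ladder_sum_symmetry (phi : P -> P) :
  (exists C, forall u v t, phi (ept n u v t) = ept n (u + C) (v + C) t) \/
  (exists2 C, (4 * n <= C)%N & forall u v t, (u <= C)%N -> (v <= C)%N ->
     phi (ept n u v t) = ept n (C - u) (C - v) t) ->
  \sum_(i <- iota 0 n) join_cycle (a i) (fun s => F [seq (z.1, phi z.2) | z <- s]) =
  \sum_(i <- iota 0 n) join_cycle (a i) F.
Proof.
have per i : join_cycle (a (i + n)) F = join_cycle (a i) F by exact: ladder_half_turn.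
case=> [[C phiE]|[C C4 phiE]].
  under eq_bigr do rewrite (ladder_rotation _ phiE).
  rewrite -(sum_iota_shift (fun i => join_cycle (a i) F) 0 n C).
  exact: (periodic_sum (L := fun i => join_cycle (a i) F)).
rewrite -(periodic_sum (C - n.+1 - (0 + n)) per).
rewrite -(sum_iota_rev (fun i => join_cycle (a i) F)); last by lia.
rewrite [LHS]big_seq [RHS]big_seq; apply: eq_bigr => i; rewrite mem_iota => /andP[_ i_lt].
by apply: ladder_reflection => //; lia.
Qed.

End LadderSymmetry.

(** * Automorphisms of the ladder are dihedral *)

Section LadderAutomorphism.
Variable n : nat.
Hypothesis n3 : (3 < n)%N.

Definition next_to a b := b = a.+1 \/ b = 0%N /\ a.+1 = (2 * n)%N.

Definition antipodal a b := b = (a + n)%N \/ a = (b + n)%N.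

(* Adjacency of residues modulo 2n, spelled out on representatives. *)
Definition ladder_adj a b := [\/ next_to a b, next_to b a | antipodal a b].

Lemma ladder_adj_sym a b : ladder_adj a b -> ladder_adj b a.
Proof.
by case=> [h|h|[h|h]]; [constructor 2|constructor 1|constructor 3; right|
  constructor 3; left].
Qed.

(** For n > 3 circle edges and rungs alternate in every 4-cycle; a 4-cycle with a single rung would
    force n = 3. *)
Lemma ladder_square A x y B : (A < 2 * n)%N -> (x < 2 * n)%N -> (y < 2 * n)%N ->
  (B < 2 * n)%N -> ladder_adj A x -> ladder_adj x y -> ladder_adj y B ->
  ladder_adj A B -> A <> y -> x <> B -> ~ antipodal A B -> antipodal A x.
Proof.
move=> hA hx hy hB Ax xy yB AB Ay xB nAB.
case: AB => // AB; case: Ax => // Ax; case: xy => xy; case: yB => yB;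
  by rewrite /next_to /antipodal in AB Ax xy yB; exfalso; lia.
Qed.

Variable s : nat -> nat.
Hypothesis s_lt : forall v, (s v < 2 * n)%N.
Hypothesis s_period : forall v, s (v + 2 * n) = s v.
Hypothesis s_inj : forall u v, s u = s v -> u = v %[mod 2 * n].
Hypothesis s_side : forall v, ladder_adj (s v) (s v.+1).
Hypothesis s_rung : forall v, ladder_adj (s v) (s (v + n)).

Let s_neq u k : (0 < k < 2 * n)%N -> s u <> s (u + k).
Proof.
move=> /andP[k0 kn] /s_inj/eqP.
by rewrite -{1}[u]addn0 eqn_modDl mod0n modn_small// eq_sym gtn_eqF.
Qed.

(** The rung at w + 1 lies in two squares, on the sides of w and of w + 2. Were its image a circle
    edge, the images of both squares would make s(w) and s(w + 2) the antipode of s(w + 1), against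
    injectivity. *)
Lemma rung_image v : antipodal (s v) (s (v + n)).
Proof.
(* A successor has a predecessor among the naturals; [v] is recovered modulo [2 * n]. *)
suff H w : antipodal (s w.+1) (s (w.+1 + n)).
  by have := H (v + (2 * n).-1)%N; rewrite (_ : (v + (2 * n).-1).+1 = v + 2 * n)%N ?s_period 1?addnAC ?s_period//; lia.
apply: contrapT => nA.
have n0 : (0 < n)%N by lia.
have P1 : antipodal (s w.+1) (s w.+2).
  apply: (@ladder_square _ _ (s (w.+2 + n)) (s (w.+1 + n))) => //.
  - exact/ladder_adj_sym/s_side.
  - by rewrite (_ : w.+2 + n = w.+1 + n.+1)%N; [apply: s_neq|]; lia.
  - by rewrite (_ : w.+1 + n = w.+2 + n.-1)%N; [apply: s_neq|]; lia.
have P2 : antipodal (s w.+1) (s w).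
  apply: (@ladder_square _ _ (s (w + n)) (s (w.+1 + n))) => //.
  - exact: ladder_adj_sym.
  - by rewrite (_ : w + n = w.+1 + n.-1)%N; [apply: s_neq|]; lia.
  - by rewrite (_ : w.+1 + n = w + n.+1)%N; [apply: s_neq|]; lia.
have := @s_neq w 2; rewrite addn2 => /(_ ltac:(lia)); case: P1; case: P2; have := s_lt w;
  have := s_lt w.+1; have := s_lt w.+2; lia.
Qed.

Lemma side_image v : next_to (s v) (s v.+1) \/ next_to (s v.+1) (s v).
Proof.
have nA : ~ antipodal (s v) (s v.+1).
  have := rung_image v; have := @s_neq v.+1 n.-1.
  rewrite (_ : v.+1 + n.-1 = v + n)%N; last by lia.
  move=> /(_ ltac:(lia)); have := s_lt v; have := s_lt v.+1; have := s_lt (v + n).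
  by rewrite /antipodal; lia.
by case: (s_side v) => h; [left|right|].
Qed.

Lemma side_image_next v :
  (next_to (s v) (s v.+1) -> next_to (s v.+1) (s v.+2)) /\
  (next_to (s v.+1) (s v) -> next_to (s v.+2) (s v.+1)).
Proof.
have := @s_neq v 2; rewrite addn2 => /(_ ltac:(lia)) ne.
have := s_lt v; have := s_lt v.+1; have := s_lt v.+2.
by split; case: (side_image v.+1) => // h1 h2; exfalso; rewrite /next_to in h1 h2; lia.
Qed.

Lemma ladder_dihedral : (exists C, forall v, s v = (v + C) %% (2 * n))%N \/
  (exists2 C, (4 * n <= C)%N & forall v, (v <= C)%N -> s v = (C - v) %% (2 * n))%N.
Proof.
have next_mod a b : next_to a b -> (b = a.+1 %[mod 2 * n])%N.
  by case=> [->//|[-> ->]]; rewrite modnn mod0n.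
case: (side_image 0) => h.
  have H v : next_to (s v) (s v.+1).
    by elim: v => // v IH; apply: (side_image_next v).1.
  left; exists (s 0) => v; rewrite -(modn_small (s_lt v)).
  elim: v => [|v IH]; first by rewrite add0n.
  by rewrite (next_mod _ _ (H v)) -addn1 -modnDml IH modnDml addn1 addSn.
have H v : next_to (s v.+1) (s v).
  by elim: v => // v IH; apply: (side_image_next v).2.
(* The multiple [4 * n] of the period makes [C] large enough for the later natural subtractions. *)
right; exists (s 0 + 4 * n)%N; first by lia.
have E v : (s v + v = s 0 + 4 * n %[mod 2 * n])%N.
  elim: v => [|v IH].
    by rewrite addn0 (_ : s 0 + 4 * n = 2 * (2 * n) + s 0)%N ?modnMDl//; lia.
  by rewrite addnS -addSn -modnDml -(next_mod _ _ (H v)) modnDml.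
move=> v vC; rewrite -(modn_small (s_lt v)); apply/eqP.
by rewrite -(eqn_modDr v) subnK//; apply/eqP.
Qed.

End LadderAutomorphism.

(** * Self-maps of graph realizations *)

Section ContOn.
Variables (R : realType) (U V W : normedModType R).

Lemma continuous_cont_on (K : set U) (f : U -> V) : continuous f -> cont_on K f.
Proof.
move=> cf x _ e e0; have /cvgrPdist_lt/(_ e e0)/nbhs_ballP[d d0 fd] := cf x.
by exists d => // y _ xy; apply: fd; rewrite -ball_normE.
Qed.

Lemma cont_on_comp (K : set U) (L : set V) (f : U -> V) (g : V -> W) :
  cont_on K f -> cont_on L g -> (forall x, K x -> L (f x)) -> cont_on K (g \o f).
Proof.
move=> cf cg KL x Kx e e0.
have [d d0 gd] := cg _ (KL _ Kx) e e0; have [d' d'0 fd] := cf x Kx d d0.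
by exists d' => // y Ky xy; apply: gd; [exact: KL|exact: fd].
Qed.

Lemma cont_on_sub (K L : set U) (f : U -> V) : K `<=` L -> cont_on L f -> cont_on K f.
Proof.
move=> KL cf x /KL Lx e e0; have [d d0 fd] := cf x Lx e e0.
by exists d => // y /KL; exact: fd.
Qed.

End ContOn.

Section GraphRealization.
Variables (R : realType) (G : simple_graph).
Local Notation P := 'rV[R]_(order G).
Local Notation K := (realization R G).
Implicit Types (i j k l : 'I_(order G)) (t : R) (x : P).

Definition vertex i : P := delta_mx 0 i.

Definition seg i j t : P := t *: vertex i + (1 - t) *: vertex j.

Lemma vertexE i k : vertex i 0 k = (k == i)%:R.
Proof. by rewrite mxE eqxx. Qed.

Lemma segE i j t k : seg i j t 0 k = t * (k == i)%:R + (1 - t) * (k == j)%:R.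
Proof. by rewrite !mxE eqxx. Qed.

Lemma vertex_inj : injective vertex.
Proof.
move=> i j /rowP/(_ i)/eqP; rewrite !vertexE eqxx.
by have [//|_] := eqVneq i j; rewrite oner_eq0.
Qed.

Lemma seg0 i j : seg i j 0 = vertex j.
Proof. by rewrite /seg scale0r add0r subr0 scale1r. Qed.

Lemma seg1 i j : seg i j 1 = vertex i.
Proof. by rewrite /seg scale1r subrr scale0r addr0. Qed.

Lemma seg_sym i j t : seg i j t = seg j i (1 - t).
Proof. by rewrite /seg subKr addrC. Qed.

Lemma seg_continuous i j : continuous (seg i j).
Proof.
move=> t; apply: cvgD; first by apply: cvgZl; exact: cvg_id.
by apply: cvgZl; apply: cvgB; [exact: cvg_cst|exact: cvg_id].
Qed.

Lemma realization_seg i j t : adj i j -> 0 <= t <= 1 -> K (seg i j t).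
Proof. by move=> ij t01; exists i, j, t; split=> //; right. Qed.

Lemma realization_vertex i : K (vertex i).
Proof.
exists i, i, 1; split; [by left|by rewrite ler01 lexx|].
by rewrite scale1r subrr scale0r addr0.
Qed.

Lemma realization_cases x : K x -> (exists i, x = vertex i) \/
  exists i j t, [/\ adj i j, 0 < t < 1 & x = seg i j t].
Proof.
case=> i [j [t [ij /andP[t0 t1] ->]]].
have [<-|ne_ij] := eqVneq i j.
  by left; exists i; rewrite -scalerDl subrKC scale1r.
case: ij => [/eqP|ij]; first by rewrite (negbTE ne_ij).
move: t0 t1; rewrite le_eqVlt => /predU1P[<-|t0].
  by left; exists j; rewrite -/(seg i j 0) seg0.
rewrite le_eqVlt => /predU1P[->|t1]; first by left; exists i; exact: seg1.
by right; exists i, j, t; rewrite t0.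
Qed.

Lemma seg_fst i j t : i != j -> seg i j t 0 i = t.
Proof. by move=> ij; rewrite segE eqxx (negbTE ij) mulr1 mulr0 addr0. Qed.

Lemma seg_snd i j t : i != j -> seg i j t 0 j = 1 - t.
Proof. by move=> ij; rewrite seg_sym seg_fst// eq_sym. Qed.

Lemma seg_supp i j t k : seg i j t 0 k != 0 -> k = i \/ k = j.
Proof.
rewrite segE; have [->|_] := eqVneq k i; first by left.
have [->|_] := eqVneq k j; first by right.
by rewrite !mulr0 addr0 eqxx.
Qed.

Lemma adj_neq i j : adj i j -> i != j.
Proof. by apply: contraTneq => ->; rewrite adj_irr. Qed.

Lemma realization_edge x k l : K x -> k != l -> 0 < x 0 k -> 0 < x 0 l ->
  [/\ adj k l, 0 < x 0 k < 1 & x = seg k l (x 0 k)].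
Proof.
move=> Kx kl xk xl; case: (realization_cases Kx) => [[i xE]|[i [j [t [ij t01 xE]]]]].
  move: xk xl; rewrite xE !vertexE; have [<-|_] := eqVneq k i; last by rewrite ltxx.
  by rewrite eq_sym (negbTE kl) ltxx.
have ne_ij := adj_neq ij.
have := seg_supp (t := t) (i := i) (j := j) (k := k).
have := seg_supp (t := t) (i := i) (j := j) (k := l).
rewrite -xE !gt_eqF// => /(_ isT) hl /(_ isT) hk.
move: kl; case: hl hk => -> [] -> kl; rewrite ?eqxx// in kl *.
  rewrite xE seg_snd// adj_sym ij -seg_sym; split=> //.
  by case/andP: t01 => t0 t1; rewrite subr_gt0 t1 ltrBlDr ltrDl.
by rewrite xE seg_fst.
Qed.

Lemma vertex_bad i j t k : adj i j -> 0 < t < 1 -> seg i j t <> vertex k.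
Proof.
move=> /adj_neq ij /andP[t0 t1] E.
have := congr1 (fun x : P => x 0 i) E; rewrite seg_fst// vertexE.
by case: (i == k) => E'; move: t0 t1; rewrite E' ltxx.
Qed.

Lemma realization_compact : compact K.
Proof.
pose E := [pred p : 'I_(order G) * 'I_(order G) | (p.1 == p.2) || adj p.1 p.2].
have -> : K = \big[setU/set0]_(p in E) (seg p.1 p.2 @` `[0, 1]%classic).
  rewrite -bigcup_pred; apply/seteqP; split=> [x [i [j [t [ij t01 ->]]]]|x [[i j] /= ij [t]]].
    exists (i, j); last by exists t => //=; rewrite in_itv.
    by apply/orP; case: ij => [->|]; [left|right].
  rewrite /= in_itv /= => t01 <-; exists i, j, t; split=> //.
  by case/orP: ij => [/eqP|]; [left|right].
apply: bigsetU_compact => p _; apply: continuous_compact; last exact: segment_compact.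
exact/continuous_subspaceT/seg_continuous.
Qed.

Section Image.
Variable phi : P -> P.
Hypothesis phiK : forall x, K x -> K (phi x).
Hypothesis phi_cont : cont_on K phi.
Hypothesis phi_inj : forall x y, K x -> K y -> phi x = phi y -> x = y.

Let coord_arc i j k : adj i j ->
  cont_on (`[0, 1]%classic : set R) (fun t => phi (seg i j t) 0 k).
Proof.
move=> ij; apply: (@cont_on_comp _ _ _ _ _ setT _ (fun x : P => x 0 k)); last by [].
  apply: (@cont_on_comp _ _ _ _ _ K (seg i j)) => //.
    exact/continuous_cont_on/seg_continuous.
  by move=> t /=; rewrite in_itv /=; exact: realization_seg.
by apply: continuous_cont_on => x; exact: coord_continuous.
Qed.

(** Inside an open edge the graph is an interval. If the image of [i] were there, two of the three
    arcs at [i] would leave it on the same side, and the intermediate value theorem would make them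
    meet again, against injectivity. *)
Lemma vertex_image i a b c : adj a i -> adj b i -> adj c i ->
  a != b -> a != c -> b != c -> exists j, phi (vertex i) = vertex j.
Proof.
move=> ai bi ci ab ac bc.
case: (realization_cases (phiK (realization_vertex i))) => [//|[k [l [t [kl /andP[t0 t1] qE]]]]].
(* Points of the graph closer than [e] to the image have positive coordinates at [k] and [l], hence
   lie on the same open edge. *)
exfalso; pose e := Num.min t (1 - t).
have e0 : 0 < e by rewrite lt_min t0 subr_gt0.
have [d d0 dP] := phi_cont (realization_vertex i) e0.
pose s := Num.min 1 (d / 2).
have s0 : 0 < s by rewrite lt_min ltr01 divr_gt0.
have s1 : s <= 1 by rewrite ge_min lexx.
have sd : s < d by rewrite gt_min; apply/orP; right; lra.
have kn := adj_neq kl.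
have onkl j r : adj j i -> 0 <= r <= s -> phi (seg j i r) = seg k l (phi (seg j i r) 0 k).
  move=> ji /andP[r0 rs]; have Kj : K (seg j i r) by apply: realization_seg => //; lra.
  have : `|phi (vertex i) - phi (seg j i r)| < e.
    apply: dP => //; apply: le_lt_trans sd; apply: le_trans rs.
    apply: norm_le_coord => // m; rewrite !mxE eqxx /=.
    rewrite (_ : _ - _ = r * ((m == i)%:R - (m == j)%:R)); last by ring.
    rewrite normrM ger0_norm// ler_piMr//.
    by do 2!case: (m == _); rewrite ?subrr ?subr0 ?sub0r ?normrN ?normr0 ?normr1.
  move=> he; have hk := le_lt_trans (coord_le_norm _ k) he.
  have hl := le_lt_trans (coord_le_norm _ l) he.
  have cE m : (phi (vertex i) - phi (seg j i r)) 0 m = seg k l t 0 m - phi (seg j i r) 0 m.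
    by rewrite qE !mxE.
  move: hk hl; rewrite !cE seg_fst// seg_snd// !lt_min !ltr_norml.
  move=> /andP[/andP[_ hk] _] /andP[_ /andP[_ hl]].
  have [||_ _ <-//] := realization_edge (phiK Kj) kn; lra.
(* If the arc from [b'] covers the endpoint of the arc from [a'], some point of it has the same
   image as that endpoint, so both arcs lie on one edge. *)
have cross a' b' : adj a' i -> adj b' i ->
    t <= phi (seg a' i s) 0 k <= phi (seg b' i s) 0 k \/
    phi (seg b' i s) 0 k <= phi (seg a' i s) 0 k <= t -> a' = b'.
  move=> ai' bi' h.
  have s01 r : 0 <= r <= s -> 0 <= r <= 1 by lra.
  have [|//|r rs rE] := @ivt_on _ (fun r => phi (seg b' i r) 0 k) 0 s (phi (seg a' i s) 0 k) (ltW s0).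
    apply: cont_on_sub (coord_arc k bi') => r /=; rewrite !in_itv /=; exact: s01.
  - by rewrite seg0 qE seg_fst.
  have sr : 0 <= s <= s by rewrite lexx ltW.
  have := onkl _ _ bi' rs; rewrite rE -(onkl _ _ ai' sr) => /phi_inj.
  move=> /(_ (realization_seg bi' (s01 _ rs)) (realization_seg ai' (s01 _ sr))) E.
  have := congr1 (fun x : P => x 0 a') E; rewrite (seg_fst _ (adj_neq ai')).
  move=> {}E; have : seg b' i r 0 a' != 0 by rewrite E gt_eqF.
  by case/seg_supp => // a'i; move: (adj_neq ai'); rewrite a'i eqxx.
have same a' b' : adj a' i -> adj b' i ->
    t <= phi (seg a' i s) 0 k /\ t <= phi (seg b' i s) 0 k \/
    phi (seg a' i s) 0 k <= t /\ phi (seg b' i s) 0 k <= t -> a' = b'.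
  move=> ai' bi'; have h1 := cross _ _ ai' bi'; have h2 := cross _ _ bi' ai'.
  have [h|/ltW h] := leP (phi (seg a' i s) 0 k) (phi (seg b' i s) 0 k); case=> -[h3 h4].
  - by apply: h1; left; rewrite h3.
  - by apply/esym/h2; right; rewrite h.
  - by apply/esym/h2; left; rewrite h4.
  - by apply: h1; right; rewrite h.
have {}same a' b' : adj a' i -> adj b' i -> a' != b' ->
    (t <= phi (seg a' i s) 0 k) != (t <= phi (seg b' i s) 0 k).
  move=> ai' bi'; apply: contra_neq => E; apply: same => //.
  move: E; case: (leP t (phi (seg a' i s) 0 k)) => [h /esym h'|h]; first by left.
  by case: leP => // h' _; right; split; exact: ltW.
move: (same _ _ ai bi ab) (same _ _ ai ci ac) (same _ _ bi ci bc).
by do 3!case: (t <= _).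
Qed.

(* Positive on the open edge [a b], negative on the other open edges. *)
Definition edge_test a b x : R := 4 * (x 0 a * x 0 b) - 1 + \sum_m x 0 m * x 0 m.

Lemma edge_testE a b i j t : adj i j ->
  edge_test a b (seg i j t) =
  4 * (seg i j t 0 a * seg i j t 0 b) - 2 * (t * (1 - t)).
Proof.
move=> /adj_neq ij; rewrite /edge_test.
rewrite (bigD1 i)//= (bigD1 j) 1?eq_sym//= big1 ?addr0 ?seg_fst ?seg_snd//.
  by ring.
move=> m /andP[mi mj]; have [->|E] := eqVneq (seg i j t 0 m) 0; first by rewrite mulr0.
by case: (seg_supp E) mi mj => ->; rewrite eqxx.
Qed.

Lemma edge_test_gt0 i j t : adj i j -> 0 < t < 1 -> 0 < edge_test i j (seg i j t).
Proof.
move=> ij /andP[t0 t1]; rewrite edge_testE// seg_fst ?seg_snd ?adj_neq//.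
by have : 0 < t * (1 - t) by [rewrite mulr_gt0// subr_gt0]; lra.
Qed.

Lemma edge_test_neq0 a b i j t : a != b -> adj i j -> 0 < t < 1 ->
  edge_test a b (seg i j t) != 0 /\
  (0 < edge_test a b (seg i j t) -> 0 < seg i j t 0 a /\ 0 < seg i j t 0 b).
Proof.
move=> ab ij t01; have /andP[t0 t1] := t01.
have tt : 0 < t * (1 - t) by rewrite mulr_gt0// subr_gt0.
have [E|ai] := eqVneq (seg i j t 0 a) 0; first by rewrite edge_testE// E mul0r; lra.
have [E|bi] := eqVneq (seg i j t 0 b) 0; first by rewrite edge_testE// E mulr0; lra.
rewrite edge_testE//.
case: (seg_supp ai) (seg_supp bi) ab => -> [] ->; rewrite ?eqxx// => _;
  rewrite !(seg_fst, seg_snd) ?adj_neq//; lra.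
Qed.

Lemma edge_test_continuous a b : continuous (edge_test a b).
Proof.
have sum_cts : continuous (fun x : P => \sum_m x 0 m * x 0 m : R).
  apply: (@continuous_big R 'I_(order G) +%R 0 xpredT _ P _ (fun i u => u 0 i * u 0 i)).
    exact: add_continuous.
  by move=> i _ u; apply: continuousM; exact: coord_continuous.
have prod_cts : continuous (fun x : P => 4 * (x 0 a * x 0 b) - 1 : R).
  move=> x; apply: (@continuousB _ _ _ (fun x : P => 4 * (x 0 a * x 0 b)) (cst 1)); last exact: cst_continuous.
  apply: (@continuousM _ _ (cst 4) (fun x : P => x 0 a * x 0 b)); first exact: cst_continuous.
  by apply: continuousM; exact: coord_continuous.
by move=> x; exact: (continuousD (@prod_cts x) (@sum_cts x)).
Qed.

Variable psi : P -> P.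
Hypothesis phiKpsi : forall x, K x -> psi (phi x) = x.
Variables sigma tau : 'I_(order G) -> 'I_(order G).
Hypothesis phi_vertex : forall i, phi (vertex i) = vertex (sigma i).
Hypothesis psi_vertex : forall i, psi (vertex i) = vertex (tau i).

Lemma open_edge_image k l t : adj k l -> 0 < t < 1 ->
  exists i j t', [/\ adj i j, 0 < t' < 1 & phi (seg k l t) = seg i j t'].
Proof.
move=> kl t01; have t01' : 0 <= t <= 1 by lra.
have Kt : K (seg k l t) by exact: realization_seg.
case: (realization_cases (phiK Kt)) => [[i iE]|//].
have := phiKpsi Kt; rewrite iE psi_vertex => /esym.
by case/(@vertex_bad _ _ _ _ kl t01).
Qed.

Lemma edge_image k l : adj k l -> exists a b, adj a b /\
  forall t, 0 < t < 1 -> exists2 t', 0 < t' < 1 & phi (seg k l t) = seg a b t'.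
Proof.
move=> kl; have h01 : 0 < (1 / 2 : R) < 1 by lra.
have [a [b [u [ab u01 uE]]]] := open_edge_image kl h01.
exists a, b; split=> // t t01; have abn := adj_neq ab.
pose g r := edge_test a b (phi (seg k l r)).
have g_neq r : 0 < r < 1 -> g r != 0.
  move=> r01; rewrite /g; have [i [j [r' [ij r'01 ->]]]] := open_edge_image kl r01.
  by case: (edge_test_neq0 abn ij r'01).
have g_half : 0 < g (1 / 2) by rewrite /g uE edge_test_gt0.
suff g_t : 0 < g t.
  have [i [j [r [ij r01 E]]]] := open_edge_image kl t01.
  move: g_t; rewrite /g E => /(edge_test_neq0 abn ij r01).2[xa xb].
  have Kr : K (seg i j r) by apply: realization_seg => //; lra.
  by have [_ r'01 ->] := realization_edge Kr abn xa xb; exists (seg i j r 0 a).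
rewrite ltNge; apply/negP => g_le0.
have cg (p q : R) : 0 < p < 1 -> 0 < q < 1 -> cont_on (`[p, q]%classic : set R) g.
  move=> p01 q01; apply: (@cont_on_comp _ _ _ _ _ setT _ (edge_test a b)) => //.
    apply: (@cont_on_comp _ _ _ _ _ K (seg k l)) => //.
      exact/continuous_cont_on/seg_continuous.
    by move=> r /=; rewrite in_itv /= => r01; apply: realization_seg => //; lra.
  exact/continuous_cont_on/edge_test_continuous.
have [t_half|half_t] := leP t (1 / 2).
  have [|r r01 /eqP] := ivt_on (v := 0) t_half (cg _ _ t01 h01).
    by left; rewrite g_le0 ltW.
  by apply/negP/g_neq; lra.
have [|r r01 /eqP] := ivt_on (v := 0) (ltW half_t) (cg _ _ h01 t01).
  by right; rewrite g_le0 ltW.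
by apply/negP/g_neq; lra.
Qed.

(** Otherwise the coordinate at [sigma l] would be 1 at the endpoint and 0 along the open edge, and
    could not take the value 1 / 2 in between. *)
Lemma edge_endpoint k l a b : adj k l ->
  (forall t, 0 < t < 1 -> exists2 t', 0 < t' < 1 & phi (seg k l t) = seg a b t') ->
  sigma l = a \/ sigma l = b.
Proof.
move=> kl kl_ab; pose m := sigma l.
have h01 : 0 <= (1 / 2 : R) by lra.
have zero t : ~ (m = a \/ m = b) -> 0 < t < 1 -> phi (seg k l t) 0 m = 0.
  move=> mab /kl_ab[t' _ ->]; apply/eqP; apply: contra_notT mab; exact: seg_supp.
apply: contrapT => mab.
have [||r r01 E] := @ivt_on _ (fun r => phi (seg k l r) 0 m) 0 (1 / 2) (1 / 2) h01.
- by apply: cont_on_sub (coord_arc m kl) => r /=; rewrite !in_itv /=; lra.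
- right; rewrite zero//; last by lra.
  by rewrite seg0 phi_vertex vertexE eqxx mulr1n; lra.
have [r0|r0] := eqVneq r 0.
  by move: E; rewrite r0 seg0 phi_vertex vertexE eqxx mulr1n; lra.
have {}r0 : 0 < r by rewrite lt0r r0; lra.
by move: E; rewrite zero//; lra.
Qed.

Lemma edge_to_edge k l : adj k l -> adj (sigma k) (sigma l) /\
  forall t, 0 <= t <= 1 ->
    exists2 t', 0 <= t' <= 1 & phi (seg k l t) = seg (sigma k) (sigma l) t'.
Proof.
move=> kl; have [a [b [ab abP]]] := edge_image kl.
have hl := edge_endpoint kl abP.
have hk : sigma k = a \/ sigma k = b.
  apply: (@edge_endpoint l); first by rewrite adj_sym.
  by move=> t t01; rewrite seg_sym; apply: abP; lra.
have skl : sigma k != sigma l.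
  apply: contraTneq (adj_neq kl) => E; rewrite negbK; apply/eqP/vertex_inj/phi_inj.
  - exact: realization_vertex.
  - exact: realization_vertex.
  - by rewrite !phi_vertex E.
have open t : 0 < t < 1 -> exists2 t', 0 <= t' <= 1 & phi (seg k l t) = seg (sigma k) (sigma l) t'.
  move=> /abP[t' t'01 ->]; case: hk hl skl => -> [] -> //; rewrite ?eqxx// => _.
    by exists t' => //; lra.
  by exists (1 - t'); [lra|rewrite seg_sym].
split.
  by case: hk hl skl => -> [] ->; rewrite ?eqxx// adj_sym.
move=> t /andP[]; rewrite le_eqVlt => /predU1P[<-|t0].
  by exists 0; rewrite ?lexx ?ler01// !seg0.
rewrite le_eqVlt => /predU1P[->|t1]; last by apply: open; rewrite t0.
by exists 1; rewrite ?lexx ?ler01// !seg1.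
Qed.

End Image.

End GraphRealization.

(** * Self-maps of embedded ladders *)

Lemma embedding_continuous (X Y : topologicalType) (f : X -> Y) :
  is_embedding f -> continuous f.
Proof.
by move=> [_ fP]; apply/continuousP => B oB; apply/fP; exists B.
Qed.

Lemma embedding_lift (X Y : topologicalType) (f : X -> Y) (h : Y -> Y) :
  is_embedding f -> continuous h -> h @` range f `<=` range f ->
  exists2 phi : X -> X, continuous phi & forall x, f (phi x) = h (f x).
Proof.
move=> ef ch hf; have fc := embedding_continuous ef.
have [|phi phiE] := @choice X X (fun x y => f y = h (f x)).
  move=> x; have [|y _ fy] := hf (h (f x)); last by exists y.
  by exists (f x) => //; exists x.
exists phi => //; apply/continuousP => _ /ef.2[B oB <-].
rewrite (_ : _ @^-1` _ = (h \o f) @^-1` B); last first.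
  by apply/funext => x; rewrite /preimage /= phiE.
by move: B oB; apply/continuousP => x; apply: continuous_comp; [exact: fc|exact: ch].
Qed.

Section LadderSelfMap.
Variables (R : realType) (n : nat).
Hypothesis n3 : (3 < n)%N.
Local Notation P := 'rV[R]_(2 * n).
Local Notation K := (realization R (moebius_ladder n) : set P).

Let n0 : (0 < 2 * n)%N. Proof. by rewrite muln_gt0 (leq_trans _ n3). Qed.

Definition ladder_vertex (v : nat) : 'I_(2 * n) := Ordinal (ltn_pmod v n0).

Lemma vt_vertex v : vt R n v = vertex R (G := moebius_ladder n) (ladder_vertex v).
Proof. by apply/rowP => j; rewrite !mxE eqxx. Qed.

Lemma eptE u v (t : R) :
  ept n u v t = seg (G := moebius_ladder n) (ladder_vertex v) (ladder_vertex u) t.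
Proof. by rewrite /ept !vt_vertex /seg addrC. Qed.

Lemma ladder_vertex_ord (i : 'I_(2 * n)) : ladder_vertex i = i.
Proof. by apply/val_inj; rewrite /= modn_small. Qed.

Definition ladder_edge u v := v = u.+1 \/ v = (u + n)%N.

Lemma ladder_edge_adj u v : ladder_edge u v ->
  adj (s := moebius_ladder n) (ladder_vertex v) (ladder_vertex u).
Proof.
case=> ->; rewrite adj_sym /= /moebius_adj /=; apply/or3P; [constructor 1|constructor 3].
  by rewrite -[in X in _ == X]addn1 modnDml addn1.
by rewrite modnDml.
Qed.

Lemma on_edge_realization u v x : ladder_edge u v -> on_edge u v x -> K x.
Proof.
by move=> /ladder_edge_adj uv [t t01 ->]; rewrite eptE; exact: realization_seg.
Qed.

Lemma adj_ladder (i j : 'I_(2 * n)) : adj (s := moebius_ladder n) i j -> ladder_adj n i j.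
Proof.
have := ltn_ord i; have := ltn_ord j.
have mod_cases k : (k < 4 * n)%N -> (k %% (2 * n))%N = k \/ k = (k %% (2 * n) + 2 * n)%N.
  move=> k4; have [k2|k2] := ltnP k (2 * n); first by left; rewrite modn_small.
  by right; rewrite -[in RHS](subnK k2) modnDr modn_small ?subnK//; lia.
move=> jn iN; case/or3P => /eqP.
- have [->|] := @mod_cases i.+1 ltac:(lia); first by constructor 1; left.
  by move=> h E; constructor 1; right; lia.
- have [->|] := @mod_cases j.+1 ltac:(lia); first by constructor 2; left.
  by move=> h E; constructor 2; right; lia.
- have [->|] := @mod_cases (i + n)%N ltac:(lia); first by constructor 3; left.
  by move=> h E; constructor 3; right; lia.
Qed.

Lemma ladder_degree i : exists a b c, [/\ adj (s := moebius_ladder n) a i,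
  adj (s := moebius_ladder n) b i, adj (s := moebius_ladder n) c i, a != b & a != c /\ b != c].
Proof.
have lneq u k : (0 < k < 2 * n)%N -> ladder_vertex u != ladder_vertex (u + k).
  move=> /andP[k0 kn]; apply/eqP => /(congr1 val) /= /eqP.
  by rewrite -{1}[u]addn0 eqn_modDl mod0n modn_small// eq_sym gtn_eqF.
pose u := (i + (2 * n).-1)%N.
have uE : ladder_vertex u.+1 = i.
  rewrite -[RHS]ladder_vertex_ord; apply: val_inj => /=.
  by rewrite /u -addnS prednK// modnDr.
exists (ladder_vertex u), (ladder_vertex u.+2), (ladder_vertex (u.+1 + n)).
split.
- by rewrite -uE adj_sym; apply: ladder_edge_adj; left.
- by rewrite -uE; apply: ladder_edge_adj; left.
- by rewrite -uE; apply: ladder_edge_adj; right.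
- by rewrite -addn2; apply: lneq; lia.
split; first by rewrite addSnnS; apply: lneq; lia.
by rewrite (_ : u.+1 + n = u.+2 + n.-1)%N; [apply: lneq|]; lia.
Qed.

(* [phi] moves the edges along the vertex map [s] up to reparametrisation, and [phi'] is its
   linearisation. *)
Record ladder_image (s : nat -> nat) (phi phi' : P -> P) : Prop := LadderImage {
  li_linear : forall u v t, phi' (ept n u v t) = ept n (s u) (s v) t;
  li_edge : forall u v t, ladder_edge u v -> 0 <= t <= 1 ->
    on_edge (s u) (s v) (phi (ept n u v t));
  li_in : forall u v x, ladder_edge u v -> on_edge (s u) (s v) x -> K x;
  li_inj : forall u v, s u = s v %[mod 2 * n] -> u = v %[mod 2 * n] }.

Variables phi psi : P -> P.
Hypothesis phiK : forall x, K x -> K (phi x).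
Hypothesis psiK : forall x, K x -> K (psi x).
Hypothesis phi_cont : cont_on K phi.
Hypothesis psi_cont : cont_on K psi.
Hypothesis phiKpsi : forall x, K x -> psi (phi x) = x.
Hypothesis psiKphi : forall x, K x -> phi (psi x) = x.

Lemma ladder_self_map : exists s phi', ladder_image s phi phi' /\
  ((exists C, forall u v t, phi' (ept n u v t) = ept n (u + C) (v + C) t) \/
   (exists2 C, (4 * n <= C)%N & forall u v t, (u <= C)%N -> (v <= C)%N ->
     phi' (ept n u v t) = ept n (C - u) (C - v) t)).
Proof.
have inj (g g' : P -> P) : (forall x, K x -> g' (g x) = x) ->
    forall x y, K x -> K y -> g x = g y -> x = y.
  by move=> gK x y Kx Ky E; rewrite -(gK x)// -(gK y)// E.
have vimage g g' : (forall x, K x -> K (g x)) -> cont_on K g -> (forall x, K x -> g' (g x) = x) ->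
    {s : 'I_(2 * n) -> 'I_(2 * n) & forall i, g (vertex R (G := moebius_ladder n) i) = vertex R (G := moebius_ladder n) (s i)}.
  move=> gK gc gg'; apply: (@choice _ _ (fun i j => g (vertex R (G := moebius_ladder n) i) = vertex R (G := moebius_ladder n) j)) => i; have [a [b [c [h1 h2 h3 h4 [h5 h6]]]]] := ladder_degree i.
  exact: (@vertex_image R (moebius_ladder n) g gK gc (inj _ _ gg') i a b c h1 h2 h3 h4 h5 h6).
have [sg sgE] := vimage _ _ phiK phi_cont phiKpsi.
have [tu tuE] := vimage _ _ psiK psi_cont psiKphi.
have edges := @edge_to_edge R (moebius_ladder n) phi phiK phi_cont (inj _ _ phiKpsi) psi phiKpsi sg tu sgE tuE.
pose s v : nat := sg (ladder_vertex v).
have sI u v : s u = s v -> u = v %[mod 2 * n].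
  move=> /val_inj E; suff /(congr1 val) : ladder_vertex u = ladder_vertex v by [].
  apply: (@vertex_inj R (moebius_ladder n)); apply: (inj _ _ phiKpsi).
  - exact: realization_vertex.
  - exact: realization_vertex.
  - by rewrite !sgE E.
have s_lt v : (s v < 2 * n)%N by exact: ltn_ord.
have sE v : ladder_vertex (s v) = sg (ladder_vertex v) by rewrite ladder_vertex_ord.
pose phi' (x : P) : P := \sum_i x 0 i *: vt R n (sg i).
have phi'E u v t : phi' (ept n u v t) = ept n (s u) (s v) t.
  have lin a b (x y : P) : phi' (a *: x + b *: y) = a *: phi' x + b *: phi' y.
    rewrite /phi' !scaler_sumr -big_split /=; apply: eq_bigr => i _.
    by rewrite !mxE scalerDl !scalerA.
  have vE w : phi' (vt R n w) = vt R n (s w).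
    rewrite /phi' (bigD1 (ladder_vertex w))//= big1 ?addr0.
      by rewrite mxE eqxx scale1r.
    by move=> i; rewrite -val_eqE mxE /= => /negbTE->; rewrite scale0r.
  by rewrite /ept lin !vE.
exists s, phi'; split.
  split=> //.
  - move=> u v t uv t01; rewrite eptE.
    have [_ /(_ t t01)[t' t'01 ->]] := edges _ _ (ladder_edge_adj uv).
    by exists t' => //; rewrite eptE !sE.
  - move=> u v _ uv [t t01 ->]; rewrite eptE !sE.
    by apply: realization_seg => //; have [] := edges _ _ (ladder_edge_adj uv).
  - by move=> u v; rewrite (modn_small (s_lt u)) (modn_small (s_lt v)); exact: sI.
have s_adj u v : ladder_edge u v -> ladder_adj n (s u) (s v).
  by move=> /ladder_edge_adj uv; apply/adj_ladder; have [] := edges _ _ uv; rewrite adj_sym.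
have s_per v : s (v + 2 * n)%N = s v.
  by rewrite /s; congr (val (sg _)); apply: val_inj; rewrite /= modnDr.
have [||[C CE]|[C C4 CE]] := ladder_dihedral n3 s_lt s_per sI.
- by move=> v; apply: s_adj; left.
- by move=> v; apply: s_adj; right.
- left; exists C => u v t; rewrite phi'E /ept !CE.
  by congr (_ *: _ + _ *: _); apply: vt_mod; rewrite modn_mod.
right; exists C => // u v t uC vC; rewrite phi'E /ept !CE//.
by congr (_ *: _ + _ *: _); apply: vt_mod; rewrite modn_mod.
Qed.

End LadderSelfMap.

Lemma inv_nat_small (R : realType) (e : R) : 0 < e ->
  exists M0, forall M, (M0 <= M)%N -> M%:R^-1 < e.
Proof.
move=> e0; exists (Num.truncn e^-1).+1 => M M0M.
have eM : e^-1 < M%:R.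
  by apply: lt_le_trans (_ : (Num.truncn e^-1).+1%:R <= _); rewrite ?truncnS_gt// ler_nat.
by rewrite -[e]invrK ltf_pV2 ?posrE ?invr_gt0// (lt_trans _ eM)// invr_gt0.
Qed.

Lemma ladder_edge_neq n u v : (3 < n)%N -> ladder_edge n u v -> u <> v %[mod 2 * n].
Proof.
by move=> n3; case=> -> /eqP; rewrite -{1}[u]addn0 -?[u.+1]addn1 eqn_modDl mod0n modn_small//; lia.
Qed.

Section SubLadderMetric.
Variables (R : realType) (n M : nat).
Hypotheses (n3 : (3 < n)%N) (M0 : (0 < M)%N).
Local Notation a := (sub_ladder R n M).

Lemma sub_edge_ladder i j u v : sub_edge n i j u v -> ladder_edge n u v.
Proof. by case=> -[_]; [left|right]. Qed.

Lemma sub_ladder_small i j q : (j < 9)%N -> q \in a i j ->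
  exists u v t t', [/\ ladder_edge n u v, 0 <= t <= 1, 0 <= t' <= 1,
    q = (ept n u v t, ept n u v t') & t' - t = M%:R^-1].
Proof.
move=> j9 qa; have [u [v [uv [t t01 E1] [t' t'01 E2] E]]] := sub_ladder_edge n3 M0 j9 qa.
exists u, v, t, t'; split=> //; first exact: sub_edge_ladder uv.
  by rewrite [LHS]surjective_pairing E1 E2.
have n0 : (0 < 2 * n)%N by lia.
have uv_neq : v <> u %[mod 2 * n] by exact/nesym/(ladder_edge_neq n3)/(sub_edge_ladder uv).
have := congr1 (fun x : 'rV[R]_(2 * n) => x 0 (Ordinal (ltn_pmod v n0))) E.
rewrite E1 E2 !mxE /= eqxx; move/eqP/negbTE: uv_neq => ->.
by rewrite !mulr0 !add0r !mulr1 subr0 mulr1.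
Qed.

Lemma sub_ladder_disjoint i e q q' : e \in hex_pairs ->
  (q \in a i e.2.1 /\ q' \in a i e.2.2) \/ (q \in a i e.2.2 /\ q' \in a i e.2.1) ->
  exists u v u' v', [/\ ladder_edge n u v, ladder_edge n u' v',
    disjoint_edges n u v u' v', on_edge u v q.1 & on_edge u' v' q'.1].
Proof.
move=> he hq.
have /andP[j9 k9] : (e.2.1 < 9)%N && (e.2.2 < 9)%N by move: e he {hq}; exact/allP.
case: hq => -[qa q'a].
  have [u [v [uv qe _ _]]] := sub_ladder_edge n3 M0 j9 qa.
  have [u' [v' [uv' q'e _ _]]] := sub_ladder_edge n3 M0 k9 q'a.
  exists u, v, u', v'; split=> //; try exact: sub_edge_ladder uv; try exact: sub_edge_ladder uv'.
  exact: (sub_edge_disjoint R n3 M0 he uv uv').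
have [u [v [uv qe _ _]]] := sub_ladder_edge n3 M0 k9 qa.
have [u' [v' [uv' q'e _ _]]] := sub_ladder_edge n3 M0 j9 q'a.
exists u, v, u', v'; split=> //; try exact: sub_edge_ladder uv; try exact: sub_edge_ladder uv'.
have [h1 h2 h3 h4] := sub_edge_disjoint R n3 M0 he uv' uv.
by split; [exact: nesym h1|exact: nesym h3|exact: nesym h2|exact: nesym h4].
Qed.

End SubLadderMetric.

(** * Invariance of the degrees along an embedded ladder *)

Section EmbeddedLadder.
Variables (R : realType) (n : nat).
Hypothesis n3 : (3 < n)%N.
Local Notation P := 'rV[R]_(2 * n).
Local Notation V := 'rV[R]_4.
Local Notation K := (realization R (moebius_ladder n) : set P).
Variable F : P -> V.
Hypothesis F_unit : forall x, K x -> dotv (F x) (F x) = 1.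
Hypothesis F_cont : cont_on K F.
Hypothesis F_inj : forall x y, K x -> K y -> F x = F y -> x = y.

Let K_compact : compact K. Proof. exact: (@realization_compact R (moebius_ladder n)). Qed.

Lemma edges_apart : exists2 dl, 0 < dl & forall x y, K x -> K y ->
  1 / 2 <= `|y - x| -> dl <= `|F y - F x|.
Proof.
have h : 0 < (1 / 2 : R) by lra.
have [dl dl0 dlP] := sep_on K_compact F_cont F_inj h.
by exists dl => // x y Kx Ky; exact: dlP.
Qed.

Section Move.
Variables (s : nat -> nat) (phi phi' : P -> P).
Hypothesis phi_cont : cont_on K phi.
Hypothesis phi_im : ladder_image s phi phi'.

(** Straight-line homotopy from [phi] to [phi']. Both send a ladder edge into the same edge, so
    intermediate maps do too, and disjoint edges keep disjoint images. *)
Let mix (r : R) (x : P) : P := (1 - r) *: phi x + r *: phi' x.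

Let mix_edge r u v t : 0 <= r <= 1 -> ladder_edge n u v -> 0 <= t <= 1 ->
  on_edge (s u) (s v) (mix r (ept n u v t)).
Proof.
move=> /andP[r0 r1] uv t01; rewrite /mix (li_linear phi_im).
have [t' t'01 ->] := li_edge phi_im uv t01.
exists ((1 - r) * t' + r * t).
  by apply/andP; split; nra.
by rewrite /ept !scalerDr !scalerA addrACA -!scalerDl; congr (_ *: _ + _ *: _); ring.
Qed.

Let mix_in r u v t : 0 <= r <= 1 -> ladder_edge n u v -> 0 <= t <= 1 ->
  K (mix r (ept n u v t)).
Proof. by move=> r01 uv t01; apply: (li_in phi_im uv); exact: mix_edge. Qed.

Lemma ept_diff_norm u v (t t' : R) : `|ept n u v t' - ept n u v t| <= `|t' - t|.
Proof.
rewrite (_ : _ - _ = (t' - t) *: (vt R n v - vt R n u)); last first.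
  by apply/rowP => j; rewrite !mxE; ring.
by rewrite normrZ ler_piMr// vt_diff_norm.
Qed.

Let mix_step r r' u v t : ladder_edge n u v -> 0 <= t <= 1 ->
  `|mix r' (ept n u v t) - mix r (ept n u v t)| <= `|r' - r|.
Proof.
move=> uv t01; rewrite /mix (li_linear phi_im).
have [t' t'01 ->] := li_edge phi_im uv t01.
set x := ept n (s u) (s v) t'; set y := ept n (s u) (s v) t.
rewrite (_ : _ - _ = (r' - r) *: (y - x)); last first.
  by apply/rowP => j; rewrite !mxE; ring.
rewrite normrZ ler_piMr//; apply: le_trans (ept_diff_norm _ _ _ _) _.
by rewrite ler_norml; lra.
Qed.

Let mix_close r (x y : P) e : 0 <= r <= 1 -> `|phi y - phi x| < e ->
  `|phi' y - phi' x| < e -> `|mix r y - mix r x| < e.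
Proof.
move=> /andP[r0 r1] h1 h2; rewrite /mix.
rewrite (_ : _ - _ = (1 - r) *: (phi y - phi x) + r *: (phi' y - phi' x)); last first.
  by apply/rowP => j; rewrite !mxE; ring.
apply: le_lt_trans (ler_normD _ _) _; rewrite !normrZ (ger0_norm r0) ger0_norm ?subr_ge0//.
move: h1 h2; set A := `|phi y - _|; set B := `|phi' y - _| => h1 h2.
have me : Num.max A B < e by rewrite gt_max h1.
have h3 : (1 - r) * A <= (1 - r) * Num.max A B by rewrite ler_wpM2l ?subr_ge0 ?le_max ?lexx.
have h4 : r * B <= r * Num.max A B by rewrite ler_wpM2l ?le_max ?lexx ?orbT.
lra.
Qed.

(** The homotopy is cut into [l] steps, each moving points and sample neighbours so little that
    [join_small_move] applies. *)
Lemma ladder_move : exists M1, forall M, (M1 <= M)%N -> (0 < M)%N ->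
  forall i D, locally_cocycle D ->
  join_cycle (sub_ladder R n M i) (fun w => D (map (reflect_label (fun x => F (phi x))) w)) =
  join_cycle (sub_ladder R n M i) (fun w => D (map (reflect_label (fun x => F (phi' x))) w)).
Proof.
have [dl dl0 apart] := edges_apart.
(* The largest radius that [cluster_hull] allows for separation [dl]. *)
pose r := dl ^+ 2 / 16; have r0 : 0 < r by rewrite divr_gt0// exprn_gt0.
have [d d0 Fd] := uc_on K_compact F_cont r0.
have d2 : 0 < d / 2 by rewrite divr_gt0.
have [d' d'0 phid] := uc_on K_compact phi_cont d2.
have [L L_small] := inv_nat_small d2.
have dd0 : 0 < Num.min d' (d / 2) by rewrite lt_min d'0.
have [M1 M1P] := inv_nat_small dd0.
exists M1 => M M1M M0 i D cD.
have := M1P M M1M; rewrite lt_min => /andP[Md' Md].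
pose l := L.+1; have l0 : 0 < (l%:R : R) by rewrite ltr0n.
have l_small : (l%:R : R)^-1 < d / 2 by apply: L_small.
pose c k := join_cycle (sub_ladder R n M i)
  (fun w => D (map (reflect_label (fun x => F (mix (k%:R / l%:R) x))) w)).
have step k : (k < l)%N -> c k.+1 = c k.
  move=> kl; have k01 : 0 <= (k%:R / l%:R : R) <= 1.
    by rewrite divr_ge0//= ler_pdivrMr// mul1r ler_nat ltnW.
  have k01' : 0 <= (k.+1%:R / l%:R : R) <= 1.
    by rewrite divr_ge0//= ler_pdivrMr// mul1r ler_nat.
  have kstep : k.+1%:R / l%:R - k%:R / l%:R = l%:R^-1 :> R.
    by rewrite -mulrBl -natrB// subSnn mul1r.
  rewrite /c; apply: (@join_small_move _ _ _ _ dl r _ (hex_vertex R n i)) => //.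
  - by rewrite /r; lra.
  - exact: sub_ladder_path.
  - move=> e q q' he hq.
    have [u [v [u' [v' [uv uv' dis [t t01 ->] [t' t'01 ->]]]]]] := sub_ladder_disjoint n3 M0 he hq.
    apply: apart; [exact: mix_in|exact: mix_in|].
    apply: (on_edge_far n3 M0 (u := s u) (v := s v) (u' := s u') (v' := s v')); last 2 first.
    + exact: mix_edge.
    + exact: mix_edge.
    + by move=> /(li_inj phi_im)/(ladder_edge_neq n3 uv).
    + by have [h1 h2 h3 h4] := dis; split=> /(li_inj phi_im).
  - move=> j q j9 qa.
    have [u [v [t [t' [uv t01 t'01 -> tt']]]]] := sub_ladder_small n3 M0 j9 qa.
    rewrite /=.
    have E : `|t' - t| = M%:R^-1 by rewrite tt' ger0_norm ?invr_ge0 ?ler0n.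
    have Ku : K (ept n u v t) by apply: on_edge_realization uv _ => //; exists t.
    have Kv : K (ept n u v t') by apply: on_edge_realization uv _ => //; exists t'.
    have near2 : `|mix (k%:R / l%:R) (ept n u v t') - mix (k%:R / l%:R) (ept n u v t)| < d / 2.
      have h1 : `|phi (ept n u v t') - phi (ept n u v t)| < d / 2.
        by apply: phid => //; apply: le_lt_trans (ept_diff_norm _ _ _ _) _; rewrite E.
      have h2 : `|phi' (ept n u v t') - phi' (ept n u v t)| < d / 2.
        by rewrite !(li_linear phi_im); apply: le_lt_trans (ept_diff_norm _ _ _ _) _; rewrite E.
      exact: mix_close.
    have step2 : `|mix (k.+1%:R / l%:R) (ept n u v t) - mix (k%:R / l%:R) (ept n u v t)| < d / 2.
      by apply: le_lt_trans (mix_step _ _ uv t01) _; rewrite kstep ger0_norm// invr_ge0 ler0n.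
    have step3 : `|mix (k.+1%:R / l%:R) (ept n u v t') - mix (k%:R / l%:R) (ept n u v t')| < d / 2.
      by apply: le_lt_trans (mix_step _ _ uv t'01) _; rewrite kstep ger0_norm// invr_ge0 ler0n.
    split.
    + by apply: F_unit; exact: mix_in.
    + by apply: Fd; [exact: mix_in|exact: mix_in|lra].
    + by apply: Fd; [exact: mix_in|exact: mix_in|lra].
    + apply: Fd; [exact: mix_in|exact: mix_in|].
      have := ler_distD (mix (k%:R / l%:R) (ept n u v t')) (mix (k.+1%:R / l%:R) (ept n u v t')) (mix (k%:R / l%:R) (ept n u v t)).
      lra.
have cl : c l = c 0.
  have : forall k, (k <= l)%N -> c k = c 0.
    by elim=> // k IH kl; rewrite step ?IH// ltnW.
  exact.
have mix0 x : mix (0%:R / l%:R) x = phi x by rewrite /mix mul0r subr0 scale1r scale0r addr0.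
have mix1 x : mix (l%:R / l%:R) x = phi' x.
  by rewrite /mix divff ?gt_eqF// subrr scale1r scale0r add0r.
have -> : (fun x => F (phi x)) = (fun x => F (mix (0%:R / l%:R) x)).
  by apply/funext => x; rewrite mix0.
have -> : (fun x => F (phi' x)) = (fun x => F (mix (l%:R / l%:R) x)).
  by apply/funext => x; rewrite mix1.
exact: esym cl.
Qed.

End Move.

Lemma ladder_mesh e : 0 < e -> exists M1, forall M, (M1 <= M)%N -> (0 < M)%N ->
  forall i j q, (j < 9)%N -> q \in sub_ladder R n M i j -> [/\ K q.1, K q.2 & `|F q.2 - F q.1| < e].
Proof.
move=> e0; have [d d0 Fd] := uc_on K_compact F_cont e0.
have [M1 M1P] := inv_nat_small d0; exists M1 => M M1M M0 i j q j9 qa.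
have [u [v [t [t' [uv t01 t'01 -> tt']]]]] := sub_ladder_small n3 M0 j9 qa.
have Ku : K (ept n u v t) by apply: on_edge_realization uv _ => //; exists t.
have Kv : K (ept n u v t') by apply: on_edge_realization uv _ => //; exists t'.
split=> //; apply: Fd => //; apply: le_lt_trans (ept_diff_norm _ _ _ _) _.
by rewrite tt' ger0_norm ?invr_ge0 ?ler0n// M1P.
Qed.

Lemma ladder_apart : exists2 dl, 0 < dl & forall M, (0 < M)%N ->
  forall i e q q', e \in hex_pairs ->
  (q \in sub_ladder R n M i e.2.1 /\ q' \in sub_ladder R n M i e.2.2) \/
  (q \in sub_ladder R n M i e.2.2 /\ q' \in sub_ladder R n M i e.2.1) ->
  dl <= `|F q'.1 - F q.1|.
Proof.
have [dl dl0 apart] := edges_apart; exists dl => // M M0 i e q q' he hq.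
have [u [v [u' [v' [uv uv' dis h h']]]]] := sub_ladder_disjoint n3 M0 he hq.
apply: apart; [exact: on_edge_realization h|exact: on_edge_realization h'|].
exact: (on_edge_far n3 M0 (ladder_edge_neq n3 uv) dis h h').
Qed.

Lemma ladder_adm : exists M1, forall M, (M1 <= M)%N -> (0 < M)%N ->
  forall i e q q', e \in hex_pairs ->
  (q \in sub_ladder R n M i e.2.1 /\ q' \in sub_ladder R n M i e.2.2) \/
  (q \in sub_ladder R n M i e.2.2 /\ q' \in sub_ladder R n M i e.2.1) ->
  ~ hull (map (reflect_label F) (join_simplex q q')) 0.
Proof.
have [dl dl0 apart] := ladder_apart.
pose r := dl ^+ 2 / 16; have r0 : 0 < r by rewrite divr_gt0// exprn_gt0.
have [M1 M1P] := ladder_mesh r0; exists M1 => M M1M M0 i e q q' he hq.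
have /andP[j9 k9] : (e.2.1 < 9)%N && (e.2.2 < 9)%N by move: e he {hq}; exact/allP.
have far := apart M M0 i e q q' he hq.
have [[K1 K2 s12] [K1' K2' s12']] :
    [/\ K q.1, K q.2 & `|F q.2 - F q.1| < r] /\ [/\ K q'.1, K q'.2 & `|F q'.2 - F q'.1| < r].
  case: hq => -[qa q'a]; split.
  - exact: (M1P M M1M M0 i e.2.1 q).
  - exact: (M1P M M1M M0 i e.2.2 q').
  - exact: (M1P M M1M M0 i e.2.2 q).
  - exact: (M1P M M1M M0 i e.2.1 q').
apply: (@cluster_hull R _ (F q.1) (F q'.1) dl r); [exact: F_unit|exact: F_unit|by []|exact: ltW| |].
  by rewrite /r; lra.
move=> v /mapP[z]; rewrite /join_simplex !inE => /or4P[] /eqP -> ->; rewrite /reflect_label /=.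
- by left; rewrite addNr normr0.
- by left; rewrite addrC distrC.
- by right; rewrite subrr normr0.
- by right.
Qed.

Lemma ladder_refine (hh : V -> V) :
  (forall u, dotv u u = 1 -> dotv (hh u) (hh u) = 1) -> cont_on (sphere3 R) hh ->
  (forall u v, sphere3 R u -> sphere3 R v -> hh u = hh v -> u = v) ->
  exists M1 m0, forall M m, (M1 <= M)%N -> (0 < M)%N -> (m0 <= m)%N ->
  forall i D, locally_cocycle D ->
  join_cycle (sub_ladder R n M i) (fun w =>
    iter m sd (fun u => D (map (fun v => hh (normalize v)) u)) (map (reflect_label F) w)) =
  join_cycle (sub_ladder R n M i) (fun w => D (map (reflect_label (fun x => hh (F x))) w)).
Proof.
move=> hu hc hI; have [dl dl0 apart] := ladder_apart.
have [r0 r0_gt0 [m0 m0P]] := join_refine hu hc hI dl0.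
have [M1 M1P] := ladder_mesh r0_gt0.
exists M1, m0 => M m M1M M0 m0m i D cD.
apply: (m0P m m0m P F _ (hex_vertex R n i) D) => //.
- exact: sub_ladder_path.
- exact: apart.
- by move=> j q j9 qa; have [K1 K2 s12] := M1P M M1M M0 i j q j9 qa; split; rewrite ?F_unit.
Qed.

End EmbeddedLadder.

Lemma odd_sum_neq0 (L : nat -> int) (r : seq nat) : odd (size r) ->
  (forall i m, i \in r -> L i <> 2 * m) -> \sum_(i <- r) L i <> 0.
Proof.
move=> odd_r oddL; suff [m ->] : exists m, \sum_(i <- r) L i = 2 * m + (size r)%:Z by lia.
elim: r {odd_r} oddL => [|i r IH] oddL; first by exists 0; rewrite big_nil.
have [|m mE] := IH; first by move=> j m jr; apply: oddL; rewrite inE jr orbT.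
have [k kE] : exists k, L i = 2 * k + 1.
  exists (L i %/ 2)%Z; have := oddL i (L i %/ 2)%Z (mem_head _ _); lia.
by exists (m + k); rewrite big_cons mE kE /=; lia.
Qed.

Section DegreeCocycle.
Variables (R : realType) (t : nat -> R).
Local Notation l := (fun i => moment (t i)).
Hypothesis flat4 : forall w, flat l 4 w -> w = 0.

Let l_lin k b (u v : 'rV[R]_4) : l k (b *: u + v) = b * l k u + l k v.
Proof. exact: moment_linear. Qed.

Lemma degc_locally_cocycle : locally_cocycle (degc l 4).
Proof.
move=> u u0; apply: cob_degc l_lin _ _ _ => w hw fw; apply: u0.
by rewrite -(flat4 fw).
Qed.

End DegreeCocycle.

(* Total extensions [hh] of a self-homeomorphism of the sphere and [phi], with inverse
   [psi], of the self-map that it induces on the embedded space [K]. *)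
Record mirror (R : realType) (U : normedModType R) (K : set U) (F : U -> 'rV[R]_4)
    (hh : 'rV[R]_4 -> 'rV[R]_4) (phi psi : U -> U) : Prop := Mirror {
  mr_unit : forall x, K x -> dotv (F x) (F x) = 1;
  mr_cont : cont_on K F;
  mr_inj : forall x y, K x -> K y -> F x = F y -> x = y;
  mr_reflect_unit : forall u, dotv u u = 1 -> dotv (hh u) (hh u) = 1;
  mr_reflect_cont : cont_on (sphere3 R) hh;
  mr_reflect_inj : forall u v, sphere3 R u -> sphere3 R v -> hh u = hh v -> u = v;
  mr_self : forall x, K x -> K (phi x) /\ K (psi x);
  mr_self_cont : cont_on K phi /\ cont_on K psi;
  mr_self_inv : forall x, K x -> psi (phi x) = x /\ phi (psi x) = x;
  mr_self_reflect : forall x, K x -> F (phi x) = hh (F x) }.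

Lemma achiral_mirror (R : realType) (U : normedModType R) (K : set U)
    (f : K -> sphere3 R) : is_embedding f -> achiral (range f) ->
  exists h, exists2 hh, orientation_reversing h &
    (forall x : sphere3 R, hh (set_val x) = set_val (h x)) /\
    exists phi psi, mirror K (extend f) hh phi psi.
Proof.
move=> ef [h [[hi [hiK hKi]] h_rev h_im]].
have fc := embedding_continuous ef.
have hc : continuous h := @cts_fun _ _ h.
have hic : continuous hi := @cts_fun _ _ hi.
have [phi phi_c phiE] : exists2 phi, continuous phi & forall x, f (phi x) = h (f x).
  by apply: embedding_lift => //; rewrite h_im.
have [psi psi_c psiE] : exists2 psi, continuous psi & forall x, f (psi x) = hi (f x).
  apply: embedding_lift => // _ [y fy <-].
  have [z fz <-] : (h @` range f) y by rewrite h_im.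
  by rewrite hiK.
exists h, (extend h) => //; split; first exact: extendE.
exists (extend phi), (extend psi).
have at_pt (A : U -> Prop) : (forall x : K, A (set_val x)) -> forall x, K x -> A x.
  by move=> AK x Kx; exact: (AK (exist _ x (mem_set Kx))).
have at_pt3 (A : 'rV[R]_4 -> Prop) : (forall x : sphere3 R, A (set_val x)) -> forall x, sphere3 R x -> A x.
  by move=> AK x Kx; exact: (AK (exist _ x (mem_set Kx))).
split.
- by move=> x; exact: extend_unit.
- exact: extend_cont.
- move=> x y Kx Ky; move: x Kx y Ky; apply: (at_pt) => x; apply: (at_pt) => y.
  by rewrite !extendE => /val_inj/ef.1->.
- by move=> u u1; apply: extend_unit; apply/sphere3P.
- exact: extend_cont.
- move=> u v su sv; move: u su v sv; apply: (at_pt3) => u; apply: (at_pt3) => v.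
  by rewrite !extendE => /val_inj /(congr1 hi); rewrite !hiK => ->.
- by move=> x Kx; split; exact: extend_in.
- by split; exact: extend_cont.
- apply: (at_pt) => x; rewrite !extendE; split; congr (set_val _); apply: ef.1.
    by rewrite psiE phiE hiK.
  by rewrite phiE psiE hKi.
- by apply: (at_pt) => x; rewrite !extendE phiE.
Qed.

(** * Parity against reversal of orientation *)

Section AchiralLadder.
Variables (R : realType) (n : nat).
Hypotheses (n3 : (3 < n)%N) (n_odd : odd n).
Local Notation G := (moebius_ladder n).
Local Notation P := 'rV[R]_(2 * n).
Local Notation K := (realization R G : set P).
Local Notation V := 'rV[R]_4.

Lemma ladder_not_mirror (h : continuousType (sphere3 R) (sphere3 R)) (hh : V -> V)
    (F : P -> V) (phi psi : P -> P) : orientation_reversing h ->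
  (forall x : sphere3 R, hh (set_val x) = set_val (h x)) -> ~ mirror K F hh phi psi.
Proof.
move=> h_rev hh_val [F_unit F_cont F_inj hh_unit hh_cont hh_inj phiK phi_cont phiKpsi Fphi].
have [s [phi' [phi_im dihedral]]] := ladder_self_map n3 (fun x Kx => (phiK x Kx).1)
  (fun x Kx => (phiK x Kx).2) phi_cont.1 phi_cont.2 (fun x Kx => (phiKpsi x Kx).1) (fun x Kx => (phiKpsi x Kx).2).
have [M1 moveP] := ladder_move n3 F_unit F_cont F_inj phi_cont.1 phi_im.
have [M2 admP] := ladder_adm n3 F_unit F_cont F_inj.
have [M3 [m3 refineP]] := ladder_refine n3 F_unit F_cont F_inj hh_unit hh_cont hh_inj.
have id_cont : cont_on (sphere3 R) (@id V).
  by move=> x _ e e0; exists e.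
(* The case of the identity serves the other side of [join_reverse], which is subdivided and
   projected as well. *)
have [M4 [m4 refineP']] := ladder_refine n3 F_unit F_cont F_inj (hh := id) (fun _ => id) id_cont (fun _ _ _ _ => id).
(* Only the membership of the sample points in [K] is wanted; the mesh bound 1 is arbitrary. *)
have [M5 meshP] := ladder_mesh n3 F_cont (ltr01 : 0 < 1 :> R).
have [M M0 [M1M M2M M3M [M4M M5M]]] : exists2 M, (0 < M)%N &
    [/\ (M1 <= M)%N, (M2 <= M)%N, (M3 <= M)%N & (M4 <= M)%N /\ (M5 <= M)%N].
  by exists (M1 + M2 + M3 + M4 + M5).+1; split; lia.
pose a := sub_ladder R n M.
have [mr mrP] := choice (fun i => join_reverse (sub_ladder_path (R := R) n3 M0 i) (admP M M2M M0 i) h_rev hh_val).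
pose m := (m3 + m4 + \max_(i < n) mr i)%N.
(* Both signs are listed because a segment is reflected or not according to its place in the
   pair. *)
pose pts i := flatten [seq flatten [seq [:: F q.1; F q.2; - F q.1; - F q.2] | q <- a i j] | j <- iota 0 9].
have [t [flat4 avoid]] := generic_flag (flatten [seq pts i | i <- iota 0 n]).
pose D := degc (fun i => moment (t i)) 4.
have D_cocycle : locally_cocycle D by exact: degc_locally_cocycle.
pose L i g := join_cycle (a i) (fun w => D (map (reflect_label g) w)).
have revL i : (i < n)%N -> L i (fun x => hh (F x)) = - L i F.
  move=> ni; have m3m : (m3 <= m)%N by rewrite /m -addnA leq_addr.
  have m4m : (m4 <= m)%N by rewrite /m addnAC leq_addl.
  have mrm : (mr i <= m)%N.
    by rewrite /m; apply: leq_trans (leq_addl _ _); exact: (leq_bigmax (F := fun i : 'I_n => mr i) (Ordinal ni)).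
  have := mrP i m mrm D D_cocycle.
  by rewrite (refineP M m M3M M0 m3m i D D_cocycle) (refineP' M m M4M M0 m4m i D D_cocycle).
have moveL i : L i (fun x => hh (F x)) = L i (fun x => F (phi' x)).
  rewrite -[RHS](moveP M M1M M0 i D D_cocycle).
  apply: eq_join_cycle => e q q' he hq.
  have /andP[j9 k9] : (e.2.1 < 9)%N && (e.2.2 < 9)%N by move: e he {hq}; exact/allP.
  have [[K1 K2 _] [K1' K2' _]] : [/\ K q.1, K q.2 & `|F q.2 - F q.1| < 1] /\
      [/\ K q'.1, K q'.2 & `|F q'.2 - F q'.1| < 1].
    case: hq => -[qa q'a]; split.
    - exact: (meshP M M5M M0 i e.2.1 q).
    - exact: (meshP M M5M M0 i e.2.2 q').
    - exact: (meshP M M5M M0 i e.2.2 q).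
    - exact: (meshP M M5M M0 i e.2.1 q').
  by rewrite /= /reflect_label /= !Fphi.
have symL : \sum_(i <- iota 0 n) L i (fun x => F (phi' x)) = \sum_(i <- iota 0 n) L i F.
  pose Fc (w : seq (bool * P)) := D (map (reflect_label F) w).
  have altF : alternating Fc.
    by move=> w1 x y w2; rewrite /Fc !map_cat /=; exact: alternating_degc.
  rewrite -[RHS](ladder_sum_symmetry n3 M0 altF dihedral).
  by apply: eq_bigr => i _; congr join_cycle; apply/funext => w; rewrite /Fc -map_comp.
have oddL i k : i \in iota 0 n -> L i F <> 2 * k.
  move=> ni; apply: (join_cycle_odd (sub_ladder_path (R := R) n3 M0 i)).
  - by move=> k' b u v; exact: moment_linear.
  - exact: sub_ladder_src.
  - exact: sub_ladder_tgt.
  move=> e q q' he qa q'a w wq w4; refine (avoid w _ w4 _).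
    move=> v /wq vq; apply/flattenP; exists (pts i); first exact: map_f.
    have /andP[j9 k9] : (e.2.1 < 9)%N && (e.2.2 < 9)%N by move: e he {qa q'a}; exact/allP.
    have mem_pts j q0 : (j < 9)%N -> q0 \in a i j ->
        {subset [:: F q0.1; F q0.2; - F q0.1; - F q0.2] <= pts i}.
      move=> j0 q0a z zq; apply/flatten_mapP; exists j; first by rewrite mem_iota.
      by apply/flatten_mapP; exists q0.
    move: vq; rewrite /join_simplex /reflect_label /= !inE => /or4P[]/eqP->.
    - by apply: (mem_pts _ _ j9 qa); rewrite !inE eqxx !orbT.
    - by apply: (mem_pts _ _ j9 qa); rewrite !inE eqxx !orbT.
    - by apply: (mem_pts _ _ k9 q'a); rewrite !inE eqxx.
    - by apply: (mem_pts _ _ k9 q'a); rewrite !inE eqxx !orbT.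
  move=> w0; apply: (admP M M2M M0 i e q q' he (or_introl (conj qa q'a))).
  exact: hullS w0.
apply: (@odd_sum_neq0 (fun i => L i F) (iota 0 n)); [by rewrite size_iota|exact: oddL|].
have : \sum_(i <- iota 0 n) L i F = - \sum_(i <- iota 0 n) L i F.
  rewrite -{1}symL -sumrN [LHS]big_seq [RHS]big_seq; apply: eq_bigr => i.
  by rewrite mem_iota => /andP[_ ni]; rewrite -moveL revL.
lia.
Qed.

Lemma ladder_chiral (f : realization R G -> sphere3 R) : is_embedding f -> chiral (range f).
Proof.
move=> ef /(achiral_mirror ef)[h [hh h_rev [hh_val [phi [psi mr]]]]].
exact: ladder_not_mirror h_rev hh_val mr.
Qed.

End AchiralLadder.

Theorem corollary3p11 (R : realType) (N : nat) (hN : (2 <= N)%N) :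
  intrinsically_chiral R (moebius_ladder (2 * N + 1)%N).
Proof.
move=> f ef _; apply: ladder_chiral ef; first by lia.
by rewrite oddD mul2n odd_double.
Qed.
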